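(* Given $A\in\mathbb{Q}^{m\times d}$, $b\in\mathbb{Q}^m$ and $x^U\in\mathbb{Q}^d$ such that the system $Ax\le b$ is non-degenerate, $P=\{x\in\mathbb{R}^d\mid Ax\le b\}$ is bounded, and $x^U$ is a vertex of $P$, one can construct in strongly polynomial time a matrix $A_Q\in\mathbb{Q}^{(m+2)\times(d+1)}$ and a vector $b_Q\in\mathbb{Q}^{m+2}$ such that $Q=\{y\in\mathbb{R}^{d+1}\mid A_Qy\le b_Q\}$ is a simple rational rock extension of $P$ with at most $m+2$ facets and diameter at most $2(m-d+1)$.
   Context: The hyperplane arrangement $\mathcal{H}(A,b)$ of $Ax\le b$ is the family of hyperplanes $\{x\in\mathbb{R}^d\mid A_ix=b_i\}$, $i=1,\dots,m$, where $A_i$ (nonzero) is the $i$-th row of $A$; a vertex of $\mathcal{H}(A,b)$ is a point that is the intersection of some of these hyperplanes. A feasible system $Ax\le b$ is non-degenerate if each vertex of $\mathcal{H}(A,b)$ is contained in exactly $d$ of the $m$ hyperplanes. Rock extension of a polytope $P\subseteq\mathbb{R}^d$: for a system $A'x\le b'$ with $m'$ inequalities defining $P$ (possibly containing redundant inequalities), any polytope of the form $\{(x,z)\in\mathbb{R}^{d+1}\mid A'x+a'z\le b',\ z\ge0\}$ with $a'\in\mathbb{R}^{m'}_{>0}$. A $q$-dimensional polytope is simple if each vertex is contained in exactly $q$ facets. The diameter of a polytope is the smallest $\delta$ such that every two vertices are connected by a path with at most $\delta$ edges in its graph of vertices and one-dimensional faces. Strongly polynomial time: the number of bit operations is bounded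 by a polynomial in the entire input length (binary encoding size), and the number of arithmetic operations is bounded by a polynomial in the number of inequalities and the number of variables. *)

(* Defs.v *)
From HB Require Import structures.
From mathcomp Require Import all_boot all_order all_algebra.
From mathcomp Require Import boolp classical_sets functions cardinality reals.

Set Implicit Arguments.
Unset Strict Implicit.
Unset Printing Implicit Defensive.

Import Order.TTheory GRing.Theory Num.Theory.

Local Open Scope classical_set_scope.
Local Open Scope card_scope.
Local Open Scope ring_scope.

(** * Polyhedra *)

Section Polyhedra.
Variable R : realType.

Definition polyhedron m n (A : 'M[R]_(m, n)) (b : 'cV[R]_m) : set 'cV[R]_n :=
  [set x | forall i, (A *m x) i 0 <= b i 0].

Definition bounded_set n (S : set 'cV[R]_n) : Prop :=
  exists M : R, forall x, S x -> forall j, `|x j 0| <= M.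

Definition affinely_independent n k (p : 'I_k -> 'cV[R]_n) : Prop :=
  forall l : 'I_k -> R,
    \sum_i l i = 0 -> \sum_i l i *: p i = 0 -> forall i, l i = 0.

(* The affine dimension of S is k; it is defined only for nonempty S. *)
Definition has_dim n (S : set 'cV[R]_n) (k : nat) : Prop :=
  (exists p : 'I_k.+1 -> 'cV[R]_n,
      (forall i, S (p i)) /\ affinely_independent p) /\
  (forall p : 'I_k.+2 -> 'cV[R]_n,
      (forall i, S (p i)) -> ~ affinely_independent p).

(* Taking c = 0 shows that S itself and the empty set are faces. *)
Definition face n (S F : set 'cV[R]_n) : Prop :=
  exists (c : 'rV[R]_n) (delta : R),
    (forall x, S x -> (c *m x) 0 0 <= delta) /\
    F = S `&` [set x | (c *m x) 0 0 = delta].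

Definition vertex n (S : set 'cV[R]_n) (v : 'cV[R]_n) : Prop :=
  face S [set v].

Definition edge n (S F : set 'cV[R]_n) : Prop := face S F /\ has_dim F 1.

Definition facet n (S F : set 'cV[R]_n) : Prop :=
  face S F /\ exists k, has_dim S k.+1 /\ has_dim F k.

Definition simple_polytope n (S : set 'cV[R]_n) : Prop :=
  exists q, has_dim S q /\
    forall v, vertex S v -> [set F | facet S F /\ F v] #= `I_q.

Definition adjacent n (S : set 'cV[R]_n) (u v : 'cV[R]_n) : Prop :=
  [/\ vertex S u, vertex S v, u <> v & exists F, [/\ edge S F, F u & F v]].

(* The path visits u followed by the vertices listed in p, so that [size p] is
   its number of edges. *)
Definition connected_within n (S : set 'cV[R]_n) (k : nat) (u v : 'cV[R]_n) :
  Prop :=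
  exists p : seq 'cV[R]_n,
    [/\ path (fun x y => `[< adjacent S x y >]) u p, uniq (u :: p),
        last u p = v & (size p <= k)%N].

Definition diameter_at_most n (S : set 'cV[R]_n) (k : nat) : Prop :=
  forall u v, vertex S u -> vertex S v -> connected_within S k u v.

Definition is_diameter n (S : set 'cV[R]_n) (delta : nat) : Prop :=
  diameter_at_most S delta /\
  forall k, diameter_at_most S k -> (delta <= k)%N.

Definition hyperplane m n (A : 'M[R]_(m, n)) (b : 'cV[R]_m) (i : 'I_m) :
  set 'cV[R]_n := [set x | (A *m x) i 0 = b i 0].

Definition arrangement_vertex m n (A : 'M[R]_(m, n)) (b : 'cV[R]_m)
  (v : 'cV[R]_n) : Prop :=
  exists I : set 'I_m, \bigcap_(i in I) hyperplane A b i = [set v].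

(* The rows are required to be nonzero, so that every [hyperplane A b i] is
   a hyperplane.  The hyperplanes form a family: they are counted by index. *)
Definition non_degenerate m n (A : 'M[R]_(m, n)) (b : 'cV[R]_m) : Prop :=
  [/\ forall i, row i A != 0,
      exists x, polyhedron A b x &
      forall v, arrangement_vertex A b v ->
        #|[pred i | (A *m v) i 0 == b i 0]| = n].

(* A vector of dimension d + 1 is the pair of its first d entries x and of its
   last entry z. *)
Definition rock_polyhedron m d (A : 'M[R]_(m, d)) (a b : 'cV[R]_m) :
  set 'cV[R]_(d + 1) :=
  [set y | let x := usubmx y in let z := dsubmx y 0 0 in
           (forall i, (A *m x) i 0 + a i 0 * z <= b i 0) /\ 0 <= z].

Definition ratr_mx m n (A : 'M[rat]_(m, n)) : 'M[R]_(m, n) := map_mx ratr A.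

(* The system A' x <= b' that defines P may contain redundant inequalities.
   Rationality is imposed on the data of the rock extension themselves. *)
Definition rational_rock_extension d (P : set 'cV[R]_d)
  (Q : set 'cV[R]_(d + 1)) : Prop :=
  exists (m' : nat) (A' : 'M[rat]_(m', d)) (a' b' : 'cV[rat]_m'),
    [/\ P = polyhedron (ratr_mx A') (ratr_mx b'),
        forall i, 0 < a' i 0,
        Q = rock_polyhedron (ratr_mx A') (ratr_mx a') (ratr_mx b') &
        bounded_set Q].

End Polyhedra.

(** * Machine model

   Strong polynomiality is measured on a uniform random access machine, given
   by a structured language: natural-number registers hold the indices, and
   finitely many two-dimensional arrays (one per name occurring in the program)
   hold rational numbers.  The operations on rationals are +, -, *, / and
   comparison; in particular there is no rounding, and no access to the binary
   digits.  Data flow from rationals to indices only through comparisons.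

   Two costs are recorded: the number of elementary steps (arithmetic
   operations, comparisons, memory accesses, assignments and tests are all
   counted, including those on indices), and the number of bit operations.
   The latter charges an operation on numbers of encoding lengths s and t with
   (s + t) ^ 2, which up to a constant factor covers schoolbook arithmetic
   together with the reduction of fractions by Euclid's algorithm; an access
   to a number is charged with its encoding length. *)

Definition bitlen (n : nat) : nat := (trunc_log 2 n).+1.

Definition ratlen (x : rat) : nat :=
  (1 + bitlen `|numq x| + bitlen `|denq x|)%N.

Inductive iop := IAdd | ISub | IMul.

Inductive iexp :=
| IConst (n : nat)
| IReg (r : nat)
| IOp (o : iop) (e1 e2 : iexp).

Inductive qop := QAdd | QSub | QMul | QDiv.

Inductive qexp :=
| QConst (c : rat)
| QCell (a : nat) (i j : iexp)
| QOfIndex (e : iexp)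
| QOp (o : qop) (e1 e2 : qexp).

Inductive bexp :=
| BILe (e1 e2 : iexp)
| BQLe (e1 e2 : qexp)
| BNot (e : bexp)
| BAnd (e1 e2 : bexp).

Inductive cmd :=
| Skip
| ISet (r : nat) (e : iexp)
| QSet (a : nat) (i j : iexp) (e : qexp)
| Seq (c1 c2 : cmd)
| If (e : bexp) (c1 c2 : cmd)
| While (e : bexp) (c : cmd).

Record state := State {
  reg : nat -> nat;
  cell : nat -> nat -> nat -> rat
}.

Definition set_reg (s : state) (r n : nat) : state :=
  State (fun r' => if r' == r then n else reg s r') (cell s).

Definition set_cell (s : state) (a i j : nat) (x : rat) : state :=
  State (reg s) (fun a' i' j' =>
    if [&& a' == a, i' == i & j' == j] then x else cell s a' i' j').

(* Subtraction of indices is truncated. *)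
Definition iop_val (o : iop) (x y : nat) : nat :=
  match o with IAdd => x + y | ISub => x - y | IMul => x * y end%N.

(* Division by zero returns zero. *)
Definition qop_val (o : qop) (x y : rat) : rat :=
  match o with
  | QAdd => x + y | QSub => x - y | QMul => x * y | QDiv => x / y
  end.

Fixpoint ival (s : state) (e : iexp) : nat :=
  match e with
  | IConst n => n
  | IReg r => reg s r
  | IOp o e1 e2 => iop_val o (ival s e1) (ival s e2)
  end.

Fixpoint qval (s : state) (e : qexp) : rat :=
  match e with
  | QConst c => c
  | QCell a i j => cell s a (ival s i) (ival s j)
  | QOfIndex e => (ival s e)%:R
  | QOp o e1 e2 => qop_val o (qval s e1) (qval s e2)
  end.

Fixpoint bval (s : state) (e : bexp) : bool :=
  match e with
  | BILe e1 e2 => (ival s e1 <= ival s e2)%N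
  | BQLe e1 e2 => qval s e1 <= qval s e2
  | BNot e => ~~ bval s e
  | BAnd e1 e2 => bval s e1 && bval s e2
  end.

Local Open Scope nat_scope.

Fixpoint isteps (e : iexp) : nat :=
  match e with
  | IConst _ | IReg _ => 1
  | IOp _ e1 e2 => isteps e1 + isteps e2 + 1
  end.

Fixpoint qsteps (e : qexp) : nat :=
  match e with
  | QConst _ => 1
  | QCell _ i j => isteps i + isteps j + 1
  | QOfIndex e => isteps e + 1
  | QOp _ e1 e2 => qsteps e1 + qsteps e2 + 1
  end.

Fixpoint bsteps (e : bexp) : nat :=
  match e with
  | BILe e1 e2 => isteps e1 + isteps e2 + 1
  | BQLe e1 e2 => qsteps e1 + qsteps e2 + 1
  | BNot e => bsteps e + 1
  | BAnd e1 e2 => bsteps e1 + bsteps e2 + 1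
  end.

Fixpoint ibits (s : state) (e : iexp) : nat :=
  match e with
  | IConst _ | IReg _ => bitlen (ival s e)
  | IOp _ e1 e2 =>
      ibits s e1 + ibits s e2 + (bitlen (ival s e1) + bitlen (ival s e2)) ^ 2
  end.

Fixpoint qbits (s : state) (e : qexp) : nat :=
  match e with
  | QConst c => ratlen c
  | QCell _ i j => ibits s i + ibits s j + ratlen (qval s e)
  | QOfIndex e => ibits s e + bitlen (ival s e)
  | QOp _ e1 e2 =>
      qbits s e1 + qbits s e2 + (ratlen (qval s e1) + ratlen (qval s e2)) ^ 2
  end.

Fixpoint bbits (s : state) (e : bexp) : nat :=
  match e with
  | BILe e1 e2 =>
      ibits s e1 + ibits s e2 + (bitlen (ival s e1) + bitlen (ival s e2)) ^ 2
  | BQLe e1 e2 =>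
      qbits s e1 + qbits s e2 + (ratlen (qval s e1) + ratlen (qval s e2)) ^ 2
  | BNot e => bbits s e + 1
  | BAnd e1 e2 => bbits s e1 + bbits s e2 + 1
  end.

(* [exec c s s' t w]: started in state s, the program c halts in state s'
   after t elementary steps and w bit operations. *)
Inductive exec : cmd -> state -> state -> nat -> nat -> Prop :=
| exec_Skip s : exec Skip s s 1 1
| exec_ISet r e s :
    exec (ISet r e) s (set_reg s r (ival s e))
      (isteps e + 1) (ibits s e + bitlen (ival s e))
| exec_QSet a i j e s :
    exec (QSet a i j e) s (set_cell s a (ival s i) (ival s j) (qval s e))
      (isteps i + isteps j + qsteps e + 1)
      (ibits s i + ibits s j + qbits s e + ratlen (qval s e))
| exec_Seq c1 c2 s s' s'' t1 t2 w1 w2 :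
    exec c1 s s' t1 w1 -> exec c2 s' s'' t2 w2 ->
    exec (Seq c1 c2) s s'' (t1 + t2) (w1 + w2)
| exec_IfTrue e c1 c2 s s' t w :
    bval s e -> exec c1 s s' t w ->
    exec (If e c1 c2) s s' (bsteps e + t + 1) (bbits s e + w + 1)
| exec_IfFalse e c1 c2 s s' t w :
    ~~ bval s e -> exec c2 s s' t w ->
    exec (If e c1 c2) s s' (bsteps e + t + 1) (bbits s e + w + 1)
| exec_WhileStop e c s :
    ~~ bval s e -> exec (While e c) s s (bsteps e + 1) (bbits s e + 1)
| exec_WhileStep e c s s' s'' t1 t2 w1 w2 :
    bval s e -> exec c s s' t1 w1 -> exec (While e c) s' s'' t2 w2 ->
    exec (While e c) s s'' (bsteps e + t1 + t2 + 1) (bbits s e + w1 + w2 + 1).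

Local Close Scope nat_scope.

(** * Inputs and outputs *)

Definition num_cells m n (A : 'M[rat]_(m, n)) (i j : nat) : rat :=
  match insub i, insub j with
  | Some i', Some j' => (numq (A i' j'))%:~R
  | _, _ => 0
  end.

Definition den_cells m n (A : 'M[rat]_(m, n)) (i j : nat) : rat :=
  match insub i, insub j with
  | Some i', Some j' => (denq (A i' j'))%:~R
  | _, _ => 0
  end.

(* As in the binary encoding, each input rational is given by its numerator and
   its denominator, which are two integers: arrays 0 and 1 for A, 2 and 3 for
   b, 4 and 5 for x.  Registers 0 and 1 contain m and d. *)
Definition input_state m d (A : 'M[rat]_(m, d)) (b : 'cV[rat]_m)
  (x : 'cV[rat]_d) : state :=
  State (fun r => match r with 0 => m | 1 => d | _ => 0 end%N)
        (fun a => match a with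
         | 0 => num_cells A | 1 => den_cells A
         | 2 => num_cells b | 3 => den_cells b
         | 4 => num_cells x | 5 => den_cells x
         | _ => fun _ _ => 0%R
         end%N).

Definition mxlen m n (A : 'M[rat]_(m, n)) : nat :=
  (\sum_(i < m) \sum_(j < n) ratlen (A i j))%N.

Definition input_length m d (A : 'M[rat]_(m, d)) (b : 'cV[rat]_m)
  (x : 'cV[rat]_d) : nat :=
  (bitlen m + bitlen d + mxlen A + mxlen b + mxlen x)%N.

Definition array_contains (s : state) (a : nat) m n (A : 'M[rat]_(m, n)) :
  Prop := forall (i : 'I_m) (j : 'I_n), cell s a i j = A i j.

(* On input (A, b, x), the program writes AQ to array 6 and bQ to array 7,
   with at most T elementary steps and at most W bit operations. *)
Definition computes m d (prog : cmd) (A : 'M[rat]_(m, d)) (b : 'cV[rat]_m)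
  (x : 'cV[rat]_d) m' d' (AQ : 'M[rat]_(m', d')) (bQ : 'cV[rat]_m')
  (T W : nat) : Prop :=
  exists s t w,
    [/\ exec prog (input_state A b x) s t w,
        array_contains s 6 AQ, array_contains s 7 bQ,
        (t <= T)%N & (w <= W)%N].

(* Main.v *)
Require Import Defs.
From HB Require Import structures.
From mathcomp Require Import all_boot all_order all_algebra.
From mathcomp Require Import boolp classical_sets functions cardinality reals.
From mathcomp Require Import ring lra zify.

Set Implicit Arguments.
Unset Strict Implicit.
Unset Printing Implicit Defensive.

Import Order.TTheory GRing.Theory Num.Theory.

Local Open Scope classical_set_scope.
Local Open Scope card_scope.
Local Open Scope ring_scope.

(** If [c] is an interior point of P, the coefficients [a = b - A c] yield the
    pyramid over P with apex (c, 1). Take [a = b - A c - eta] instead, where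
    [eta_i >= 0] vanishes on d + 1 inequalities that describe a simplex around P
    (the d inequalities tight at [xU] and a redundant one), and where the other
    [eta_i] are positive and of very different magnitudes. With u = x - z c,
    inequality i reads [A_i u <= (1 - z) b_i + eta_i z].

    Eliminating u from the tight equations at a point with 0 < z < 1 by an
    integral dependency of their normals, whose entries are minors, bounds
    z / (1 - z) from below by a constant times 1 / max eta_i; boundedness of the
    simplex bounds it from above by a constant times 1 / eta_i, for every tight
    i. As the magnitudes are separated, the extension is simple, and leaving a
    vertex along the edge that drops the tight inequality with the largest
    eta_i (or z >= 0) increases z and decreases the largest eta_i. Hence the
    apex is reached after at most m - d + 1 edges.

    The program scales the input to integers and takes the [eta_i] close to a
    geometric progression whose ratio comes from a bound on the minors. It needs
    no linear algebra: for c, only the values [A_i c] for the inequalities tight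
    at [xU] matter, and these may be prescribed. *)

(** The apex of the exact pyramid lies on all [m] side hyperplanes, hence is far from simple;
    letting [eta] vanish on d + 1 inequalities only leaves exactly those tight there. Non-degeneracy
    enters through a single number: for the integral dependencies [l] of normals that are used, the
    product of [l] and [b] is a nonzero integer, so at least 1 in absolute value. The two-sided
    estimate of z / (1 - z) then turns the largest tight [eta_i] into a scale for the height: scales
    differ by more than all minors involved, so among the points with 0 < z < 1 a smaller scale
    always means a greater height. Outside the simplex there remain m + 1 - (d + 1) = m - d
    inequalities, hence m - d scales, and one more edge may be needed to leave the base. The upper
    estimate uses a simplex because its normals add up to zero, which makes all its dimensions
    explicit in terms of minors. The vertex [xU] itself cannot serve as the center, since the
    coefficients must be positive; the center is moved inward by an amount below every other
    scale. *)

Section Spread.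
Variables (F : fieldType) (p m : nat) (f : 'I_p -> 'I_m) (v : 'rV[F]_p).

(** Multiplication by [rowsub f 1%:M] turns coefficients for selected rows into coefficients for all
    rows, zero outside the image of [f]. *)
Lemma spread_image k : injective f -> (v *m rowsub f 1%:M) 0 (f k) = v 0 k.
Proof.
move=> finj; rewrite mxE (bigD1 k) //= !mxE eqxx mulr1 big1 ?addr0 // => j njk.
by rewrite !mxE (inj_eq finj) (negPf njk) mulr0.
Qed.

Lemma spread_notin (S : {set 'I_m}) i : (forall k, f k \in S) -> i \notin S ->
  (v *m rowsub f 1%:M) 0 i = 0.
Proof.
move=> fS iS; rewrite mxE big1 // => k _; rewrite !mxE.
case: eqP => [ek|_]; last by rewrite mulr0.
by move: iS; rewrite -ek fS.
Qed.

End Spread.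

(** * Independent and spanning sets of rows *)

Section RowSets.
Variables (F : fieldType) (M n : nat) (N : 'M[F]_(M, n)).
Implicit Types (S T : {set 'I_M}) (l : 'rV[F]_M) (r : 'cV[F]_n).

Definition supported S l : Prop := forall i, i \notin S -> l 0 i = 0.

(** Coefficient vectors keep the full index set and are restricted by their support, so that
    dependencies on different sets of rows can be compared directly. *)
Definition indep S : Prop := forall l, supported S l -> l *m N = 0 -> l = 0.

(** Rank [n] expressed by the absence of free directions: the form in which vertices are
    recognized. *)
Definition full S : Prop :=
  forall r, (forall i, i \in S -> (N *m r) i 0 = 0) -> r = 0.

Let sub S : 'M_(#|S|, n) := rowsub (@enum_val _ (mem S)) N.

Lemma indep_row_free S : indep S -> row_free (sub S).
Proof.
move=> hS; apply: inj_row_free => v hv.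
pose E : 'M[F]_(#|S|, M) := rowsub (@enum_val _ (mem S)) 1%:M.
have E0 : v *m E = 0.
  apply: hS; last by rewrite -mulmxA /E mul_rowsub_mx mul1mx.
  by move=> i; apply: spread_notin => k; apply: enum_valP.
by apply/rowP => k; rewrite -(spread_image v k (@enum_val_inj _ _)) -/E E0 !mxE.
Qed.

Lemma indep_card S : indep S -> (#|S| <= n)%N.
Proof. by move/indep_row_free/eqP => <-; exact: rank_leq_col. Qed.

Lemma indep_solve S (g : 'I_M -> F) : indep S ->
  exists r, forall i, i \in S -> (N *m r) i 0 = g i.
Proof.
move/indep_row_free => fS.
exists (pinvmx (sub S) *m \col_k g (enum_val k)) => i iS.
have := mulmxVp fS => e.
have /colP/(_ (enum_rank_in iS i)) :
    sub S *m (pinvmx (sub S) *m \col_k g (enum_val k)) = \col_k g (enum_val k).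
  by rewrite mulmxA e mul1mx.
by rewrite /sub mul_rowsub_mx !mxE (enum_rankK_in iS iS).
Qed.

Lemma full_subset S T : S \subset T -> full S -> full T.
Proof. by move=> /fintype.subsetP sST fS r hr; apply: fS => i /sST; exact: hr. Qed.

Lemma indep_subset S T : S \subset T -> indep T -> indep S.
Proof.
move=> /fintype.subsetP sST iT l hl; apply: iT => i; apply: contraNeq => li.
by apply: sST; apply: contraNT li => /hl ->.
Qed.

Lemma indep0 : indep finset.set0.
Proof. by move=> l hl _; apply/rowP => i; rewrite hl ?inE // mxE. Qed.

Lemma indep_full_card S : indep S -> full S -> #|S| = n.
Proof.
move=> iS fS; apply/eqP; rewrite eqn_leq indep_card //=.
suff : row_free (sub S)^T by move/eqP => <-; exact: rank_leq_col.
apply: inj_row_free => v hv; apply: trmx_inj; rewrite trmx0; apply: fS => i iS'.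
have /(congr1 trmx) := hv; rewrite trmx_mul trmxK trmx0.
move=> /colP/(_ (enum_rank_in iS' i)).
by rewrite /sub mul_rowsub_mx !mxE (enum_rankK_in iS' iS').
Qed.

Lemma indep_card_full S : indep S -> #|S| = n -> full S.
Proof.
move=> iS cS r hr; have fS := indep_row_free iS.
have uS : row_full (sub S) by rewrite /row_full (eqP fS) cS.
have e : sub S *m r = 0.
  rewrite /sub mul_rowsub_mx; apply/colP => i.
  by have := hr _ (enum_valP i); rewrite !mxE.
by rewrite -[r]mul1mx -(mulVpmx uS) -mulmxA e mulmx0.
Qed.

Lemma maximal_indep S T : S \subset T -> indep S -> exists S',
  [/\ S \subset S', S' \subset T, indep S' &
      forall j, j \in T -> j \notin S' -> ~ indep (j |: S')].
Proof.
move=> sST iS; pose P S0 := `[< indep S0 /\ S0 \subset T >].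
have [|S' /maxsetP [/asboolP [iS' sS'T] mS'] sSS'] := @maxset_exists _ P S.
  exact/asboolP.
exists S'; split=> // j jT jS' ij.
have e : j |: S' = S'.
  apply: mS'; last exact: finset.subsetUr.
  by apply/asboolP; split=> //; rewrite finset.subUset finset.sub1set jT.
by move: jS'; rewrite -e !inE eqxx.
Qed.

(** The dependency must involve [j], since [S] is independent; dividing by that coefficient solves
    for row [j]. *)
Lemma dependent_row S j : indep S -> ~ indep (j |: S) ->
  exists2 mu, supported S mu & row j N = mu *m N.
Proof.
move=> iS /existsNP [l] /not_implyP [hl] /not_implyP [l0 nl].
have lj : l 0 j != 0.
  apply/eqP => lj; apply: nl; apply: iS => // i iS'.
  by have [->//|ij] := eqVneq i j; apply: hl; rewrite !inE negb_or ij.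
exists (delta_mx 0 j - (l 0 j)^-1 *: l).
  move=> i iS'; rewrite !mxE eqxx /=.
  have [->|ij] := eqVneq i j; first by rewrite mulVf // subrr.
  have -> : l 0 i = 0 by apply: hl; rewrite !inE negb_or ij.
  by rewrite mulr0 subr0.
by rewrite mulmxBl -scalemxAl l0 scaler0 subr0 rowE.
Qed.

Lemma supported_mul0 S l r : supported S l ->
  (forall i, i \in S -> (N *m r) i 0 = 0) -> l *m (N *m r) = 0.
Proof.
move=> hl hr; apply/matrixP => i j; rewrite !ord1 mxE big1 ?mxE // => k _.
have [/hr ->|/hl ->] := boolP (k \in S); first by rewrite mulr0.
by rewrite mul0r.
Qed.

Lemma maximal_full S T : full T -> indep S ->
  (forall j, j \in T -> j \notin S -> ~ indep (j |: S)) -> full S.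
Proof.
move=> fT iS mS r hr; apply: fT => j jT.
have [/hr //|jS] := boolP (j \in S).
have [mu hmu e] := dependent_row iS (mS j jT jS).
have : row j N *m r = 0 by rewrite e -mulmxA (supported_mul0 hmu hr).
by rewrite -row_mul => /matrixP/(_ 0 0); rewrite [LHS]mxE [RHS]mxE.
Qed.

Lemma extend_basis S T : S \subset T -> indep S -> full T -> exists S',
  [/\ S \subset S', S' \subset T, indep S', full S' & #|S'| = n].
Proof.
move=> sST iS fT; have [S' [? ? iS' mS']] := maximal_indep sST iS.
have fS' := maximal_full fT iS' mS'.
by exists S'; split=> //; apply: indep_full_card.
Qed.

End RowSets.

(** * Polyhedra and simple systems of inequalities *)

Section Polyhedron.
Variables (R : realType) (M n : nat) (N : 'M[R]_(M, n)) (b : 'cV[R]_M).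
Implicit Types (y v w r : 'cV[R]_n) (J : {set 'I_M}).

Let Q := polyhedron N b.

Definition tight y : {set 'I_M} :=
  finset.finset (fun i => (N *m y) i 0 == b i 0).

Lemma in_tight y i : (i \in tight y) = ((N *m y) i 0 == b i 0).
Proof. by rewrite finset.inE. Qed.

Lemma tightP y i : reflect ((N *m y) i 0 = b i 0) (i \in tight y).
Proof. by rewrite in_tight; apply: eqP. Qed.

Lemma row_step y t r i :
  (N *m (y + t *: r)) i 0 = (N *m y) i 0 + t * (N *m r) i 0.
Proof. by rewrite mulmxDr -scalemxAr [LHS]mxE [X in _ + X]mxE. Qed.

Lemma tight_lt y i : Q y -> i \notin tight y -> (N *m y) i 0 < b i 0.
Proof. by move=> Qy; rewrite in_tight lt_neqAle => ->; rewrite Qy. Qed.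

Lemma small_step y r : Q y ->
  (forall i, i \in tight y -> (N *m r) i 0 <= 0) ->
  exists t, [/\ 0 < t, Q (y + t *: r) &
    forall i, i \notin tight y -> i \notin tight (y + t *: r)].
Proof.
move=> Qy hr.
(* Half of the step that reaches hyperplane [i], so that no inequality becomes tight on the way. *)
pose g i : R := if 0 < (N *m r) i 0
  then (b i 0 - (N *m y) i 0) / (N *m r) i 0 / 2 else 1.
have gt0 i : 0 < g i.
  rewrite /g; case: ifPn => // r0.
  have it : i \notin tight y.
    by apply/negP => /hr; rewrite leNgt r0.
  by rewrite !divr_gt0 // subr_gt0 tight_lt.
pose t := \big[Order.min/1]_i g i.
have t0 : 0 < t by apply: lt_bigmin.
have tg i : t <= g i by exact: bigmin_le.
have key i : i \notin tight y -> (N *m (y + t *: r)) i 0 < b i 0.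
  move=> it; rewrite row_step; have yi := tight_lt Qy it.
  have [r0|r0] := ltP 0 ((N *m r) i 0); last first.
    by rewrite (le_lt_trans _ yi) // gerDl mulr_ge0_le0 // ltW.
  have := tg i; rewrite /g r0 => ti.
  have : t * (N *m r) i 0 <= (b i 0 - (N *m y) i 0) / 2.
    by rewrite -ler_pdivlMr // mulrAC.
  by lra.
exists t; split=> //.
- move=> i; have [it|it] := boolP (i \in tight y); last exact/ltW/key.
  rewrite row_step (tightP _ _ it) gerDl mulr_ge0_le0 ?hr //; exact: ltW.
- by move=> i /key h; rewrite in_tight lt_eqF.
Qed.

(** The ratio test of the simplex method. The step [t] may be 0, if a blocking row is already tight
    at [y]. *)
Lemma ray_step y r j0 : Q y -> 0 < (N *m r) j0 0 ->
  exists t j, [/\ 0 <= t, Q (y + t *: r), 0 < (N *m r) j 0 &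
                  j \in tight (y + t *: r)].
Proof.
move=> Qy r0; pose f i := (b i 0 - (N *m y) i 0) / (N *m r) i 0.
case: (@arg_minP _ _ _ j0 (fun j => 0 < (N *m r) j 0) f r0) => j rj hj.
have fj : 0 <= f j by rewrite divr_ge0 ?subr_ge0 ?Qy // ltW.
exists (f j), j; split=> //.
- move=> i; rewrite row_step.
  have [ri|ri] := ltP 0 ((N *m r) i 0); last first.
    by rewrite (le_trans _ (Qy i)) // gerDl mulr_ge0_le0.
  by rewrite -lerBrDl -ler_pdivlMr // hj.
- by apply/tightP; rewrite row_step /f divfK ?gt_eqF // addrC subrK.
Qed.

Lemma positive_row r : bounded_set Q -> Q !=set0 -> r != 0 ->
  exists j, 0 < (N *m r) j 0.
Proof.
move=> [C hC] [y Qy] rn0; apply: contrapT => /forallNP hr.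
have [k rk] : exists k, r k 0 != 0.
  apply: contrapT => /forallNP h; move/eqP: rn0; apply; apply/colP => k.
  by rewrite mxE; apply/eqP; have /negP := h k; rewrite negbK.
have Qt t : 0 <= t -> Q (y + t *: r).
  move=> t0 i; rewrite row_step (le_trans _ (Qy i)) // gerDl mulr_ge0_le0 //.
  by rewrite leNgt; apply/negP/hr.
have C0 : 0 <= C by apply: le_trans (hC _ Qy k).
have nr : 0 < `|r k 0| by rewrite normr_gt0.
(* A step of this length pushes coordinate [k] out of the box of radius [C]. *)
pose t := (C + `|y k 0| + 1) / `|r k 0|.
have t0 : 0 <= t by rewrite divr_ge0 // addr_ge0 // addr_ge0.
have := hC _ (Qt t t0) k; rewrite !mxE.
have e : `|t * r k 0| = C + `|y k 0| + 1.
  by rewrite normrM (ger0_norm t0) divfK ?gt_eqF.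
have := lerB_normD (t * r k 0) (y k 0); rewrite e [t * _ + _]addrC.
by lra.
Qed.

Lemma unfull J : ~ full N J ->
  exists2 r : 'cV[R]_n, r != 0 & forall i, i \in J -> (N *m r) i 0 = 0.
Proof. by move=> /existsNP [r] /not_implyP [hr /eqP]; exists r. Qed.

(** While the tight rows leave a line free, one of its two directions does not decrease [g];
    boundedness blocks the ray at a row that was not tight, and the number of slack rows drops. This
    serves both to find vertices and to maximize a functional over [Q]. *)
Lemma climb y (g : 'rV[R]_n) : bounded_set Q -> Q y ->
  exists v, [/\ Q v, full N (tight v), tight y \subset tight v &
                (g *m y) 0 0 <= (g *m v) 0 0].
Proof.
move=> bQ; have [k] := ubnP #|(~: tight y)%SET|.
elim: k y => // k IH y; rewrite ltnS => ck Qy.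
have [fy|/unfull [r0 r0n hr0]] := pselect (full N (tight y)).
  by exists y.
have [r [rn hr gr]] : exists r : 'cV[R]_n, [/\ r != 0,
    forall i, i \in tight y -> (N *m r) i 0 = 0 & 0 <= (g *m r) 0 0].
  have [g0|g0] := leP 0 ((g *m r0) 0 0); first by exists r0.
  exists (- r0); split; rewrite ?oppr_eq0 //.
    by move=> i it; rewrite mulmxN mxE hr0 // oppr0.
  by rewrite mulmxN mxE oppr_ge0 ltW.
have [j0 rj0] := positive_row bQ (ex_intro _ y Qy) rn.
have [t [j [t0 Qt rj jt]]] := ray_step Qy rj0.
have sub : tight y \subset tight (y + t *: r).
  apply/fintype.subsetP => i it; apply/tightP.
  by rewrite row_step hr // mulr0 addr0; apply/tightP.
have ck' : (#|(~: tight (y + t *: r))%SET| < k)%N.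
  apply: leq_trans ck; apply: proper_card.
  rewrite fintype.properE finset.setCS sub /= finset.setCS.
  apply/negP => /fintype.subsetP/(_ j jt)/hr rj0'.
  by rewrite rj0' ltxx in rj.
have [v [Qv fv sv gv]] := IH _ ck' Qt.
exists v; split=> //; first exact: fintype.subset_trans sv.
apply: le_trans gv; rewrite mulmxDr -scalemxAr [X in _ <= X]mxE.
by rewrite [X in _ + X]mxE lerDl mulr_ge0.
Qed.

Lemma row_sum_mul J y :
  ((\sum_(i in J) row i N) *m y) 0 0 = \sum_(i in J) (N *m y) i 0.
Proof.
rewrite mulmx_suml summxE; apply: eq_bigr => i _.
by rewrite -row_mul mxE.
Qed.

Definition tight_face J : set 'cV[R]_n :=
  Q `&` [set y | forall i, i \in J -> i \in tight y].

(** The sum of the inequalities in [J] exposes the face: a sum of nonnegative slacks vanishes only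
    if every slack does. *)
Lemma face_tight_face J : face Q (tight_face J).
Proof.
exists (\sum_(i in J) row i N), (\sum_(i in J) b i 0); split.
  by move=> y Qy; rewrite row_sum_mul; apply: ler_sum => i _; apply: Qy.
apply/seteqP; split=> y [Qy] /=.
  by move=> hy; split=> //; rewrite row_sum_mul; apply: eq_bigr => i /hy /tightP.
rewrite row_sum_mul => e; split=> // i iJ; apply/tightP/eqP.
have : \sum_(i in J) (b i 0 - (N *m y) i 0) = 0.
  by rewrite sumrB e subrr.
move=> /eqP; rewrite psumr_eq0 => [/allP/(_ i)|k _]; last by rewrite subr_ge0 Qy.
by rewrite mem_index_enum iJ /= subr_eq0 eq_sym; exact.
Qed.

(** If the tight rows left a direction [r] free, small steps along [r] and [- r] would both stay in
    [Q], the functional exposing [v] would be constant along [r], and the face would contain a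
    second point. *)
Lemma vertexP v : vertex Q v <-> Q v /\ full N (tight v).
Proof.
split=> [[c [e [hc ev]]]|[Qv fv]]; last first.
  rewrite /vertex (_ : [set v] = tight_face (tight v)).
    exact: face_tight_face.
  apply/seteqP; split=> [_ ->|y [Qy hy]]; first by split.
  apply/eqP; rewrite -subr_eq0; apply/eqP/fv => i it.
  by rewrite mulmxBr mxE [X in _ + X]mxE (tightP _ _ (hy i it)) (tightP _ _ it) subrr.
have [Qv /= cv] : (Q `&` [set x | (c *m x) 0 0 = e]) v by rewrite -ev.
split=> //; apply: contrapT => /unfull [r rn hr].
have cS t (r' : 'cV[R]_n) : (c *m (v + t *: r')) 0 0 = e + t * (c *m r') 0 0.
  by rewrite mulmxDr -scalemxAr mxE [X in _ + X]mxE cv.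
have [|t [t0 Qt _]] := @small_step v r Qv; first by move=> i /hr ->.
have [|t' [t'0 Qt' _]] := @small_step v (- r) Qv.
  by move=> i it; rewrite mulmxN mxE hr ?oppr0.
have cN : (c *m - r) 0 0 = - (c *m r) 0 0 by rewrite mulmxN mxE.
have := hc _ Qt; have := hc _ Qt'; rewrite !cS cN mulrN.
rewrite gerDl oppr_le0 gerDl pmulr_rge0 // pmulr_rle0 // => h1 h2.
have c0 : (c *m r) 0 0 = 0 by apply: le_anti; rewrite h1 h2.
have : [set v] (v + t *: r) by rewrite ev; split=> //=; rewrite cS c0 mulr0 addr0.
move=> /= e1; have : t *: r = 0 by rewrite -[LHS](addKr v) e1 addNr.
by move/eqP; rewrite scaler_eq0 (negPf rn) orbF gt_eqF.
Qed.

End Polyhedron.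

Lemma has_dim_inj (R : realType) n (S : set 'cV[R]_n) k k' :
  has_dim S k -> has_dim S k' -> k = k'.
Proof.
wlog lt : k k' / (k < k')%N.
  move=> W hk hk'; case: (ltngtP k k') => // lt; first exact: W.
  by apply/esym; exact: W.
move=> [_ hk] [[p [Sp ip]] _]; have le : (k.+2 <= k'.+1)%N by [].
pose h := widen_ord le; have hinj : injective h.
  by move=> i j /(congr1 val) /= /val_inj.
case: (hk (p \o h)) => [i|l l0 lp i]; first exact: Sp.
pose l' j := \sum_(i | h i == j) l i.
have l'E i0 : l' (h i0) = l i0.
  by rewrite /l' (big_pred1 i0) // => j; rewrite (inj_eq hinj).
rewrite -l'E; apply: ip.
  by rewrite -[RHS]l0 [RHS](partition_big h predT).
rewrite -[RHS]lp [RHS](partition_big h predT) //=; apply: eq_bigr => j _.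
by rewrite scaler_suml; apply: eq_bigr => i' /eqP ->.
Qed.

Lemma dependent_rows (F : fieldType) a k (B : 'M[F]_(a, k)) : (k < a)%N ->
  exists2 l : 'rV_a, l != 0 & l *m B = 0.
Proof.
move=> ka; have : kermx B != 0.
  rewrite kermx_eq0 /row_free neq_ltn (leq_ltn_trans (rank_leq_col B)) //.
by move/rowV0Pn => [l /sub_kermxP l0 ln]; exists l.
Qed.

(** * Edges and facets when the tight rows are independent at every point *)

Section SimpleSystem.
Variables (R : realType) (M n : nat) (N : 'M[R]_(M, n)) (b : 'cV[R]_M).
Implicit Types (y v w r : 'cV[R]_n) (J : {set 'I_M}).

Let Q := polyhedron N b.

Hypothesis bQ : bounded_set Q.
Hypothesis iQ : forall y, Q y -> indep N (tight N b y).

(** Independence of the tight rows permits prescribing their values on a direction: -1 on row [j]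
    and 0 on the others gives the edge that leaves only hyperplane [j]. *)
Lemma edge_directions v : Q v -> exists r_ : 'I_M -> 'cV[R]_n,
  forall j, j \in tight N b v -> [/\ Q (v + r_ j), (N *m r_ j) j 0 < 0 &
    forall i, i \in tight N b v -> i != j -> (N *m r_ j) i 0 = 0].
Proof.
move=> Qv.
suff h j : exists r, j \in tight N b v ->
    [/\ Q (v + r), (N *m r) j 0 < 0 &
      forall i, i \in tight N b v -> i != j -> (N *m r) i 0 = 0].
  by have [r_ hr] := boolp.choice h; exists r_.
have [r hr] := indep_solve (fun i => if i == j then -1 else 0) (iQ Qv).
have [|t [t0 Qt _]] := @small_step _ _ _ N b v r Qv.
  by move=> i /hr ->; case: ifP; rewrite ?lerN10.
exists (t *: r) => jt; split=> //; last move=> i it ij.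
  by rewrite -scalemxAr mxE hr // eqxx mulrN1 oppr_lt0.
by rewrite -scalemxAr mxE hr // (negPf ij) mulr0.
Qed.

(** Near [v] the face is a simplicial cone with one edge for each tight row outside [J]. The ends of
    these edges together with [v] are affinely independent; conversely the values of the tight rows
    outside [J] are affine coordinates on the face. *)
Lemma tight_face_dim v J : Q v -> full N (tight N b v) ->
  J \subset tight N b v ->
  has_dim (tight_face N b J) #|(tight N b v :\: J)%SET|.
Proof.
move=> Qv fv /fintype.subsetP sJ; set D := (_ :\: _)%SET; split.
  have [r_ hr] := edge_directions Qv.
  have DT j : j \in D -> (j \notin J) /\ j \in tight N b v.
    by rewrite finset.inE => /andP.
  pose p (k : 'I_#|D|.+1) :=
    if unlift ord0 k is Some k' then v + r_ (enum_val k') else v.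
  have p0 : p ord0 = v by rewrite /p unlift_none.
  have pS k : p (lift ord0 k) = v + r_ (enum_val k) by rewrite /p liftK.
  exists p; split=> [k|l l0 lp].
    case: (unliftP ord0 k) => [k' ->|->]; last first.
      by rewrite p0; split=> // i /sJ.
    rewrite pS; have [jJ jt] := DT _ (enum_valP k').
    have [Qr _ r0] := hr _ jt; split=> // i iJ; apply/tightP.
    rewrite -[r_ _]scale1r row_step mul1r r0 ?addr0; first exact/tightP/sJ.
      exact: sJ.
    by apply: contraNneq jJ => <-.
  have lS k : l (lift ord0 k) = 0.
    have [jJ jt] := DT _ (enum_valP k); have [_ rj _] := hr _ jt.
    move: lp l0; rewrite !big_ord_recl p0.
    under eq_bigr do rewrite pS scalerDr.
    rewrite big_split /= -scaler_suml addrA -scalerDl => lp l0.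
    move: lp; rewrite l0 scale0r add0r => /(congr1 (fun z => (N *m z) (enum_val k) 0)).
    rewrite mulmx0 [RHS]mxE mulmx_sumr summxE (bigD1 k) //= big1 ?addr0.
      by rewrite -scalemxAr mxE => /eqP; rewrite mulf_eq0 (lt_eqF rj) orbF => /eqP.
    move=> k' nk; have [_ jt'] := DT _ (enum_valP k'); have [_ _ r0] := hr _ jt'.
    rewrite -scalemxAr mxE r0 ?mulr0 //.
    by apply: contraNneq nk => /enum_val_inj ->.
  move=> k; case: (unliftP ord0 k) => [k' ->|->] //.
  by move: l0; rewrite big_ord_recl big1 ?addr0.
move=> p Fp ip.
(* The column of ones makes a linear dependency of the rows of [B] an affine dependency of the
   points. *)
pose B : 'M[R]_(#|D|.+2, #|D|.+1) := \matrix_(k, j)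
  if unlift ord0 j is Some j' then (N *m p k) (enum_val j') 0 else 1.
have [l ln lB] := dependent_rows B (ltnSn _).
case/negP: ln; apply/eqP/rowP => k; rewrite mxE; apply: (ip (l 0)).
  move/rowP/(_ ord0): lB; rewrite !mxE => lB; rewrite -[RHS]lB.
  by apply: eq_bigr => i _; rewrite mxE unlift_none mulr1.
have sl : \sum_i l 0 i = 0.
  move/rowP/(_ ord0): lB; rewrite !mxE => lB; rewrite -[RHS]lB.
  by apply: eq_bigr => i _; rewrite mxE unlift_none mulr1.
apply: fv => i it; rewrite mulmx_sumr summxE.
have [iJ|iJ] := boolP (i \in J).
  rewrite (eq_bigr (fun k => l 0 k * b i 0)).
    by rewrite -mulr_suml sl mul0r.
  move=> k' _; rewrite -scalemxAr mxE; congr (_ * _).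
  by case: (Fp k') => _ /(_ i iJ)/tightP.
have iD : i \in D by rewrite finset.inE iJ.
move/rowP/(_ (lift ord0 (enum_rank_in iD i))): lB; rewrite !mxE => lB.
rewrite -[RHS]lB; apply: eq_bigr => k' _.
by rewrite -scalemxAr mxE [B _ _]mxE liftK enum_rankK_in.
Qed.

Lemma tight_face_set0 : tight_face N b finset.set0 = Q.
Proof.
apply/seteqP; split=> [y []//|y Qy]; split=> // i; by rewrite finset.inE.
Qed.

Lemma tight_card v : Q v -> full N (tight N b v) -> #|tight N b v| = n.
Proof. by move=> Qv fv; exact: indep_full_card (iQ Qv) fv. Qed.

Lemma polyhedron_dim v : Q v -> full N (tight N b v) -> has_dim Q n.
Proof.
move=> Qv fv; have := @tight_face_dim v finset.set0 Qv fv (finset.sub0set _).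
by rewrite tight_face_set0 finset.setD0 tight_card.
Qed.

Lemma tight_face1_dim v i : Q v -> full N (tight N b v) -> i \in tight N b v ->
  has_dim (tight_face N b [set i]%SET) n.-1.
Proof.
move=> Qv fv it; have := @tight_face_dim v [set i]%SET Qv fv.
rewrite finset.sub1set it => /(_ isT).
suff -> : #|(tight N b v :\ i)%SET| = n.-1 by [].
by have := tight_card Qv fv; rewrite (finset.cardsD1 i) it => /(congr1 predn).
Qed.

Lemma facet_tight_face1 v i : Q v -> full N (tight N b v) ->
  i \in tight N b v -> facet Q (tight_face N b [set i]%SET).
Proof.
move=> Qv fv it; split; first exact: face_tight_face.
exists n.-1; split; last exact: tight_face1_dim fv it.
have n0 : (0 < n)%N by rewrite -(tight_card Qv fv); apply/card_gt0P; exists i.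
by rewrite prednK //; exact: polyhedron_dim fv.
Qed.

Lemma adjacent_step v w k r t : Q v -> full N (tight N b v) ->
  Q w -> full N (tight N b w) -> w = v + t *: r -> k \in tight N b v ->
  v <> w -> (forall i, i \in tight N b v -> i != k -> (N *m r) i 0 = 0) ->
  adjacent Q v w.
Proof.
move=> Qv fv Qw fw ew kt vw hr; split=> //; try exact/vertexP.
exists (tight_face N b (tight N b v :\ k)%SET); split.
- split; first exact: face_tight_face.
  have := @tight_face_dim v (tight N b v :\ k)%SET Qv fv (finset.subsetDl _ _).
  rewrite finset.setDDr finset.setDv finset.set0U.
  by rewrite (finset.setIidPr _) ?finset.sub1set // finset.cards1.
- by split=> // i /finset.setD1P [].
- split=> // i /finset.setD1P [ik it]; apply/tightP.
  by rewrite ew row_step hr // mulr0 addr0; apply/tightP.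
Qed.

(** A simplex pivot that drops row [k]: boundedness ensures that the ray is blocked, and
    independence of the old tight rows that the step is positive and keeps the other tight rows. *)
Lemma pivot v k : Q v -> full N (tight N b v) -> k \in tight N b v ->
  exists r t, [/\ 0 < t, Q (v + t *: r), full N (tight N b (v + t *: r)),
                 adjacent Q v (v + t *: r) & k \notin tight N b (v + t *: r)] /\
    (forall i, i \in tight N b v -> (N *m r) i 0 = - (i == k)%:R).
Proof.
move=> Qv fv kt.
have [r hr] := indep_solve (fun i => - (i == k)%:R) (iQ Qv).
have rk : (N *m r) k 0 = -1 by rewrite hr // eqxx.
have rn : r != 0.
  by apply: contra_eq_neq rk => ->; rewrite mulmx0 mxE eq_sym oppr_eq0 oner_eq0.
have [j0 rj0] := positive_row bQ (ex_intro _ v Qv) rn.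
have [t [j [t0 Qw rj jw]]] := ray_step Qv rj0.
have r0 i : i \in tight N b v -> (N *m r) i 0 <= 0.
  by move=> /hr ->; rewrite oppr_le0 ler0n.
have tgt0 : 0 < t.
  rewrite lt_neqAle t0 andbT; apply/eqP => t00; move: jw.
  rewrite -t00 scale0r addr0 => /r0; by rewrite leNgt rj.
have rne i : i \in tight N b v -> i != k -> (N *m r) i 0 = 0.
  by move=> /hr -> /negPf ->; rewrite oppr0.
have fw : full N (tight N b (v + t *: r)).
  move=> s hs.
  (* A vector killed by the new tight rows can only be a multiple of [r], and the blocking row [j]
     does not kill [r]. *)
  have s0 : s + (N *m s) k 0 *: r = 0.
    apply: fv => i it; rewrite row_step.
    have [->|ik] := eqVneq i k; first by rewrite rk mulrN1 subrr.
    rewrite rne // mulr0 addr0; apply: hs; apply/tightP.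
    by rewrite row_step rne // mulr0 addr0; apply/tightP.
  have := hs _ jw; have -> : s = 0 + (- (N *m s) k 0) *: r.
    by rewrite add0r scaleNr; apply/eqP; rewrite -addr_eq0 s0.
  rewrite row_step mulmx0 mxE add0r => /eqP; rewrite mulf_eq0 (gt_eqF rj) orbF.
  by move=> /eqP ->; rewrite scale0r addr0.
exists r, t; split=> //; split=> //.
  apply: (adjacent_step (r := r) (t := t) (k := k)) => //.
  move=> e; have : t *: r = 0 by rewrite -[LHS](addKr v) -e addNr.
  by move/eqP; rewrite scaler_eq0 (negPf rn) orbF gt_eqF.
by rewrite in_tight row_step rk (tightP _ _ _ _ kt) mulrN1 -subr_eq0 addrAC subrr
  add0r oppr_eq0 gt_eqF.
Qed.

(** Some row is tight on all of [F], as otherwise [F] would contain a point where every inequality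
    is strict and would be all of [Q]. Comparing dimensions then leaves no room between [F] and the
    face of that row. *)
Lemma facet_is_tight_face F : facet Q F -> exists i,
  F = tight_face N b [set i]%SET.
Proof.
move=> [[c [e [hc eF]]] [k [dQ dF]]].
have [[p [Fp ip]] _] := dF.
have FQ y : F y -> Q y by rewrite eF => -[].
have Fc y : F y -> (c *m y) 0 0 = e by rewrite eF => -[].
have [i Fi] : exists i, forall y, F y -> i \in tight N b y.
  apply: contrapT => /forallNP noi.
  have /(@boolp.choice _ _ _) [f hf] :
      forall i : 'I_M, exists y, F y /\ i \notin tight N b y.
    move=> i; apply: contrapT => /forallNP h; apply: (noi i) => y Fy.
    by apply/negPn/negP => hi; apply: (h y).
  pose a : R := (M.+1)%:R^-1.
  have a0 : 0 < a by rewrite invr_gt0 ltr0n.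
  pose y0 := p ord0.
  (* The barycenter of points of [F], each row being slack at one of them. The additional point [y0]
     keeps the average meaningful when there are no rows. *)
  pose y := a *: (y0 + \sum_i f i).
  have Fy0 : F y0 by apply: Fp.
  have aS : a + \sum_(i < M) a = 1.
    rewrite sumr_const card_ord -mulrS -mulr_natr mulVf //.
    by rewrite pnatr_eq0.
  have yE m' (A : 'M[R]_(m', n)) i : (A *m y) i 0 =
      a * (A *m y0) i 0 + \sum_j a * (A *m f j) i 0.
    rewrite /y -scalemxAr mulmxDr mulmx_sumr [LHS]mxE.
    have -> (U V : 'M[R]_(m', 1)) : (U + V) i 0 = U i 0 + V i 0 by rewrite mxE.
    by rewrite mulrDr summxE mulr_sumr.
  have ylt i : (N *m y) i 0 < b i 0.
    rewrite yE -[ltRHS]mul1r -aS mulrDl mulr_suml.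
    apply: ler_ltD; first by rewrite ler_pM2l // FQ.
    rewrite [ltLHS](bigD1 i) //= [ltRHS](bigD1 i) //=.
    apply: ltr_leD.
      by rewrite ltr_pM2l // tight_lt; [|apply: FQ|]; have [] := hf i.
    by apply: ler_sum => j _; rewrite ler_pM2l // FQ //; have [] := hf j.
  have cy : (c *m y) 0 0 = e.
    rewrite yE Fc // (eq_bigr (fun=> a * e)); last first.
      by move=> j _; rewrite Fc //; have [] := hf j.
    by rewrite -mulr_suml -mulrDl aS mul1r.
  have Qy : Q y by move=> i; apply/ltW.
  have ty : tight N b y = finset.set0.
    by apply/finset.setP => i; rewrite in_tight finset.in_set0 lt_eqF.
  clearbody y.
  have c0 r : (c *m r) 0 0 <= 0.
    have [|t [t0 Qt _]] := @small_step _ _ _ N b y r Qy.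
      by move=> i; rewrite ty finset.in_set0.
    have := hc _ Qt; rewrite mulmxDr -scalemxAr mxE cy [X in _ + X]mxE.
    by rewrite gerDl pmulr_rle0.
  have c00 r : (c *m r) 0 0 = 0.
    apply: le_anti; rewrite c0 /=; have := c0 (- r).
    by rewrite mulmxN mxE oppr_le0.
  have QF : Q = F.
    apply/seteqP; split=> y' // Qy'; last exact: FQ.
    by rewrite eF; split=> //=; rewrite c00 -cy c00.
  by move: dQ; rewrite QF => /(has_dim_inj dF)/eqP; rewrite ltn_eqF.
exists i.
have [v [Qv fv sv _]] := climb (0 : 'rV[R]_n) bQ (FQ _ (Fp ord0)).
have it : i \in tight N b v by apply: (fintype.subsetP sv); apply/Fi/Fp.
have en : n.-1 = k by rewrite -(has_dim_inj dQ (polyhedron_dim Qv fv)).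
have := tight_face1_dim Qv fv it; rewrite en => -[_ hF].
apply/seteqP; split=> [y Fy|y [Qy ty]].
  by split; [exact: FQ|move=> j /finset.set1P ->; exact: Fi].
rewrite eF; split=> //=; apply: contrapT => /eqP cy.
(* A point of the tight face outside [F] would extend the affinely independent points of [F],
   exceeding the dimension of the tight face. *)
apply: (hF (fun j => if unlift ord0 j is Some j' then p j' else y)).
  move=> j; case: unliftP => [j' _|_]; last by split.
  by split; [apply/FQ|move=> j0 /finset.set1P ->; apply: Fi].
move=> l l0 lp.
have eS (f : 'I_k.+1 -> 'cV[R]_n) : \sum_(j < k.+2)
    l j *: (if unlift ord0 j is Some j' then f j' else y) =
    l ord0 *: y + \sum_j l (lift ord0 j) *: f j.
  rewrite big_ord_recl unlift_none; congr (_ + _).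
  by apply: eq_bigr => j _; rewrite liftK.
move: lp l0; rewrite eS => lp; rewrite big_ord_recl => l0.
have l00 : l ord0 = 0.
  move/(congr1 (fun z => (c *m z) 0 0)): (lp).
  rewrite mulmx0 [RHS]mxE mulmxDr [LHS]mxE -scalemxAr [X in X + _]mxE mulmx_sumr summxE.
  rewrite (eq_bigr (fun j => l (lift ord0 j) * e)); last first.
    by move=> j _; rewrite -scalemxAr mxE Fc.
  rewrite -mulr_suml; have -> : \sum_j l (lift ord0 j) = - l ord0.
    by apply/eqP; rewrite -addr_eq0 addrC l0.
  move=> /eqP; have -> (u z : R) : u * z + - u * e = u * (z - e) by ring.
  rewrite mulf_eq0 subr_eq0 => /orP [/eqP//|/eqP h].
  by rewrite h eqxx in cy.
move=> j; case: (unliftP ord0 j) => [j' ->|-> //].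
apply: (ip (fun j => l (lift ord0 j))).
  by move: l0; rewrite l00 add0r.
by move: lp; rewrite l00 scale0r add0r.
Qed.

Lemma facet_count : [set F | facet Q F] #<= `I_M.
Proof.
pose f i := tight_face N b [set i]%SET.
rewrite (card_le_eqr card_II).
apply: (card_le_trans _ (card_image_le f _)).
by apply: subset_card_le => F /facet_is_tight_face [i ->]; exists i.
Qed.

(** Distinct tight rows give distinct facets: the edge that leaves only hyperplane [j] remains in
    the facets of all other tight rows. *)
Lemma simple_system_simple v : Q v -> full N (tight N b v) -> simple_polytope Q.
Proof.
move=> Qv fv; exists n; split; first exact: polyhedron_dim fv.
move=> w /vertexP [Qw fw].
pose f i := tight_face N b [set i]%SET.
have -> : [set F | facet Q F /\ F w] = f @` [set` tight N b w].
  apply/seteqP; split=> [F [/facet_is_tight_face [i ->] [_ /= hw]]|_ [i /= it <-]].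
    by exists i => //=; apply: hw; rewrite finset.set11.
  split; first exact: facet_tight_face1 fw it.
  by split=> // j /finset.set1P ->.
have /card_eql -> : f @` [set` tight N b w] #= [set` tight N b w].
  apply: inj_card_eq => i j; rewrite !inE /= => it jt.
  apply: contra_eq => ij; apply/eqP => eij.
  have [r_ hr] := edge_directions Qw.
  have [Qr rj r0] := hr _ jt.
  have : f i (w + r_ j).
    split=> // i' /finset.set1P ->; apply/tightP.
    rewrite -[r_ j]scale1r row_step mul1r r0 // addr0; exact/tightP.
  rewrite eij => -[_ /(_ j (finset.set11 j))/tightP].
  rewrite -[r_ j]scale1r row_step mul1r (tightP _ _ _ _ jt) => /eqP.
  by rewrite -subr_eq0 addrAC subrr add0r lt_eqF.
suff : [set` tight N b w] #= `I_#|tight N b w| by rewrite (tight_card Qw fw).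
rewrite (card_eqr card_II).
have -> : [set` tight N b w] = enum_val @` [set: 'I_#|tight N b w|].
  apply/seteqP; split=> [i it|_ [k _ <-]] /=; last exact: enum_valP.
  by exists (enum_rank_in it i) => //; rewrite enum_rankK_in.
by apply: inj_card_eq => i j _ _ /enum_val_inj.
Qed.

End SimpleSystem.

(** * Rock extensions with separated rates *)

Lemma ext_cases m (i : 'I_(m + 1)) :
  (exists j, i = lshift 1 j) \/ i = rshift m 0.
Proof.
by case: (split_ordP i) => j ->; [left; exists j|right; rewrite (ord1 j)].
Qed.

Section Rock.
Variables (R : realType) (M d : nat) (A : 'M[R]_(M, d)) (b a : 'cV[R]_M).
Variables (J : {set 'I_M}) (c : 'cV[R]_d) (K C rho : R).

Definition rock_mx : 'M[R]_(M + 1, d + 1) := block_mx A a 0 (-1).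
Definition rock_rhs : 'cV[R]_(M + 1) := col_mx b 0.

Let N := rock_mx.
Let be := rock_rhs.
Let Q := polyhedron N be.

(* Hyperplane [i] meets the vertical line through [c] at height
   [1 + rate i / a i], slightly above the apex [(c, 1)]. *)
Definition rate i : R := b i 0 - (A *m c) i 0 - a i 0.
Definition dot (l : 'rV[R]_M) (f : 'I_M -> R) : R := \sum_i l 0 i * f i.

Definition height (y : 'cV[R]_(d + 1)) : R := dsubmx y 0 0.
Definition shadow (y : 'cV[R]_(d + 1)) : 'cV[R]_d :=
  usubmx y - height y *: c.
Definition rock_row (i : 'I_M) : 'I_(M + 1) := lshift 1 i.
Definition base_row : 'I_(M + 1) := rshift M 0.

Hypothesis J_rate : forall i, i \in J -> rate i = 0.
Hypothesis rate_gt0 : forall i, i \notin J -> 0 < rate i.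
(** At height z the rows of [J], whose rates vanish, confine the shadow to the simplex scaled by
    [s = 1 - z]. A negative factor leaves nothing, the factor 0 a single point, and in general the
    violation of any other row is at most a multiple of [s]. *)
Hypothesis simplex_ge0 : forall (u : 'cV[R]_d) s,
  (forall i, i \in J -> (A *m u) i 0 <= s * b i 0) -> 0 <= s.
Hypothesis simplex_apex : forall u : 'cV[R]_d,
  (forall i, i \in J -> (A *m u) i 0 <= 0) -> u = 0.
Hypothesis simplex_bound : forall (u : 'cV[R]_d) s k, k \notin J ->
  (forall i, i \in J -> (A *m u) i 0 <= s * b i 0) ->
  (A *m u) k 0 - s * b k 0 <= C * s.
(** Quantitative general position: hyperplanes with dependent normals have no common point, because
    such a point would make the product of [l] and [b] zero. Integrality provides the lower bounds
    by 1. *)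
Hypothesis dependency : forall T : {set 'I_M}, ~ indep A T ->
  exists l, [/\ supported T l, l *m A = 0, 1 <= `|dot l (fun i => b i 0)|,
    \sum_i `|l 0 i| <= K & forall i, l 0 i != 0 -> 1 <= `|l 0 i|].
Hypothesis rate_gap : forall i j, i \notin J -> j \notin J -> i != j ->
  rate i <= rate j -> rate i <= rho * rate j.
Hypotheses (rho_ge0 : 0 <= rho) (rho_le1 : rho <= 1) (K_rho : K * rho < 1) (CK_rho : C * K * rho < 1).
Hypotheses (K_ge0 : 0 <= K) (C_ge0 : 0 <= C).
Hypothesis J_card : #|J| = d.+1.
Hypothesis J_dep : forall l, supported J l -> l *m A = 0 ->
  dot l (fun i => b i 0) = 0 -> l = 0.
Hypothesis bQ : bounded_set Q.

Implicit Types (y v w r : 'cV[R]_(d + 1)) (l : 'rV[R]_M) (T : {set 'I_M}).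

Lemma rock_rowE y i : (N *m y) (rock_row i) 0 =
  (A *m shadow y) i 0 + height y * (b i 0 - rate i).
Proof.
rewrite /N /rock_mx -{1}[y]vsubmxK mul_block_col col_mxEu.
rewrite /shadow mulmxBr -scalemxAr /rate /height.
rewrite [in LHS]mxE [X in _ = X + _]mxE [X in _ = _ + X + _]mxE.
rewrite [X in - X]mxE [X in _ + X = _]mxE big_ord1; ring.
Qed.

Lemma base_rowE y : (N *m y) base_row 0 = - height y.
Proof.
rewrite /N /rock_mx -{1}[y]vsubmxK mul_block_col col_mxEd mul0mx add0r.
by rewrite mulNmx mul1mx mxE.
Qed.

Lemma be_rock i : be (rock_row i) 0 = b i 0.
Proof. by rewrite /be /rock_rhs col_mxEu. Qed.

Lemma be_base : be base_row 0 = 0.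
Proof. by rewrite /be /rock_rhs col_mxEd mxE. Qed.

Lemma row_cases (i : 'I_(M + 1)) : (exists j, i = rock_row j) \/ i = base_row.
Proof. exact: ext_cases. Qed.

Definition rock_tight y : {set 'I_M} :=
  finset.finset (fun i => rock_row i \in tight N be y).

Lemma in_rock_tight y i : (i \in rock_tight y) = (rock_row i \in tight N be y).
Proof. by rewrite finset.inE. Qed.

Lemma rock_le y i : Q y ->
  (A *m shadow y) i 0 <= (1 - height y) * b i 0 + rate i * height y.
Proof. by move/(_ (rock_row i)); rewrite rock_rowE be_rock; lra. Qed.

Lemma rock_tightP y i : reflect
  ((A *m shadow y) i 0 = (1 - height y) * b i 0 + rate i * height y)
  (i \in rock_tight y).
Proof.
rewrite in_rock_tight; apply: (iffP (tightP _ _ _ _));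
  rewrite rock_rowE be_rock => e; lra.
Qed.

Lemma base_tight y : (base_row \in tight N be y) = (height y == 0).
Proof. by rewrite in_tight base_rowE be_base oppr_eq0. Qed.

Lemma height_ge0 y : Q y -> 0 <= height y.
Proof. by move/(_ base_row); rewrite base_rowE be_base oppr_le0. Qed.

Lemma rate_ge0 i : 0 <= rate i.
Proof. by have [/J_rate ->|/rate_gt0/ltW] := boolP (i \in J). Qed.

Lemma J_le y : Q y ->
  forall i, i \in J -> (A *m shadow y) i 0 <= (1 - height y) * b i 0.
Proof. by move=> Qy i iJ; have := rock_le i Qy; rewrite J_rate // mul0r addr0. Qed.

Lemma height_le1 y : Q y -> height y <= 1.
Proof. by move=> /J_le /simplex_ge0; rewrite subr_ge0. Qed.

Lemma dot_mul0 l (u : 'cV[R]_d) : l *m A = 0 ->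
  dot l (fun i => (A *m u) i 0) = 0.
Proof.
move=> lA; have := congr1 (fun B => (B *m u) 0 0) lA.
by rewrite /= mul0mx -mulmxA mxE [RHS]mxE.
Qed.

Lemma dotD l f g : dot l (fun i => f i + g i) = dot l f + dot l g.
Proof. by rewrite /dot -big_split; apply: eq_bigr => i _; rewrite mulrDr. Qed.

Lemma dotZ l e f : dot l (fun i => e * f i) = e * dot l f.
Proof. by rewrite /dot mulr_sumr; apply: eq_bigr => i _; ring. Qed.

Lemma eq_dot T l f g : supported T l -> (forall i, i \in T -> f i = g i) ->
  dot l f = dot l g.
Proof.
move=> hl fg; apply: eq_bigr => i _.
by have [/fg ->//|/hl ->] := boolP (i \in T); rewrite !mul0r.
Qed.

Lemma dot_rate_le T l e : supported T l -> \sum_i `|l 0 i| <= K -> 0 <= e ->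
  (forall i, i \in T -> rate i <= e) -> `|dot l rate| <= K * e.
Proof.
move=> hl lK e0 he; apply: le_trans (ler_norm_sum _ _ _) _.
apply: le_trans (ler_wpM2r e0 lK); rewrite mulr_suml; apply: ler_sum => i _.
rewrite normrM (ger0_norm (rate_ge0 i)).
have [/he h|/hl ->] := boolP (i \in T); first by rewrite ler_wpM2l.
by rewrite normr0 !mul0r.
Qed.

(* Substituting the tight equations of [y] into a dependency of their normals
   eliminates the shadow and leaves a relation between height and depth. *)
Lemma dependency_time y l : supported (rock_tight y) l -> l *m A = 0 ->
  (1 - height y) * dot l (fun i => b i 0) = - (height y * dot l rate).
Proof.
move=> hl lA; have := dot_mul0 (shadow y) lA.
rewrite (eq_dot (g := fun i => (1 - height y) * b i 0 + height y * rate i) hl).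
  by rewrite dotD !dotZ => /eqP; rewrite addr_eq0 => /eqP.
by move=> i /rock_tightP ->; rewrite [rate i * _]mulrC.
Qed.

(** In the relation of [dependency_time] the left-hand product is at least the depth [1 - height y],
    and the right-hand one is controlled by the rates on [T]. A proper subset [T] of the tight rows
    is allowed, so that the row of largest rate can be left out. *)
Lemma time_le y T e : Q y -> T \subset rock_tight y -> ~ indep A T ->
  0 <= e -> (forall i, i \in T -> rate i <= e) ->
  1 - height y <= height y * (K * e).
Proof.
move=> Qy /fintype.subsetP sT /dependency [l [hl lA lb lK _]] e0 he.
have hl' : supported (rock_tight y) l.
  by move=> i it; apply: hl; apply: contra it => /sT.
have s0 : 0 <= 1 - height y by rewrite subr_ge0 height_le1.
have z0 := height_ge0 Qy.
have /(congr1 Num.norm) := dependency_time hl' lA.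
rewrite normrN !normrM (ger0_norm s0) (ger0_norm z0) => e1.
apply: le_trans (_ : height y * `|dot l rate| <= _); last first.
  by apply: ler_wpM2l => //; apply: (dot_rate_le hl).
by rewrite -e1 ler_peMr.
Qed.

(** Tightness of row [k] means that the shadow violates the scaled inequality by exactly
    [rate k * height y], and the simplex bounds such violations. *)
Lemma time_ge y k : Q y -> k \in rock_tight y -> k \notin J ->
  rate k * height y <= C * (1 - height y).
Proof.
move=> Qy /rock_tightP e kJ; have := simplex_bound kJ (J_le Qy).
by rewrite e addrAC subrr add0r.
Qed.

Definition top y k := [/\ k \in rock_tight y, k \notin J &
  forall i, i \in rock_tight y -> i != k -> rate i <= rho * rate k].

(** A tight row outside [J] has positive rate, so the row of maximal rate is outside [J] as well,
    and the gap hypothesis separates it from all other tight rows. *)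
Lemma top_exists y : ~~ (rock_tight y \subset J) -> exists k, top y k.
Proof.
move=> /fintype.subsetPn [k0 k0t k0J].
case: (@arg_maxP _ _ _ k0 (mem (rock_tight y)) rate k0t) => k /= kt hk.
have kJ : k \notin J.
  by apply/negP => /J_rate e; have := hk _ k0t; rewrite e leNgt rate_gt0.
exists k; split=> // i it ik.
have [/J_rate ->|iJ] := boolP (i \in J).
  by rewrite mulr_ge0 ?rate_ge0.
by apply: rate_gap => //; apply: hk.
Qed.

Lemma flat_indep y : Q y -> height y < 1 -> rock_tight y \subset J ->
  indep A (rock_tight y).
Proof.
move=> Qy z1 /fintype.subsetP sJ; apply: contrapT => ni.
have /= := time_le Qy (fintype.subxx _) ni (lexx 0).
rewrite !mulr0 subr_le0 leNgt z1 => h.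
by apply: notF; apply: h => i /sJ /J_rate ->.
Qed.

(** A dependency that avoids [k] would put [y] at a height of the order of [1 / (rho * rate k)] in
    terms of z / (1 - z), whereas tightness of [k] allows at most the order of [1 / rate k];
    [CK_rho] makes these incompatible. *)
Lemma top_indep y k : Q y -> 0 < height y -> top y k ->
  indep A (rock_tight y :\ k)%SET.
Proof.
move=> Qy z0 [kt kJ hk]; apply: contrapT => ni.
have rk := rate_gt0 kJ.
have e0 : 0 <= rho * rate k by rewrite mulr_ge0 // ltW.
have /= h1 := time_le Qy (finset.subsetDl _ _) ni e0.
have {}h1 : 1 - height y <= height y * (K * (rho * rate k)).
  by apply: h1 => i /finset.setD1P [ik it]; apply: hk.
have h2 := time_ge Qy kt kJ.
have h3 := ler_wpM2l C_ge0 h1.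
have zr : 0 < height y * rate k by rewrite mulr_gt0.
have : C * K * rho * (height y * rate k) < height y * rate k.
  by rewrite -[ltRHS]mul1r ltr_pM2r.
by lra.
Qed.

Lemma apex_shadow y : Q y -> height y = 1 -> shadow y = 0.
Proof.
move=> Qy z1; apply: simplex_apex => i /(J_le Qy).
by rewrite z1 subrr mul0r.
Qed.

(** Simplicity in its strongest form, at all points of [Q]. The argument differs at the base, at the
    apex and strictly between them. *)
Lemma rock_tight_indep y : Q y -> indep N (tight N be y).
Proof.
move=> Qy L hL LN; rewrite -[L]hsubmxK.
set l := lsubmx L; set l2 := rsubmx L.
have hl : supported (rock_tight y) l.
  by move=> i; rewrite in_rock_tight => /hL; rewrite mxE.
have [lA la] : l *m A = 0 /\ l *m a = l2.
  move: LN; rewrite -[L]hsubmxK /N /rock_mx mul_row_block mulmx0 addr0.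
  rewrite -/l -/l2 mulmxN mulmx1 -[RHS]row_mx0 => /eq_row_mx [-> /eqP].
  by rewrite subr_eq0 => /eqP.
suff l0 : l = 0 by rewrite -la l0 mul0mx row_mx0.
have dlA : dot l (fun i => a i 0) = l2 0 0 by rewrite -la mxE.
(* At height 0, [dependency_time] makes the product of [b] with any dependency of tight rows vanish,
   against the bound by 1. *)
have [z0|z0] := eqVneq (height y) 0.
  apply: (contrapT _ : indep A (rock_tight y)) => //; move=> /dependency.
  move=> [l' [hl' lA' lb' _ _]].
  have := dependency_time hl' lA'; rewrite z0 subr0 mul1r mul0r oppr0 => e.
  by rewrite e normr0 ler10 in lb'.
have zgt : 0 < height y by rewrite lt_neqAle eq_sym z0 height_ge0.
have l20 : l2 0 0 = 0.
  by rewrite mxE; apply: hL; rewrite base_tight.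
have lb0 : dot l (fun i => b i 0) = dot l rate.
  have -> : dot l rate = dot l (fun i => b i 0) +
      -1 * dot l (fun i => (A *m c) i 0) + -1 * dot l (fun i => a i 0).
    by rewrite -!dotZ -!dotD; apply: eq_bigr => i _; rewrite /rate; ring.
  by rewrite dot_mul0 // dlA l20 !mulr0 !addr0.
(* At the apex only the rows of [J] are tight, and their rates vanish. *)
have [z1|z1] := eqVneq (height y) 1.
  have sJ : supported J l.
    move=> i iJ; apply: hl; apply/negP => /rock_tightP.
    rewrite apex_shadow // mulmx0 mxE z1 subrr mul0r add0r mulr1 => /esym/eqP.
    by rewrite gt_eqF // rate_gt0.
  apply: J_dep => //; rewrite lb0 (eq_dot (g := fun=> 0) sJ) //.
  by rewrite /dot big1 // => i _; rewrite mulr0.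
have zlt : height y < 1 by rewrite lt_neqAle z1 height_le1.
have [/(flat_indep Qy zlt)|/top_exists [k tk]] := boolP (rock_tight y \subset J).
  exact.
have ik := top_indep Qy zgt tk.
have [lk|lk] := eqVneq (l 0 k) 0.
  apply: ik => // i; rewrite finset.in_setD1 negb_and negbK.
  by case/orP => [/eqP -> //|/hl].
have /dependency [l' [hl' lA' lb' _ _]] : ~ indep A (rock_tight y).
  by move=> /(_ l hl lA) e; rewrite e mxE eqxx in lk.
(* Removing [k] makes the rows independent, so all dependencies of the tight rows are
   proportional. *)
clearbody l; have el : l' = (l' 0 k / l 0 k) *: l.
  apply/eqP; rewrite -subr_eq0; apply/eqP; apply: ik.
    move=> i; rewrite finset.in_setD1 negb_and negbK => /orP [/eqP ->|it].
      by rewrite !mxE divfK // subrr.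
    by rewrite !mxE (hl' i it) (hl i it) mulr0 subrr.
  by rewrite mulmxBl -scalemxAl lA lA' scaler0 subrr.
(* The column of heights gives [l] the same product with [b] as with [rate], while [dependency_time]
   relates the two products with opposite signs. *)
have lb00 : dot l (fun i => b i 0) = 0.
  have := dependency_time hl lA; rewrite -lb0 => e; lra.
have dotl x : dot (x *: l) (fun i => b i 0) = x * dot l (fun i => b i 0).
  by rewrite /dot mulr_sumr; apply: eq_bigr => i _; rewrite mxE mulrA.
by move: lb'; rewrite el dotl lb00 mulr0 normr0 ler10.
Qed.

Definition apex : 'cV[R]_(d + 1) := col_mx c 1.

Lemma height_apex : height apex = 1.
Proof. by rewrite /height /apex col_mxKd mxE eqxx. Qed.

Lemma apexP y : Q y -> height y = 1 -> y = apex.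
Proof.
move=> Qy z1; have := apex_shadow Qy z1.
rewrite /shadow z1 scale1r => /eqP; rewrite subr_eq0 => /eqP e.
rewrite -[y]vsubmxK e /apex; congr col_mx; apply/colP => i.
by rewrite !ord1 -/(height y) z1 mxE eqxx.
Qed.

Lemma shadow_apex : shadow apex = 0.
Proof. by rewrite /shadow height_apex scale1r /apex col_mxKu subrr. Qed.

Lemma Q_apex : Q apex.
Proof.
move=> i; case: (row_cases i) => [[j ->]|->].
  rewrite rock_rowE shadow_apex mulmx0 mxE add0r height_apex mul1r be_rock.
  by rewrite gerBl rate_ge0.
by rewrite base_rowE be_base height_apex oppr_le0 ler01.
Qed.

Lemma base_notin_tight y : height y != 0 -> base_row \notin tight N be y.
Proof. by rewrite base_tight. Qed.

Lemma card_rock_tight y : height y != 0 -> #|rock_tight y| = #|tight N be y|.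
Proof.
move=> z0; have inj : injective rock_row by exact: lshift_inj.
rewrite -(card_imset (mem (rock_tight y)) inj); apply: eq_card => i.
apply/imsetP/idP => [[j jt ->]|it]; first by rewrite -in_rock_tight.
case: (row_cases i) it => [[j ->]|->] it; last first.
  by rewrite (negPf (base_notin_tight z0)) in it.
by exists j => //=; rewrite in_rock_tight.
Qed.

Lemma apex_full : full N (tight N be apex).
Proof.
have h0 : height apex != 0 by rewrite height_apex oner_eq0.
apply: indep_card_full; first exact/rock_tight_indep/Q_apex.
rewrite -card_rock_tight // addn1 -J_card; apply: eq_card => i.
apply/rock_tightP/idP.
  rewrite shadow_apex mulmx0 mxE height_apex subrr mul0r add0r mulr1 => e.
  by apply: contraT => /rate_gt0; rewrite -e ltxx.
by move=> iJ; rewrite shadow_apex mulmx0 mxE height_apex subrr mul0r J_rate // mul0r addr0.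
Qed.

Lemma height_step v (t : R) r : height (v + t *: r) = height v + t * height r.
Proof. by rewrite /height linearD linearZ /= mxE [X in _ + X]mxE. Qed.

Lemma leave_base v : Q v -> full N (tight N be v) -> height v = 0 ->
  exists w, [/\ Q w, full N (tight N be w), adjacent Q v w & 0 < height w].
Proof.
move=> Qv fv z0; have bt : base_row \in tight N be v by rewrite base_tight z0.
have [r [t [[t0 Qw fw avw _] hr]]] := pivot bQ rock_tight_indep Qv fv bt.
exists (v + t *: r); split=> //.
have := hr _ bt; rewrite base_rowE eqxx => /oppr_inj r1.
by rewrite height_step z0 r1 add0r mulr1.
Qed.

(** The potential of the climb: the rows outside [J] whose rate does not exceed the largest tight
    one. At the apex it is empty. *)
Definition level y : {set 'I_M} := finset.finset (fun i => (i \notin J) &&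
  [exists j, [&& j \in rock_tight y, j \notin J & rate i <= rate j]]).

Lemma level_card y : (#|level y| <= M - d.+1)%N.
Proof.
rewrite -J_card -[X in (_ <= X - _)%N]card_ord -(cardsC J) addKn.
apply/subset_leq_card/fintype.subsetP => i.
by rewrite !finset.inE => /andP [].
Qed.

(** Dropping the dominant row [k] raises the height, because [k] dictates the sign of the product of
    [l] and [rate]; a greater height in turn excludes tight rows of larger rate than [k]. *)
Lemma climb_step v : Q v -> full N (tight N be v) ->
  0 < height v -> height v < 1 ->
  exists w, [/\ Q w, full N (tight N be w), adjacent Q v w, 0 < height w &
                (#|level w| < #|level v|)%N].
Proof.
move=> Qv fv z0 z1; have hz : height v != 0 by rewrite gt_eqF.
have ct : #|rock_tight v| = d.+1.
  by rewrite card_rock_tight // (tight_card rock_tight_indep Qv fv) addn1.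
have dT : ~ indep A (rock_tight v).
  by move=> /indep_card; rewrite ct ltnn.
have [sJ|/top_exists [k tk]] := boolP (rock_tight v \subset J).
  by case: dT; apply: flat_indep.
have [kt kJ hk] := tk; have ik := top_indep Qv z0 tk.
have rk := rate_gt0 kJ.
have bt : rock_row k \in tight N be v by rewrite -in_rock_tight.
have [r [t [[t0 Qw fw avw kw] hr]]] := pivot bQ rock_tight_indep Qv fv bt.
set w := v + t *: r in Qw fw avw kw.
have [l [hl lA lb lK l1]] := dependency dT.
have lk : l 0 k != 0.
  apply/eqP => lk; have l0 : l = 0.
    apply: ik => // i; rewrite finset.in_setD1 negb_and negbK.
    by case/orP => [/eqP -> //|/hl].
  move: lb; rewrite l0 /dot big1 ?normr0 ?ler10 // => i _.
  by rewrite mxE mul0r.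
(* Pairing [l] with the values of the tight rows on [r] eliminates the shadow of [r];
   [dependency_time] at [v] then eliminates the product of [l] and [b]. *)
have e1 : (1 - height v) * l 0 k = height r * dot l rate.
  have := dot_mul0 (shadow r) lA.
  rewrite (eq_dot (g := fun i => - (i == k)%:R +
      (- height r * b i 0 + height r * rate i)) hl); last first.
    move=> i; rewrite in_rock_tight => /hr; rewrite rock_rowE.
    rewrite (inj_eq (@lshift_inj _ _)) => <-; ring.
  rewrite dotD dotD !dotZ; have -> : dot l (fun i => - (i == k)%:R) = - l 0 k.
    rewrite /dot (bigD1 k) //= eqxx mulrN1 big1 ?addr0 // => i /negPf ->.
    by rewrite oppr0 mulr0.
  have := dependency_time hl lA; set x := dot l _; set y := dot l _ => e2 e3.
  have -> : l 0 k = height r * (y - x) by lra.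
  have -> : (1 - height v) * (height r * (y - x)) =
    height r * ((1 - height v) * y - (1 - height v) * x) by ring.
  by rewrite e2; ring.
(* The term of [k] contributes at least [rate k] in absolute value, all others together at most
   [K * rho * rate k]. *)
have e2 : 0 < l 0 k * dot l rate.
  have l2 := l1 _ lk.
  have -> : dot l rate = l 0 k * rate k + \sum_(i | i != k) l 0 i * rate i.
    by rewrite /dot (bigD1 k).
  set s := \sum_(_ | _) _.
  have sK : `|s| <= K * (rho * rate k).
    have re : 0 <= rho * rate k by rewrite mulr_ge0 // ltW.
    apply: le_trans (_ : (\sum_i `|l 0 i|) * (rho * rate k) <= _); last first.
      exact: ler_wpM2r.
    rewrite (bigD1 k) //= mulrDl; apply: le_trans (ler_norm_sum _ _ _) _.
    rewrite -[leLHS]add0r; apply: lerD; first by rewrite mulr_ge0.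
    rewrite mulr_suml; apply: ler_sum => i ik'.
    rewrite normrM (ger0_norm (rate_ge0 i)).
    have [/hk h|/hl ->] := boolP (i \in rock_tight v).
      by rewrite ler_wpM2l ?h.
    by rewrite normr0 !mul0r.
  have sk : `|s| < rate k.
    apply: le_lt_trans sK _; rewrite mulrA -[ltRHS]mul1r ltr_pM2r //.
  rewrite mulrDr mulrA -expr2 -real_normK ?num_real // expr2.
  have h1 : - (`|l 0 k| * `|s|) <= l 0 k * s.
    by rewrite -normrM lerNnormlW.
  apply: lt_le_trans (lerD (lexx _) h1).
  have -> : `|l 0 k| * `|l 0 k| * rate k - `|l 0 k| * `|s| =
    `|l 0 k| * (`|l 0 k| * rate k - `|s|) by ring.
  rewrite mulr_gt0 ?normr_gt0 // subr_gt0 (lt_le_trans sk) //.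
  by rewrite ler_peMl // ltW.
have hr0 : 0 < height r.
  have e3 : 0 < (1 - height v) * l 0 k * l 0 k.
    by rewrite -mulrA mulr_gt0 ?subr_gt0 // -expr2 exprn_even_gt0.
  by move: e3; rewrite e1 -mulrA [dot _ _ * _]mulrC pmulr_lgt0.
have zw : height v < height w by rewrite height_step ltrDl mulr_gt0.
(* A tight row of larger rate at [w] would exceed [rate k] by the factor [1 / rho], and [time_ge]
   would place [w] below [v]. *)
have low j : j \in rock_tight w -> j \notin J -> rate j < rate k.
  move=> jt jJ; rewrite ltNge; apply/negP => jk.
  have njk : k != j.
    by apply: contraNneq kw => ->; rewrite -in_rock_tight.
  have g := rate_gap kJ jJ njk jk.
  have h1 := time_ge Qw jt jJ.
  have h2 : 1 - height v <= height v * (K * rate k).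
    apply: (time_le Qv (fintype.subxx _) dT (ltW rk)) => i it.
    have [-> //|ink] := eqVneq i k.
    by apply: le_trans (hk i it ink) _; rewrite ler_piMl // ltW.
  have h3 : C * (1 - height w) <= C * (height v * (K * rate k)).
    by apply: ler_wpM2l => //; apply: le_trans h2; rewrite lerD2l lerN2 ltW.
  have h4 : C * (height v * (K * rate k)) <= C * (height v * (K * (rho * rate j))).
    by rewrite !ler_wpM2l // ltW.
  have h5 : C * K * rho * (height v * rate j) <= C * K * rho * (height w * rate j).
    by rewrite ler_wpM2l ?mulr_ge0 // ler_wpM2r ?rate_ge0 // ltW.
  have h6 : C * K * rho * (height w * rate j) < height w * rate j.
    rewrite -[ltRHS]mul1r ltr_pM2r // mulr_gt0 ?rate_gt0 //.
    exact: lt_trans zw.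
  lra.
exists w; split=> //; first exact: lt_trans zw.
apply: proper_card; rewrite fintype.properE; apply/andP; split.
  apply/fintype.subsetP => i; rewrite !finset.inE => /andP [iJ] /existsP [j].
  move=> /and3P [jt jJ ij]; rewrite iJ; apply/existsP; exists k.
  by rewrite kt kJ (le_trans ij) // ltW // low.
apply/negP => /fintype.subsetP/(_ k); rewrite !finset.inE kJ /=.
have -> : [exists j, [&& j \in rock_tight v, j \notin J & rate k <= rate j]].
  by apply/existsP; exists k; rewrite kt kJ lexx.
move=> /(_ isT) /existsP [j /and3P [jt jJ]].
by rewrite leNgt low.
Qed.

Let adj := fun x y => `[< adjacent Q x y >].

Lemma path_to_apex v : vertex Q v -> exists p,
  [/\ path adj v p, last v p = apex & (size p <= (M - d.+1).+1)%N].
Proof.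
have up y : Q y -> full N (tight N be y) -> 0 < height y -> exists p,
    [/\ path adj y p, last y p = apex & (size p <= #|level y|)%N].
  have [k] := ubnP #|level y|; elim: k y => // k IH y lk Qy fy z0.
  have [z1|z1] := eqVneq (height y) 1.
    by exists [::]; split=> //=; apply: apexP.
  have zlt : height y < 1 by rewrite lt_neqAle z1 height_le1.
  have [w [Qw fw ayw w0 lw]] := climb_step Qy fy z0 zlt.
  have [p [hp lp sp]] := IH w (leq_trans lw lk) Qw fw w0.
  exists (w :: p); split=> //=; last exact: leq_ltn_trans sp lw.
  by rewrite hp andbT; apply/asboolP.
move=> /vertexP [Qv fv]; have [z0|z0] := eqVneq (height v) 0; last first.
  have vpos : 0 < height v by rewrite lt_neqAle eq_sym z0 height_ge0.
  have [p [hp lp sp]] := up v Qv fv vpos.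
  exists p; split=> //; apply: leq_trans sp _; apply: leqW; exact: level_card.
have [w [Qw fw avw w0]] := leave_base Qv fv z0.
have [p [hp lp sp]] := up w Qw fw w0.
exists (w :: p); split=> //=; first by rewrite hp andbT; apply/asboolP.
by rewrite ltnS (leq_trans sp) ?level_card.
Qed.

Lemma adj_sym x y : adj x y = adj y x.
Proof.
by apply/asboolP/asboolP => -[? ? ? [F [? ? ?]]];
   split=> //; [exact: nesym|exists F|exact: nesym|exists F].
Qed.

Lemma rock_diameter_at_most : diameter_at_most Q (2 * (M - d.+1).+1).
Proof.
move=> u v /path_to_apex [p [hp lp sp]] /path_to_apex [q [hq lq sq]].
have hr : path adj u (p ++ rev (belast v q)).
  rewrite cat_path hp lp -lq rev_path.
  by under eq_path do rewrite adj_sym.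
have lr : last u (p ++ rev (belast v q)) = v.
  by rewrite last_cat lp -lq; case: (q) => [|w q'] //=;
     rewrite rev_cons last_rcons.
have sr : (size (p ++ rev (belast v q)) <= 2 * (M - d.+1).+1)%N.
  by rewrite size_cat size_rev size_belast mul2n -addnn leq_add.
(* The ascents from [u] and [v] may share vertices besides the apex, whereas the path has to be free
   of repetitions. *)
case: (shortenP hr) lr => p' hp' up' sub lr; exists p'; split=> //.
by apply: leq_trans sr; apply: uniq_leq_size sub; case/andP: up'.
Qed.

Lemma rock_diameter : exists2 delta, is_diameter Q delta &
  (delta <= 2 * (M - d.+1).+1)%N.
Proof.
have h := rock_diameter_at_most.
have ex : exists k, `[< diameter_at_most Q k >] by eexists; apply/asboolP; exact: h.
case: (ex_minnP ex) => k /asboolP hk mk; exists k; last exact/mk/asboolP.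
by split=> // k' hk'; apply/mk/asboolP.
Qed.

Lemma rock_simple : simple_polytope Q.
Proof. exact: (simple_system_simple bQ rock_tight_indep Q_apex apex_full). Qed.

Lemma rock_facets : [set F | facet Q F] #<= `I_(M + 1).
Proof. exact: (facet_count bQ rock_tight_indep). Qed.

End Rock.

(** * Explicit constants *)

Section Determinants.
Variable R : archiRealFieldType.

(** Expansion along a row; bounding sums over rows instead of single entries avoids a factorial. *)
Lemma det_norm_le n (X : 'M[R]_n) (G : R) : 0 <= G ->
  (forall i, \sum_j `|X i j| <= G) -> `|\det X| <= G ^+ n.
Proof.
move=> G0; elim: n X => [|n IH] X hX; first by rewrite det_mx00 normr1 expr0.
rewrite (expand_det_row X ord0) exprS.
apply: le_trans (ler_norm_sum _ _ _) _.
apply: le_trans (ler_wpM2r (exprn_ge0 n G0) (hX ord0)).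
rewrite mulr_suml; apply: ler_sum => j _; rewrite normrM ler_wpM2l //.
rewrite /cofactor normrM normrX normrN1 expr1n mul1r; apply: IH => i.
apply: le_trans (hX (lift ord0 i)); rewrite (bigD1_ord j) //=.
rewrite -[leLHS]add0r lerD // le_eqVlt; apply/orP; left; apply/eqP.
by apply: eq_bigr => k _; rewrite !mxE.
Qed.

Lemma det_int n (X : 'M[R]_n) : (forall i j, X i j \is a Num.int) ->
  \det X \is a Num.int.
Proof.
move=> hX; apply: rpred_sum => s _; rewrite rpredM ?rpredX ?rpredN ?rpred1 //.
exact: rpred_prod.
Qed.

(** The factor [G] stands for the deleted row and avoids the exponent [n - 1]. *)
Lemma cofactor_norm_le n (X : 'M[R]_n) (G : R) i j : 1 <= G ->
  (forall i, \sum_j `|X i j| <= G) -> G * `|cofactor X i j| <= G ^+ n.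
Proof.
move=> G1; have G0 : 0 <= G by apply: le_trans G1.
case: n X i j => [|n] X i j hX; first by case: i.
rewrite exprS ler_wpM2l // /cofactor normrM normrX normrN1 expr1n mul1r.
apply: det_norm_le => // k; apply: le_trans (hX (lift i k)).
rewrite (bigD1_ord j) //= -[leLHS]add0r lerD // le_eqVlt.
by apply/orP; left; apply/eqP; apply: eq_bigr => l _; rewrite !mxE.
Qed.

Lemma cofactor_int n (X : 'M[R]_n) i j : (forall i j, X i j \is a Num.int) ->
  cofactor X i j \is a Num.int.
Proof.
move=> hX; rewrite /cofactor rpredM ?rpredX ?rpredN ?rpred1 //.
by apply: det_int => k l; rewrite !mxE.
Qed.

(* Cramer's rule: [D] and the entries of [alpha] are minors. *)
Lemma cramer_coefficients m d (A : 'M[R]_(m, d)) (S : {set 'I_m})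
    (x : 'rV[R]_d) (G : R) : 1 <= G ->
  (forall i j, A i j \is a Num.int) -> (forall i, \sum_j `|A i j| <= G) ->
  (forall j, x 0 j \is a Num.int) -> \sum_j `|x 0 j| <= G ->
  indep A S -> #|S| = d ->
  exists D alpha, [/\ D \is a Num.int, D != 0 & `|D| <= G ^+ d] /\
    [/\ supported S alpha, forall i, alpha 0 i \is a Num.int,
        forall i, `|alpha 0 i| <= G ^+ d & D *: x = alpha *m A].
Proof.
move=> G1 Aint AG xint xG iS cS; have G0 : 0 <= G by apply: le_trans G1.
pose f k : 'I_m := @enum_val _ (mem S) (cast_ord (esym cS) k).
have finj : injective f by move=> k l /enum_val_inj /cast_ord_inj.
have fS k : f k \in S by exact: enum_valP.
pose X : 'M[R]_d := rowsub f A.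
have Xint i j : X i j \is a Num.int by rewrite mxE.
have XG i : \sum_j `|X i j| <= G.
  by apply: le_trans (AG (f i)); rewrite le_eqVlt; apply/orP; left; apply/eqP;
     apply: eq_bigr => j _; rewrite mxE.
have X0 : \det X != 0.
  rewrite -unitfE -unitmxE -row_free_unit.
  apply: inj_row_free => v vX.
  pose E : 'M[R]_(d, m) := rowsub f 1%:M.
  have E0 : v *m E = 0.
    apply: iS; last by rewrite -mulmxA /E mul_rowsub_mx mul1mx.
    by move=> i; apply: spread_notin.
  by apply/rowP => k; rewrite -(spread_image v k finj) -/E E0 !mxE.
pose al := x *m \adj X.
have alE k : al 0 k = \sum_j x 0 j * cofactor X k j.
  by rewrite mxE; apply: eq_bigr => j _; rewrite [X in _ * X]mxE.
have alG k : `|al 0 k| <= G ^+ d.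
  rewrite alE; apply: le_trans (ler_norm_sum _ _ _) _.
  apply: le_trans (_ : \sum_j `|x 0 j| * (G ^+ d / G) <= _).
    apply: ler_sum => j _; rewrite normrM ler_wpM2l //.
    rewrite ler_pdivlMr ?(lt_le_trans ltr01) // mulrC.
    exact: cofactor_norm_le.
  rewrite -mulr_suml mulrA mulrAC ler_piMl ?exprn_ge0 //.
  by rewrite ler_pdivrMr ?(lt_le_trans ltr01) // mul1r.
have alint k : al 0 k \is a Num.int.
  by rewrite alE rpred_sum // => j _; rewrite rpredM // cofactor_int.
pose alpha : 'rV[R]_m := al *m rowsub f 1%:M.
have af k : alpha 0 (f k) = al 0 k by exact: spread_image.
have sup : supported S alpha by move=> i; apply: spread_notin.
have cases i : (exists k, i = f k) \/ alpha 0 i = 0.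
  have [iS'|/sup] := boolP (i \in S); last by right.
  left; exists (cast_ord cS (enum_rank_in iS' i)).
  by rewrite /f cast_ordK enum_rankK_in.
exists (\det X), alpha; split; split=> //.
- exact: det_int.
- exact: det_norm_le.
- by move=> i; case: (cases i) => [[k ->]|->]; rewrite ?af ?rpred0.
- by move=> i; case: (cases i) => [[k ->]|->]; rewrite ?af ?normr0 ?exprn_ge0.
- by rewrite /alpha -mulmxA mul_rowsub_mx mul1mx -mulmxA mul_adj_mx
    mul_mx_scalar.
Qed.

End Determinants.

(** * The enclosing simplex, its dependencies and the separated rates *)

Section Constants.
Variables (R : realType) (m d : nat).
Variables (A : 'M[R]_(m, d)) (b : 'cV[R]_m) (xU : 'cV[R]_d) (G : R).

Let P := polyhedron A b.
Let I : {set 'I_m} := tight A b xU.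

(* The inequality [extra_row *m x <= bound] closes the cone of the inequalities
   tight at [xU] to a simplex; [G] bounds the entries of [A] and [b], so that
   [far] bounds all minors of the extended matrix. *)
Definition far := G ^+ d.+1.
(** By Cramer's rule [extra_row] has absolute value at most [far] at every vertex of the
    arrangement; the additional 1 keeps the new hyperplane away from all of them. *)
Definition bound := far + 1.
(** The three factors [far] and the factor [d.+1] absorb the product of [spread] and [depth]. With
    their constant 3 and the gap [3 * ratio] between rates, a factor 9 remains to be beaten by
    16. *)
Definition ratio : R := (16%:R * d.+1%:R * (far * far * far))^-1.
(** One power beyond the smallest intended rate [ratio ^+ m], so that moving the center away from
    [xU] by [tiny] hardly changes the rates. *)
Definition tiny := ratio ^+ m.+1.
Definition slack i : R := b i 0 - (A *m xU) i 0.
Definition rock_coef : 'cV[R]_m :=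
  \col_i if i \in I then tiny else slack i - ratio ^+ i.+1.
Definition extra_row : 'rV[R]_d := - \sum_(i in I) row i A.
Definition extra_coef : R := bound + \sum_(i in I) (b i 0 - tiny).

Definition ext_mx : 'M[R]_(m + 1, d) := col_mx A extra_row.
Definition ext_rhs : 'cV[R]_(m + 1) := col_mx b bound%:M.
Definition ext_coef : 'cV[R]_(m + 1) := col_mx rock_coef extra_coef%:M.

Hypothesis A_int : forall i j, A i j \is a Num.int.
Hypothesis b_int : forall i, b i 0 \is a Num.int.
Hypothesis slack_int : forall i, slack i \is a Num.int.
Hypothesis G_int : G \is a Num.int.
Hypothesis G_ge1 : 1 <= G.
Hypothesis A_G : \sum_i \sum_j `|A i j| <= G.
Hypothesis b_G : \sum_i `|b i 0| <= G.
Hypothesis nd : non_degenerate A b.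
Hypothesis bP : bounded_set P.
Hypothesis vU : vertex P xU.

Let G_ge0 : 0 <= G. Proof. exact: le_trans G_ge1. Qed.

Lemma xU_in : P xU. Proof. by have /vertexP [] := vU. Qed.

Lemma I_full : full A I. Proof. by have /vertexP [] := vU. Qed.

Lemma all_full : full A [set: 'I_m]%SET.
Proof. exact: full_subset (finset.subsetT _) I_full. Qed.

(** The hyperplanes of [S] meet in [v] alone, which is thus a vertex of the arrangement;
    non-degeneracy leaves no room for a further tight row. *)
Lemma basis_vertex (S : {set 'I_m}) v : full A S -> #|S| = d ->
  (forall i, i \in S -> (A *m v) i 0 = b i 0) -> tight A b v = S.
Proof.
move=> fS cS hv; have [_ _ hnd] := nd.
have av : arrangement_vertex A b v.
  exists [set` S]; apply/seteqP; split=> [x /= hx|_ -> i /= /hv //].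
  apply/eqP; rewrite -subr_eq0; apply/eqP/fS => i iS.
  by rewrite mulmxBr mxE [X in _ + X]mxE hv // (hx i iS) subrr.
apply/esym/eqP; rewrite eqEcard cS; apply/andP; split.
  by apply/fintype.subsetP => i /hv; rewrite in_tight => ->.
apply: eq_leq; apply: etrans (hnd _ av); apply: eq_card => i.
by rewrite in_tight.
Qed.

(** Any basis chosen among the tight rows already determines [xU], and [basis_vertex] makes it all
    of [I]. *)
Lemma I_card : #|I| = d.
Proof.
have [S [_ SI iS fS cS]] := extend_basis (finset.sub0set I) (@indep0 _ _ _ A) I_full.
rewrite /I (basis_vertex fS cS) // => i iS'.
by apply/tightP/(fintype.subsetP SI).
Qed.

Lemma I_indep : indep A I.
Proof.
have [S [_ SI iS fS cS]] := extend_basis (finset.sub0set I) (@indep0 _ _ _ A) I_full.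
by have /eqP <- : S == I by rewrite eqEcard SI cS I_card /=.
Qed.

Lemma row_G i : \sum_j `|A i j| <= G.
Proof.
apply: le_trans A_G; rewrite [leRHS](bigD1 i) //= lerDl sumr_ge0 // => k _.
by rewrite sumr_ge0.
Qed.

Lemma extra_rowE j : extra_row 0 j = - \sum_(i in I) A i j.
Proof.
by rewrite mxE summxE; congr (- _); apply: eq_bigr => i _; rewrite mxE.
Qed.

Lemma extra_row_G : \sum_j `|extra_row 0 j| <= G.
Proof.
apply: le_trans A_G; rewrite exchange_big /=; apply: ler_sum => j _.
rewrite extra_rowE normrN; apply: le_trans (ler_norm_sum _ _ _) _.
by rewrite [leRHS](bigID (mem I)) /= lerDl sumr_ge0.
Qed.

Lemma extra_row_int j : extra_row 0 j \is a Num.int.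
Proof. by rewrite extra_rowE rpredN rpred_sum. Qed.

Lemma extra_row_mul (x : 'cV[R]_d) :
  (extra_row *m x) 0 0 = - \sum_(i in I) (A *m x) i 0.
Proof. by rewrite mulNmx mxE row_sum_mul. Qed.

Lemma far_ge1 : 1 <= far. Proof. exact: exprn_ege1. Qed.

Lemma powd_le_far : G ^+ d <= far.
Proof. by rewrite /far exprS ler_peMl // exprn_ge0. Qed.

Lemma G_le_far : G <= far.
Proof. by rewrite /far exprS ler_peMr // exprn_ege1. Qed.

Lemma bound_int : bound \is a Num.int.
Proof. by rewrite rpredD ?rpredX ?rpred1. Qed.

(** The sum of the right-hand sides over the simplex rows. As their normals add up to zero, it is
    the sum of their slacks at any point and measures the size of the simplex. *)
Definition I_total := bound + \sum_(i in I) b i 0.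

Lemma sum_I_b : `|\sum_(i in I) b i 0| <= G.
Proof.
apply: le_trans b_G; apply: le_trans (ler_norm_sum _ _ _) _.
by rewrite [leRHS](bigID (mem I)) /= lerDl sumr_ge0.
Qed.

Lemma I_total_ge1 : 1 <= I_total.
Proof.
rewrite /I_total /bound; have := sum_I_b; have := G_le_far.
by rewrite ler_norml => h /andP [h1 h2]; lra.
Qed.

Lemma I_total_le : I_total <= 3%:R * far.
Proof.
rewrite /I_total /bound; have := sum_I_b; have := G_le_far; have := far_ge1.
by rewrite ler_norml => h0 h /andP [h1 h2]; lra.
Qed.

Lemma cramer (S : {set 'I_m}) (x : 'rV[R]_d) :
  (forall j, x 0 j \is a Num.int) -> \sum_j `|x 0 j| <= G ->
  indep A S -> #|S| = d ->
  exists D alpha, [/\ D \is a Num.int, D != 0 & `|D| <= G ^+ d] /\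
    [/\ supported S alpha, forall i, alpha 0 i \is a Num.int,
        forall i, `|alpha 0 i| <= G ^+ d & D *: x = alpha *m A].
Proof. by move=> *; apply: cramer_coefficients => //; apply: row_G. Qed.

Lemma basis_coefficients (x : 'rV[R]_d) :
  (forall j, x 0 j \is a Num.int) -> \sum_j `|x 0 j| <= G ->
  exists mu, [/\ supported I mu, forall i, `|mu 0 i| <= G ^+ d & x = mu *m A].
Proof.
move=> xint xG.
have [D [al [[Dint D0 _] [sal _ alG e]]]] := cramer xint xG I_indep I_card.
have D1 : 1 <= `|D| by exact: norm_intr_ge1.
exists (D^-1 *: al); split.
- by move=> i /sal e0; rewrite mxE e0 mulr0.
- move=> i; rewrite mxE normrM normfV mulrC ler_pdivrMr ?(lt_le_trans ltr01) //.
  by apply: le_trans (alG i) _; rewrite ler_peMr // exprn_ge0.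
- by rewrite -scalemxAl -e scalerA mulVf // scale1r.
Qed.

(** It suffices to consider a vertex of [P], reached by [climb], where Cramer's rule expresses the
    value by minors and right-hand sides. *)
Lemma extra_row_redundant x : P x -> (extra_row *m x) 0 0 <= bound.
Proof.
move=> Px; have [v [Pv fv _ xv]] := climb extra_row bP Px.
apply: le_trans xv _.
have [S [_ Sv iS fS cS]] := extend_basis (finset.sub0set _) (@indep0 _ _ _ A) fv.
have [D [al [[Dint D0 _] [sal _ alG e]]]] :=
  cramer extra_row_int extra_row_G iS cS.
have D1 : 1 <= `|D| by exact: norm_intr_ge1.
have e1 : D * (extra_row *m v) 0 0 = \sum_i al 0 i * b i 0.
  have := congr1 (fun B => (B *m v) 0 0) e; rewrite -scalemxAl mxE => ->.
  rewrite -mulmxA mxE; apply: eq_bigr => i _.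
  have [/(fintype.subsetP Sv)/tightP -> //|/sal ->] := boolP (i \in S).
  by rewrite !mul0r.
apply: le_trans (ler_norm _) _.
apply: le_trans (_ : `|D| * `|(extra_row *m v) 0 0| <= _).
  by rewrite ler_peMl.
rewrite -normrM e1; apply: le_trans (ler_norm_sum _ _ _) _.
apply: le_trans (_ : \sum_i G ^+ d * `|b i 0| <= _).
  by apply: ler_sum => i _; rewrite normrM ler_wpM2r.
rewrite -mulr_sumr; apply: le_trans (_ : G ^+ d * G <= _).
  by rewrite ler_wpM2l // exprn_ge0.
by rewrite -exprSr lerDl.
Qed.

Lemma ext_mx_lshift (x : 'cV[R]_d) i :
  (ext_mx *m x) (lshift 1 i) 0 = (A *m x) i 0.
Proof. by rewrite mul_col_mx col_mxEu. Qed.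

Lemma ext_mx_rshift (x : 'cV[R]_d) :
  (ext_mx *m x) (rshift m 0) 0 = - \sum_(i in I) (A *m x) i 0.
Proof. by rewrite mul_col_mx col_mxEd extra_row_mul. Qed.

Lemma ext_rhs_lshift i : ext_rhs (lshift 1 i) 0 = b i 0.
Proof. by rewrite col_mxEu. Qed.

Lemma ext_rhs_rshift : ext_rhs (rshift m 0) 0 = bound.
Proof. by rewrite col_mxEd mxE eqxx mulr1n. Qed.

Lemma ext_polyhedron : polyhedron ext_mx ext_rhs = P.
Proof.
apply/seteqP; split=> x Px i.
  by have := Px (lshift 1 i); rewrite ext_mx_lshift ext_rhs_lshift.
case: (ext_cases i) => [[j ->]|->]; first by rewrite ext_mx_lshift ext_rhs_lshift.
by rewrite ext_mx_rshift ext_rhs_rshift -extra_row_mul extra_row_redundant.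
Qed.

Definition J : {set 'I_(m + 1)} := (rshift m 0 |: [set lshift 1 i | i in I])%SET.

Lemma J_lshift i : (lshift 1 i \in J) = (i \in I).
Proof.
rewrite finset.in_setU1 eq_lrshift /=.
by apply/imsetP/idP => [[k kI /lshift_inj ->]|iI] //; exists i.
Qed.

Lemma J_rshift : rshift m 0 \in J.
Proof. exact: finset.setU11. Qed.

Lemma J_card : #|J| = d.+1.
Proof.
rewrite cardsU1 card_imset; last exact: lshift_inj.
rewrite I_card; case: imsetP => // -[k _ /eqP].
by rewrite eq_rlshift.
Qed.

(** Adding the inequalities of [J] cancels [u], so the slacks of the rows in [I] have sum at most
    [s * I_total]. *)
Lemma simplex_slack (u : 'cV[R]_d) s :
  (forall i, i \in J -> (ext_mx *m u) i 0 <= s * ext_rhs i 0) ->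
  [/\ forall i, i \in I -> 0 <= s * b i 0 - (A *m u) i 0,
      \sum_(i in I) (s * b i 0 - (A *m u) i 0) <= s * I_total & 0 <= s].
Proof.
move=> hu.
have h0 i : i \in I -> 0 <= s * b i 0 - (A *m u) i 0.
  move=> iI; have := hu (lshift 1 i); rewrite J_lshift iI => /(_ isT).
  by rewrite ext_mx_lshift ext_rhs_lshift subr_ge0.
have h1 : \sum_(i in I) (s * b i 0 - (A *m u) i 0) <= s * I_total.
  rewrite sumrB -mulr_sumr /I_total mulrDr addrC lerD2r.
  by have := hu _ J_rshift; rewrite ext_mx_rshift ext_rhs_rshift.
split=> //; have : 0 <= s * I_total by apply: le_trans h1; apply: sumr_ge0.
by rewrite pmulr_lge0 // (lt_le_trans ltr01) // I_total_ge1.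
Qed.

Lemma simplex_apex0 (u : 'cV[R]_d) :
  (forall i, i \in J -> (ext_mx *m u) i 0 <= 0) -> u = 0.
Proof.
move=> hu; have [|h0 h1 _] := @simplex_slack u 0.
  by move=> i /hu; rewrite mul0r.
apply: I_full => i iI; move: h1; rewrite mul0r => h1.
have /eqP : \sum_(i in I) (0 * b i 0 - (A *m u) i 0) = 0.
  by apply: le_anti; rewrite h1 sumr_ge0.
rewrite psumr_eq0 => [/allP/(_ i)|k /h0 //].
by rewrite mem_index_enum iI mul0r sub0r oppr_eq0 => /(_ isT)/eqP.
Qed.

Lemma notin_J k : k \notin J -> exists2 j, k = lshift 1 j & j \notin I.
Proof.
case: (ext_cases k) => [[j ->]|->]; last by rewrite J_rshift.
by rewrite J_lshift; exists j.
Qed.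

Lemma A_row_int i j : row i A 0 j \is a Num.int.
Proof. by rewrite mxE. Qed.

Lemma A_row_G i : \sum_j `|row i A 0 j| <= G.
Proof. by under eq_bigr do rewrite mxE; apply: row_G. Qed.

Lemma slack_ge0 i : 0 <= slack i.
Proof. by rewrite subr_ge0; apply: xU_in. Qed.

Lemma slack_ge1 i : i \notin I -> 1 <= slack i.
Proof.
move=> iI; rewrite -(ger0_norm (slack_ge0 i)); apply: norm_intr_ge1 => //.
by rewrite subr_eq0 eq_sym; move: iI; rewrite in_tight.
Qed.

Definition spread : R := 3%:R * (G ^+ d * far).

Lemma spread_ge0 : 0 <= spread.
Proof. by rewrite !mulr_ge0 ?exprn_ge0. Qed.

(** Row [k] is a combination of the rows in [I], which turns its violation into a combination of
    their slacks, minus the nonnegative [s * slack j] at [xU]. *)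
Lemma simplex_spread (u : 'cV[R]_d) s k : k \notin J ->
  (forall i, i \in J -> (ext_mx *m u) i 0 <= s * ext_rhs i 0) ->
  (ext_mx *m u) k 0 - s * ext_rhs k 0 <= spread * s.
Proof.
move=> /notin_J [j -> jI] /simplex_slack [h0 h1 s0].
rewrite ext_mx_lshift ext_rhs_lshift.
have [mu [smu muG e]] := basis_coefficients (A_row_int j) (A_row_G j).
have AE (x : 'cV[R]_d) : (A *m x) j 0 = \sum_(i in I) mu 0 i * (A *m x) i 0.
  have := congr1 (fun B => (B *m x) 0 0) e; rewrite -row_mul mxE => ->.
  rewrite -mulmxA mxE [LHS](bigID (mem I)) /= [X in _ + X]big1 ?addr0 //.
  by move=> i /smu ->; rewrite mul0r.
have -> : (A *m u) j 0 - s * b j 0 = - (s * slack j) -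
    \sum_(i in I) mu 0 i * (s * b i 0 - (A *m u) i 0).
  rewrite /slack (AE u) (AE xU).
  have -> : \sum_(i in I) mu 0 i * (A *m xU) i 0 =
      \sum_(i in I) mu 0 i * b i 0.
    by apply: eq_bigr => i /tightP ->.
  under [X in _ = _ - X]eq_bigr do rewrite mulrBr mulrCA.
  by rewrite sumrB -mulr_sumr; ring.
have h2 : - \sum_(i in I) mu 0 i * (s * b i 0 - (A *m u) i 0) <=
    G ^+ d * (s * I_total).
  apply: le_trans (ler_wpM2l (exprn_ge0 _ G_ge0) h1).
  rewrite mulr_sumr -sumrN; apply: ler_sum => i iI.
  rewrite -mulNr ler_wpM2r ?h0 //.
  by apply: le_trans (muG i); rewrite lerNl lerNnormlW.
have h3 : 0 <= s * slack j by rewrite mulr_ge0 ?slack_ge0.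
have h4 : G ^+ d * (s * I_total) <= G ^+ d * (s * (3%:R * far)).
  by rewrite !ler_wpM2l ?exprn_ge0 // I_total_le.
by rewrite /spread; lra.
Qed.

Lemma ext_row_lshift i : row (lshift 1 i) ext_mx = row i A.
Proof. by apply/rowP => j; rewrite !mxE (unsplitK (inl _ _)) /=. Qed.

(** Bounds the sum of the absolute values of the at most d + 1 nonzero minors in a dependency. *)
Definition depth : R := d.+1%:R * G ^+ d.

Lemma sum_supported (S : {set 'I_m}) (al : 'rV[R]_m) e : supported S al ->
  (forall i, `|al 0 i| <= e) -> \sum_i `|al 0 i| <= #|S|%:R * e.
Proof.
move=> sal he; rewrite (bigID (mem S)) /= [X in _ + X]big1 ?addr0.
  rewrite -sum1_card natr_sum mulr_suml; apply: ler_sum => i _.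
  by rewrite mul1r.
by move=> i /sal ->; rewrite normr0.
Qed.

Lemma ext_row_int k j : row k ext_mx 0 j \is a Num.int.
Proof.
case: (ext_cases k) => [[i ->]|->]; first by rewrite ext_row_lshift A_row_int.
by rewrite rowEsub [X in X \is a _]mxE; rewrite col_mxEd extra_row_int.
Qed.

Lemma ext_row_G k : \sum_j `|row k ext_mx 0 j| <= G.
Proof.
case: (ext_cases k) => [[i ->]|->]; first by rewrite ext_row_lshift A_row_G.
apply: le_trans extra_row_G; rewrite le_eqVlt; apply/orP; left; apply/eqP.
by apply: eq_bigr => j _; rewrite mxE col_mxEd.
Qed.

(** Isolates one row that depends on independent rows of [A]. The last clause ensures that no
    independent set containing [S] contains this row, if it is a row of [A]. *)
Lemma dependent_witness (T : {set 'I_(m + 1)}) : ~ indep ext_mx T ->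
  exists (S : {set 'I_m}) j mu, [/\ indep A S, j \in T,
    (forall i, i \in S -> lshift 1 i \in T), supported S mu &
    row j ext_mx = mu *m A] /\
    (forall i, j = lshift 1 i -> i \notin S /\ ~ indep A (i |: S)%SET).
Proof.
move=> dT; pose T' : {set 'I_m} := finset.finset (fun i => lshift 1 i \in T).
have inT' i : (i \in T') = (lshift 1 i \in T) by rewrite finset.inE.
have [S [_ ST' iS mS]] := maximal_indep (finset.sub0set T') (@indep0 _ _ _ A).
have ST i : i \in S -> lshift 1 i \in T.
  by move=> /(fintype.subsetP ST'); rewrite inT'.
(* Either some row of [A] in [T] depends on [S], or the rows of [A] in [T] are independent and the
   dependency involves the redundant row. *)
have [T'S|] := boolP (T' \subset S); last first.
  move=> /fintype.subsetPn [i iT' iS'].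
  have ni := mS i iT' iS'.
  have [mu smu e] := dependent_row iS ni.
  exists S, (lshift 1 i), mu; split; last by move=> k /lshift_inj <-.
  by split; rewrite -?inT' ?ext_row_lshift.
move/existsNP: dT => [l /not_implyP [hl /not_implyP [l0 nl]]].
pose l1 := lsubmx l; pose x := l 0 (rshift m 0).
have l1E i : l1 0 i = l 0 (lshift 1 i) by rewrite mxE.
have e0 : l1 *m A + x *: extra_row = 0.
  rewrite -[RHS]l0 -[l]hsubmxK mul_row_col -/l1; congr (_ + _).
  by apply/rowP => j; rewrite !mxE big_ord1 !mxE.
have sl1 : supported S l1.
  move=> i iS'; rewrite l1E; apply: hl; rewrite -inT'.
  by apply: contra iS'; apply: (fintype.subsetP T'S).
have x0 : x != 0.
  apply/eqP => x0; apply: nl; move: e0; rewrite x0 scale0r addr0.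
  move=> /(iS _ sl1) l10; apply/rowP => k.
  case: (ext_cases k) => [[j ->]|->]; rewrite [RHS]mxE; last exact: x0.
  by rewrite -l1E l10 mxE.
exists S, (rshift m 0), (- x^-1 *: l1); split; last first.
  by move=> i /eqP; rewrite eq_rlshift.
split=> //.
- by apply: contraT => /hl e; rewrite -/x in e; rewrite e eqxx in x0.
- by move=> i /sl1 e; rewrite mxE e mulr0.
- have -> : row (rshift m 0) ext_mx = extra_row.
    by apply/rowP => j; rewrite mxE col_mxEd.
  rewrite -scalemxAl scaleNr -scalerN; apply: (scalerI x0).
  by rewrite scalerA mulfV // scale1r; apply/eqP; rewrite -addr_eq0 addrC e0.
Qed.

(** Cramer's rule requires a basis, so [S] is first completed to [S']; the resulting dependency
    still lives on [T]. *)
Lemma ext_dependency (T : {set 'I_(m + 1)}) : ~ indep ext_mx T ->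
  exists l, [/\ supported T l, l *m ext_mx = 0,
    1 <= `|dot l (fun i => ext_rhs i 0)|,
    \sum_i `|l 0 i| <= depth & forall i, l 0 i != 0 -> 1 <= `|l 0 i|].
Proof.
move=> /dependent_witness [S [j [mu [[iS jT ST smu emu] hj]]]].
have [S' [SS' _ iS' fS' cS']] := extend_basis (finset.subsetT S) iS all_full.
have [D [al [[Dint D0 DG] [sal alint alG e]]]] :=
  cramer (ext_row_int j) (ext_row_G j) iS' cS'.
(* Coordinates with respect to [S'] are unique, hence the minors vanish outside [S]. *)
have salS : supported S al.
  have smu' : supported S' mu.
    by move=> i iS0; apply: smu; apply: contra iS0; apply: (fintype.subsetP SS').
  have : al - D *: mu = 0.
    apply: iS'.
      by move=> i iS0; rewrite !mxE sal // smu' // mulr0 subrr.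
    by rewrite mulmxBl -scalemxAl -e emu subrr.
  move=> /eqP; rewrite subr_eq0 => /eqP -> i /smu h.
  by rewrite mxE h mulr0.
have jS i : i \in S -> (lshift 1 i == j) = false.
  by move=> iS0; apply/eqP => /esym/hj [/negP].
pose l : 'rV[R]_(m + 1) := D *: delta_mx 0 j - row_mx al 0.
have lL i : l 0 (lshift 1 i) = D * (lshift 1 i == j)%:R - al 0 i.
  by rewrite [l]lock -lock /l !mxE eqxx /= (unsplitK (inl _ _)).
have lR : l 0 (rshift m 0) = D * (rshift m 0 == j)%:R.
  by rewrite /l !mxE eqxx /= (unsplitK (inr _ _)) mxE subr0.
have lint k : l 0 k \is a Num.int.
  case: (ext_cases k) => [[i ->]|->]; rewrite ?lL ?lR.
    by rewrite rpredB ?rpredM ?natr_int.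
  by rewrite rpredM ?natr_int.
have dotl f : dot l f = D * f j - \sum_i al 0 i * f (lshift 1 i).
  rewrite /dot big_split_ord big_ord1 /= lR.
  under eq_bigr do rewrite lL mulrBl.
  rewrite sumrB addrAC; congr (_ - _).
  case: (ext_cases j) => [[k ->]|->].
    rewrite eq_rlshift mulr0 mul0r addr0 (bigD1 k) //= eqxx mulr1.
    rewrite big1 ?addr0 // => i ik.
    by rewrite (inj_eq (@lshift_inj _ _)) (negPf ik) mulr0 mul0r.
  rewrite eqxx mulr1 big1 ?add0r // => i _.
  by rewrite eq_lrshift mulr0 mul0r.
exists l; split.
- move=> k kT; case: (ext_cases k) kT => [[i ->]|->] kT; rewrite ?lL ?lR.
    rewrite salS; last by apply: contra kT => /ST.
    by rewrite subr0; case: eqP kT => [->|_ _]; rewrite ?jT ?mulr0.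
  by case: eqP kT => [->|_ _]; rewrite ?jT ?mulr0.
- rewrite mulmxBl -scalemxAl -rowE e mul_row_col mul0mx addr0 subrr //.
- have dint : dot l (fun i => ext_rhs i 0) \is a Num.int.
    rewrite rpred_sum // => k _; rewrite rpredM //.
    case: (ext_cases k) => [[i ->]|->]; rewrite ?ext_rhs_lshift ?ext_rhs_rshift //.
    exact: bound_int.
  apply: norm_intr_ge1 => //; rewrite dotl.
  under eq_bigr do rewrite ext_rhs_lshift.
  case: (ext_cases j) => [[k jk]|jk]; rewrite jk.
    have [kS nk] := hj k jk.
    (* At the vertex [v] of the basis [S'] the product becomes [D] times the slack of row [k], which
       is nonzero because exactly the rows of [S'] are tight at [v]. *)
    have [v hv] := indep_solve (fun i => b i 0) iS'.
    have tv := basis_vertex fS' cS' hv.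
    have kS' : k \notin S'.
      apply/negP => kS'; apply: nk; apply: indep_subset iS'.
      by rewrite finset.subUset finset.sub1set kS' SS'.
    rewrite ext_rhs_lshift.
    have -> : \sum_i al 0 i * b i 0 = D * (A *m v) k 0.
      have := congr1 (fun B => (B *m v) 0 0) e.
      rewrite jk ext_row_lshift -scalemxAl -row_mul mxE mxE => ->.
      rewrite -mulmxA mxE; apply: eq_bigr => i _.
      by have [/hv ->//|/sal ->] := boolP (i \in S'); rewrite !mul0r.
    rewrite -mulrBr mulf_eq0 (negPf D0) /= subr_eq0 eq_sym -in_tight.
    by rewrite tv.
  (* For the redundant row, a vanishing product would bound [bound] by [G ^+ d * G], that is by
     [far]. *)
  rewrite ext_rhs_rshift subr_eq0; apply/eqP => eb.
  have D1 : 1 <= `|D| by exact: norm_intr_ge1.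
  have : bound <= far.
    have b0 : 0 <= bound by rewrite addr_ge0 // exprn_ge0.
    apply: le_trans (_ : `|D| * bound <= _); first by rewrite ler_peMl.
    rewrite -(ger0_norm b0) -normrM eb.
    apply: le_trans (ler_norm_sum _ _ _) _.
    apply: le_trans (_ : \sum_i G ^+ d * `|b i 0| <= _).
      by apply: ler_sum => i _; rewrite normrM ler_wpM2r.
    rewrite -mulr_sumr; apply: le_trans (_ : G ^+ d * G <= _).
      by rewrite ler_wpM2l // exprn_ge0.
    by rewrite -exprSr.
  by rewrite gerDl ler10.
- rewrite /depth -natr1 mulrDl mul1r addrC.
  apply: le_trans (_ : `|D| + \sum_i `|al 0 i| <= _); last first.
    by apply: lerD => //; have := sum_supported sal alG; rewrite cS'.
  rewrite big_split_ord big_ord1 /= lR.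
  apply: le_trans (_ : `|D| * (rshift m 0 == j)%:R +
     \sum_i (`|D| * (lshift 1 i == j)%:R + `|al 0 i|) <= _).
    rewrite addrC lerD //; first by rewrite normrM normr_nat.
    apply: ler_sum => i _; rewrite lL; apply: le_trans (ler_normB _ _) _.
    by rewrite normrM normr_nat.
  rewrite big_split /= addrA lerD2r -mulr_sumr -mulrDr.
  case: (ext_cases j) => [[k ->]|->].
    rewrite eq_rlshift add0r (bigD1 k) //= eqxx big1 ?addr0 ?mulr1 // => i ik.
    by rewrite (inj_eq (@lshift_inj _ _)) (negPf ik).
  rewrite eqxx big1 ?addr0 ?mulr1 // => i _.
  by rewrite eq_lrshift.
- by move=> k k0; apply: norm_intr_ge1.
Qed.

(** All dependencies of the simplex rows are multiples of the one with all coefficients 1, whose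
    product with the right-hand side is [I_total]. *)
Lemma J_dependency l : supported J l -> l *m ext_mx = 0 ->
  dot l (fun i => ext_rhs i 0) = 0 -> l = 0.
Proof.
move=> sl l0 lb; pose l1 := lsubmx l; pose x := l 0 (rshift m 0).
have l1E i : l1 0 i = l 0 (lshift 1 i) by rewrite mxE.
have e0 : l1 *m A + x *: extra_row = 0.
  rewrite -[RHS]l0 -[l]hsubmxK mul_row_col -/l1; congr (_ + _).
  by apply/rowP => j; rewrite !mxE big_ord1 !mxE.
have el1 : l1 - x *: \row_i (i \in I)%:R = 0.
  apply: I_indep.
    move=> i iI; rewrite mxE l1E sl ?J_lshift // add0r !mxE (negPf iI).
    by rewrite mulr0 oppr0.
  rewrite mulmxBl -scalemxAl -[RHS]e0 /extra_row scalerN; congr (_ - _ *: _).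
  apply/rowP => j; rewrite mxE summxE [RHS]big_mkcond.
  by apply: eq_bigr => i _; rewrite !mxE; case: ifP; rewrite ?mul1r ?mul0r.
have l1x i : l1 0 i = x * (i \in I)%:R.
  by move/rowP/(_ i): el1; rewrite !mxE => /eqP; rewrite subr_eq0 => /eqP.
have x0 : x = 0.
  have : x * I_total = 0.
    rewrite -[RHS]lb /dot big_split_ord big_ord1 /= ext_rhs_rshift -/x.
    rewrite /I_total mulrDr addrC; congr (_ + _).
    rewrite mulr_sumr big_mkcond; apply: eq_bigr => i _.
    rewrite -l1E l1x ext_rhs_lshift; case: ifP; rewrite ?mulr1 //.
    by rewrite mulr0 mul0r.
  move/eqP; rewrite mulf_eq0 => /orP [/eqP //|/eqP h].
  by have := I_total_ge1; rewrite h ler10.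
apply/rowP => k; case: (ext_cases k) => [[j ->]|->]; rewrite [RHS]mxE //.
by rewrite -l1E l1x x0 mul0r.
Qed.

Lemma ratio_gt0 : 0 < ratio.
Proof. by rewrite invr_gt0 !mulr_gt0 ?ltr0n ?exprn_gt0 ?(lt_le_trans ltr01). Qed.

Lemma ratioE : 16%:R * (d.+1%:R * (far * far * far) * ratio) = 1.
Proof.
rewrite mulrA [16%:R * _]mulrA -[X in X * _]invrK -/ratio mulVf //.
by rewrite gt_eqF // ratio_gt0.
Qed.

Lemma far3 : far <= far * far * far.
Proof.
have h := far_ge1; have h0 : 0 <= far by apply: le_trans h.
by rewrite -mulrA ler_peMr // -[1]mulr1 ler_pM.
Qed.

Lemma depth_ratio : 16%:R * (depth * ratio) <= 1.
Proof.
rewrite -[leRHS]ratioE ler_pM2l ?ltr0n // ler_wpM2r ?(ltW ratio_gt0) //.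
by rewrite ler_wpM2l ?ler0n // (le_trans powd_le_far) // far3.
Qed.

Lemma spread_depth_ratio : 16%:R * (spread * depth * ratio) <= 3%:R.
Proof.
rewrite -[leRHS]mulr1 -[X in _ <= _ * X]ratioE /spread /depth.
have -> : 16%:R * (3%:R * (G ^+ d * far) * (d.+1%:R * G ^+ d) * ratio) =
  3%:R * (16%:R * (d.+1%:R * (G ^+ d * far * G ^+ d) * ratio)) by ring.
rewrite !ler_pM2l ?ltr0n // ler_wpM2r ?(ltW ratio_gt0) // ler_wpM2l ?ler0n //.
have h0 : 0 <= far by apply: le_trans far_ge1.
rewrite ler_pM ?mulr_ge0 ?exprn_ge0 ?powd_le_far //.
by rewrite ler_wpM2r // powd_le_far.
Qed.

Lemma ratio_le : 16%:R * (d.+1%:R * ratio) <= 1.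
Proof.
rewrite -[leRHS]ratioE ler_pM2l ?ltr0n // ler_wpM2r ?(ltW ratio_gt0) //.
by rewrite ler_peMr ?ler0n // (le_trans far_ge1) // far3.
Qed.

Lemma ratio_le16 : 16%:R * ratio <= 1.
Proof.
apply: le_trans ratio_le; rewrite ler_pM2l ?ltr0n // ler_peMl ?(ltW ratio_gt0) //.
by rewrite ler1n.
Qed.

Lemma ratio_le1 : ratio <= 1.
Proof. by have := ratio_le16; have := ratio_gt0; lra. Qed.

Lemma ratioX_le i j : (i <= j)%N -> ratio ^+ j <= ratio ^+ i.
Proof. by move=> ij; rewrite ler_wiXn2l // ?(ltW ratio_gt0) // ratio_le1. Qed.

Lemma tiny_gt0 : 0 < tiny.
Proof. by rewrite exprn_gt0 // ratio_gt0. Qed.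

Lemma ext_coef_lshift i :
  ext_coef (lshift 1 i) 0 = if i \in I then tiny else slack i - ratio ^+ i.+1.
Proof. by rewrite col_mxEu mxE. Qed.

Lemma ext_coef_rshift : ext_coef (rshift m 0) 0 = extra_coef.
Proof. by rewrite col_mxEd mxE eqxx mulr1n. Qed.

Lemma ext_coef_gt0 i : 0 < ext_coef i 0.
Proof.
case: (ext_cases i) => [[j ->]|->]; rewrite ?ext_coef_lshift ?ext_coef_rshift.
  case: ifPn => [_|/slack_ge1 h]; first exact: tiny_gt0.
  have : ratio ^+ j.+1 <= ratio ^+ 1 by exact: ratioX_le.
  by rewrite expr1; have := ratio_le16; have := ratio_gt0; lra.
(* The coefficient is [I_total - d * tiny], and the first term is at least 1. *)
rewrite /extra_coef sumrB sumr_const I_card addrA.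
rewrite -/I_total -[_ *+ _]mulr_natl.
have h1 := I_total_ge1.
have h2 : tiny <= ratio by rewrite -[leRHS]expr1; apply: ratioX_le.
have h3 : d%:R * tiny <= d%:R * ratio by rewrite ler_wpM2l ?ler0n.
have h4 := ratio_le; rewrite -natr1 mulrDl mul1r in h4.
by have := ratio_gt0; lra.
Qed.

(* The center [c] exists by regularity of the tight rows, but is never computed:
   [extra_coef] only involves [A c] on these rows, and on the other ones
   [A c] is replaced by [A xU]. *)
Section Center.
Variable c : 'cV[R]_d.
Hypothesis hc : forall i, i \in I -> (A *m c) i 0 = b i 0 - tiny.

Let eta := rate ext_mx ext_rhs ext_coef c.

Lemma rate_J i : i \in J -> eta i = 0.
Proof.
case: (ext_cases i) => [[j ->]|->] iJ; rewrite /eta /rate.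
  rewrite J_lshift in iJ.
  by rewrite ext_mx_lshift ext_rhs_lshift ext_coef_lshift iJ hc //; ring.
rewrite ext_mx_rshift ext_rhs_rshift ext_coef_rshift /extra_coef.
by rewrite (eq_bigr (fun i => b i 0 - tiny) hc); ring.
Qed.

(** The error is [A_j (xU - c)]: a combination, with minors as coefficients, of the displacements
    [tiny] of the rows in [I]. The spare factor [ratio] in [tiny] absorbs [depth]. *)
Lemma rate_approx j : j \notin I ->
  `|eta (lshift 1 j) - ratio ^+ j.+1| <= ratio ^+ j.+1 / 2.
Proof.
move=> jI.
have [mu [smu muG e]] := basis_coefficients (A_row_int j) (A_row_G j).
have -> : eta (lshift 1 j) - ratio ^+ j.+1 = (A *m (xU - c)) j 0.
  rewrite /eta /rate ext_mx_lshift ext_rhs_lshift ext_coef_lshift (negPf jI) /slack.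
  rewrite mulmxBr [RHS]mxE [X in _ = _ + X]mxE; ring.
have -> : (A *m (xU - c)) j 0 = (\sum_i mu 0 i) * tiny.
  have := congr1 (fun B => (B *m (xU - c)) 0 0) e; rewrite -row_mul mxE => ->.
  rewrite -mulmxA mxE mulr_suml; apply: eq_bigr => i _.
  have [iI|/smu ->] := boolP (i \in I); last by rewrite !mul0r.
  rewrite mulmxBr [X in _ * X]mxE [X in _ + X]mxE hc // (tightP _ _ _ _ iI).
  by rewrite opprB addrCA subrr addr0.
have h1 : `|\sum_i mu 0 i| <= depth.
  apply: le_trans (ler_norm_sum _ _ _) _.
  apply: le_trans (sum_supported smu muG) _.
  by rewrite I_card ler_wpM2r ?exprn_ge0 // ler_nat.
rewrite normrM (ger0_norm (ltW tiny_gt0)).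
apply: le_trans (ler_wpM2r (ltW tiny_gt0) h1) _.
have h2 : tiny <= ratio * ratio ^+ j.+1.
  by rewrite -exprS; apply: ratioX_le; rewrite ltnS ltn_ord.
have depth0 : 0 <= depth by rewrite mulr_ge0 ?exprn_ge0.
apply: le_trans (ler_wpM2l depth0 h2) _; rewrite mulrA mulrC.
rewrite ler_wpM2l ?exprn_ge0 ?(ltW ratio_gt0) //.
by have := depth_ratio; lra.
Qed.

Lemma rate_bounds j : j \notin I ->
  ratio ^+ j.+1 / 2 <= eta (lshift 1 j) <= 3%:R / 2 * ratio ^+ j.+1.
Proof.
by move=> /rate_approx; rewrite ler_norml => /andP [h1 h2]; apply/andP; split; lra.
Qed.

Lemma rate_pos i : i \notin J -> 0 < eta i.
Proof.
move=> /notin_J [j -> jI]; have /andP [h _] := rate_bounds jI.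
by apply: lt_le_trans h; rewrite divr_gt0 // exprn_gt0 // ratio_gt0.
Qed.

(** The 3 is the quotient of the error factors 3/2 and 1/2 of [rate_bounds]. *)
Lemma rate_small i j : i \notin I -> j \notin I -> (j < i)%N ->
  eta (lshift 1 i) <= 3%:R * ratio * eta (lshift 1 j).
Proof.
move=> iI jI ij; have /andP [_ h1] := rate_bounds iI.
have /andP [h2 _] := rate_bounds jI.
have h3 : ratio ^+ i.+1 <= ratio * ratio ^+ j.+1.
  by rewrite -exprS; apply: ratioX_le.
have h4 : ratio * (ratio ^+ j.+1 / 2) <= ratio * eta (lshift 1 j).
  by rewrite ler_wpM2l // ltW // ratio_gt0.
by lra.
Qed.

Lemma rate_separated i j : i \notin J -> j \notin J -> i != j ->
  eta i <= eta j -> eta i <= 3%:R * ratio * eta j.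
Proof.
move=> iJ jJ; have ip := rate_pos iJ.
move: iJ jJ ip => /notin_J [i' -> iI] /notin_J [j' -> jI] ip.
rewrite (inj_eq (@lshift_inj _ _)) => ij le.
(* Smaller indices have larger rates, so the first case contradicts the assumed order. *)
case: (ltngtP i' j') => [lt|lt|/val_inj e]; last by rewrite e eqxx in ij.
  have := rate_small jI iI lt; have := ratio_le16; have := ratio_gt0 => r0 r1 h.
  have h2 : 3%:R * ratio * eta (lshift 1 i') <= 3%:R / 16%:R * eta (lshift 1 i').
    by rewrite ler_pM2r //; lra.
  by lra.
exact: rate_small.
Qed.

Let Q := polyhedron (rock_mx ext_mx ext_coef) (rock_rhs ext_rhs).

(** The simplex bounds the rows of [I] on the shadow, and every coordinate is a combination of these
    rows. *)
Lemma rock_bounded : bounded_set Q.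
Proof.
have c0 : 0 <= \sum_k `|c k 0| by rewrite sumr_ge0.
pose D := m%:R * (G ^+ d * (G + I_total)) + \sum_k `|c k 0| + 1.
have It := I_total_ge1.
have D1 : 1 <= D.
  rewrite lerDr addr_ge0 // mulr_ge0 ?ler0n // mulr_ge0 ?exprn_ge0 //.
  by rewrite addr_ge0 // (le_trans ler01).
exists D => y Qy k.
have z0 := height_ge0 Qy; have z1 := height_le1 rate_J _ Qy.
have {}z1 : height y <= 1 by apply: z1 => u s /simplex_slack [].
case: (split_ordP k) => k' ->; last first.
  by rewrite -[y]vsubmxK col_mxEd (ord1 k') ger0_norm // (le_trans z1).
have [h0 h1 s0] := simplex_slack (J_le rate_J Qy).
set u := shadow c y in h0 h1.
have uy : usubmx y k' 0 = u k' 0 + height y * c k' 0.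
  by rewrite /u /shadow !mxE subrK.
have Au i : i \in I -> `|(A *m u) i 0| <= G + I_total.
  move=> iI; have b1 : `|b i 0| <= G.
    by apply: le_trans b_G; rewrite [leRHS](bigD1 i) //= lerDl sumr_ge0.
  have h2 : (1 - height y) * b i 0 - (A *m u) i 0 <= I_total.
    apply: le_trans (_ : _ <= (1 - height y) * I_total) _.
      apply: le_trans h1; rewrite [leRHS](bigD1 i) //= lerDl sumr_ge0 //.
      by move=> i' /andP [i'I _]; apply: h0.
    by rewrite ler_piMl ?(le_trans ler01) // gerBl.
  have h3 := h0 i iI.
  have h4 : `|(1 - height y) * b i 0| <= G.
    by rewrite normrM ger0_norm // (le_trans _ b1) // ler_piMl // gerBl.
  rewrite ler_norml; move: h4; rewrite ler_norml => /andP [h4 h5].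
  by apply/andP; split; lra.
have [|| mu [smu muG e]] := @basis_coefficients (delta_mx 0 k').
- by move=> j; rewrite mxE natr_int.
- rewrite (bigD1 k') //= big1 ?addr0 => [|j jk]; rewrite mxE ?eqxx ?normr1 //.
  by rewrite (negPf jk) normr0.
have uk : `|u k' 0| <= m%:R * (G ^+ d * (G + I_total)).
  have -> : u k' 0 = ((delta_mx 0 k' : 'rV[R]_d) *m u) 0 0 by rewrite -rowE [RHS]mxE.
  rewrite e -mulmxA mxE; apply: le_trans (ler_norm_sum _ _ _) _.
  rewrite -[X in X%:R * _](card_ord m) -sum1_card natr_sum mulr_suml.
  apply: ler_sum => i _; rewrite mul1r normrM.
  have [/Au h|/smu ->] := boolP (i \in I); first by rewrite ler_pM.
  rewrite normr0 mul0r mulr_ge0 ?exprn_ge0 // addr_ge0 //.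
  by rewrite (le_trans ler01).
rewrite -[y]vsubmxK col_mxEu uy /D.
apply: le_trans (ler_normD _ _) _; rewrite -addrA lerD // normrM.
rewrite ger0_norm //; apply: le_trans (_ : `|c k' 0| <= _).
  by rewrite ler_piMl.
by rewrite -[leLHS]addr0 lerD // [leRHS](bigD1 k') //= lerDl sumr_ge0.
Qed.

Lemma rock_properties : [/\ simple_polytope Q,
  [set F | facet Q F] #<= `I_(m + 1 + 1) &
  exists2 delta, is_diameter Q delta & (delta <= 2 * (m - d + 1))%N].
Proof.
have C1 (u : 'cV[R]_d) s : (forall i, i \in J -> (ext_mx *m u) i 0 <= s * ext_rhs i 0) -> 0 <= s.
  by move=> /simplex_slack [].
have r0 := ratio_gt0; have r1 := ratio_le16.
have rho0 : 0 <= 3%:R * ratio by rewrite mulr_ge0 // ltW.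
have rho1 : 3%:R * ratio <= 1 by lra.
have K0 : 0 <= depth by rewrite mulr_ge0 ?exprn_ge0.
have Kr : depth * (3%:R * ratio) < 1 by have := depth_ratio; lra.
have CKr : spread * depth * (3%:R * ratio) < 1.
  by have := spread_depth_ratio; lra.
split.
- exact: (rock_simple rate_J rate_pos C1 simplex_apex0 simplex_spread
    ext_dependency rate_separated rho0 CKr spread_ge0 J_card J_dependency
    rock_bounded).
- exact: (rock_facets rate_J rate_pos C1 simplex_apex0 simplex_spread
    ext_dependency rate_separated rho0 CKr spread_ge0 J_dependency
    rock_bounded).
- have := rock_diameter rate_J rate_pos C1 simplex_apex0 simplex_spread
    ext_dependency rate_separated rho0 rho1 Kr CKr K0 spread_ge0
    J_card J_dependency
    rock_bounded.
  by have -> : ((m + 1 - d.+1).+1 = m - d + 1)%N by rewrite [(m + 1)%N]addn1 subSS addn1.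
Qed.

End Center.

Theorem rock_exists : let Q := polyhedron (rock_mx ext_mx ext_coef) (rock_rhs ext_rhs) in
  bounded_set Q /\
  [/\ simple_polytope Q, [set F | facet Q F] #<= `I_(m + 1 + 1) &
  exists2 delta, is_diameter Q delta & (delta <= 2 * (m - d + 1))%N].
Proof.
have [c hc] := indep_solve (fun i => b i 0 - tiny) I_indep.
by split; [apply: rock_bounded hc|apply: rock_properties hc].
Qed.

End Constants.

(** * Lengths and costs *)

Section Sizes.

Lemma bitlen_le n k : (n < 2 ^ k)%N -> (0 < k)%N -> (bitlen n <= k)%N.
Proof.
move=> nk k0; rewrite /bitlen; have [->|n0] := posnP n; first by rewrite trunc_log0.
by rewrite -(ltn_exp2l _ _ (ltnSn 1)) (leq_ltn_trans (trunc_logP _ n0)).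
Qed.

Lemma ltn_bitlen n : (n < 2 ^ bitlen n)%N.
Proof. exact: trunc_log_ltn. Qed.

Lemma bitlen_mono m n : (m <= n)%N -> (bitlen m <= bitlen n)%N.
Proof.
by move=> mn; apply: bitlen_le => //; apply: leq_ltn_trans mn (ltn_bitlen n).
Qed.

Lemma bitlen_leS n : (bitlen n <= n.+1)%N.
Proof. by apply: bitlen_le => //; apply: ltn_trans (ltnSn n) (ltn_expl _ _). Qed.

Lemma bitlenM m n : (bitlen (m * n) <= bitlen m + bitlen n)%N.
Proof.
apply: bitlen_le => //; rewrite expnD.
have [->|n0] := posnP n; first by rewrite muln0 muln_gt0 !expn_gt0.
apply: leq_ltn_trans (_ : (m * 2 ^ bitlen n < _)%N).
  by rewrite leq_mul2l ltnW ?orbT ?ltn_bitlen.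
by rewrite ltn_pmul2r ?expn_gt0 // ltn_bitlen.
Qed.

Lemma bitlenD m n : (bitlen (m + n) <= bitlen m + bitlen n)%N.
Proof.
apply: bitlen_le => //; rewrite expnD.
have hm := ltn_bitlen m; have hn := ltn_bitlen n.
have hm2 : (2 <= 2 ^ bitlen m)%N by rewrite (leq_pexp2l (n1 := 1)).
have hn2 : (2 <= 2 ^ bitlen n)%N by rewrite (leq_pexp2l (n1 := 1)).
move: (2 ^ bitlen m)%N (2 ^ bitlen n)%N hm hn hm2 hn2 => x y; nia.
Qed.

(** Exponents [E] simply add up under arithmetic, up to a constant, which makes this form more
    convenient than [ratlen]. *)
Definition szb (x : rat) (E : nat) : bool :=
  (`|numq x| <= 2 ^ E)%N && (`|denq x| <= 2 ^ E)%N.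

(** The numerator and denominator in lowest terms divide those of any other representation, so
    reduction never increases the size. *)
Lemma szb_frac x (p q : int) E : q != 0 -> x * q%:~R = p%:~R ->
  (`|p| <= 2 ^ E)%N -> (`|q| <= 2 ^ E)%N -> szb x E.
Proof.
move=> q0 e pE qE.
have d0 : (denq x)%:~R != 0 :> rat by rewrite intr_eq0 denq_neq0.
have e1 : numq x * q = p * denq x.
  by apply: (@intr_inj rat); rewrite !rmorphM /= -e numqE; ring.
have cop := coprime_num_den x.
apply/andP; split; last first.
  apply: leq_trans qE; apply: dvdn_leq; first by rewrite absz_gt0.
  rewrite -(@Gauss_dvdr _ `|numq x|); last by rewrite coprime_sym.
  by rewrite -abszM e1 abszM dvdn_mull.
have [p0|p0] := eqVneq p 0.
  move: e1; rewrite p0 mul0r => /eqP; rewrite mulf_eq0 (negPf q0) orbF.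
  by move=> /eqP ->; rewrite absz0.
apply: leq_trans pE; apply: dvdn_leq; first by rewrite absz_gt0.
by rewrite -(Gauss_dvdl _ cop) -abszM -e1 abszM dvdn_mulr.
Qed.

Lemma szb_le x E E' : (E <= E')%N -> szb x E -> szb x E'.
Proof.
move=> h /andP [h1 h2]; have h3 : (2 ^ E <= 2 ^ E')%N by rewrite leq_exp2l.
by rewrite /szb (leq_trans h1) // (leq_trans h2).
Qed.

Lemma szbM x y E F : szb x E -> szb y F -> szb (x * y) (E + F).
Proof.
move=> /andP [xn xd] /andP [yn yd].
apply: (@szb_frac _ (numq x * numq y) (denq x * denq y)).
- by rewrite mulf_neq0 ?denq_neq0.
- by rewrite !rmorphM /= !numqE; ring.
- by rewrite abszM expnD leq_mul.
- by rewrite abszM expnD leq_mul.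
Qed.

Lemma szbD x y E F : szb x E -> szb y F -> szb (x + y) (E + F + 1).
Proof.
move=> /andP [xn xd] /andP [yn yd].
apply: (@szb_frac _ (numq x * denq y + numq y * denq x) (denq x * denq y)).
- by rewrite mulf_neq0 ?denq_neq0.
- by rewrite rmorphD !rmorphM /= !numqE; ring.
- have h1 := leq_mul xn yd; have h2 := leq_mul yn xd.
  rewrite -!abszM -!expnD in h1 h2.
  rewrite addn1 expnS; move: h1 h2; rewrite [(F + E)%N]addnC.
  by move: (_ * _) (_ * _) (2 ^ _)%N => u v w; lia.
- rewrite abszM addn1 expnS expnD.
  by apply: leq_trans (leq_mul xd yd) _; rewrite leq_pmull.
Qed.

Lemma szbN x E : szb (- x) E = szb x E.
Proof. by rewrite /szb numqN denqN abszN. Qed.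

Lemma szbB x y E F : szb x E -> szb y F -> szb (x - y) (E + F + 1).
Proof. by move=> hx hy; apply: szbD; rewrite ?szbN. Qed.

Lemma szb_nat n E : (n <= 2 ^ E)%N -> szb n%:R E.
Proof.
by move=> nE; apply: (@szb_frac _ n 1); rewrite ?mulr1 // expn_gt0.
Qed.

Lemma szb1 E : szb 1 E.
Proof. by apply: (szb_nat (n := 1)); rewrite expn_gt0. Qed.

Lemma szb0 E : szb 0 E.
Proof. exact: (szb_nat (n := 0)). Qed.

Lemma szbV x E : szb x E -> szb x^-1 E.
Proof.
move=> /andP [xn xd]; have [->|x0] := eqVneq x 0.
  by rewrite invr0 szb0.
apply: (@szb_frac _ (denq x) (numq x)); rewrite ?numq_eq0 //.
by rewrite numqE mulKf.
Qed.

Lemma ratlen_szb x E : szb x E -> (ratlen x <= 2 * E + 3)%N.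
Proof.
move=> /andP [xn xd]; rewrite /ratlen.
have h p : (p <= 2 ^ E)%N -> (bitlen p <= E.+1)%N.
  by move=> pE; apply: bitlen_le => //; rewrite (leq_ltn_trans pE) // ltn_exp2l.
have := h _ xn; have := h _ xd; lia.
Qed.

Lemma szb_ratlen x : szb x (ratlen x).
Proof.
apply/andP; split; apply: ltnW; apply: leq_trans (ltn_bitlen _) _;
  rewrite leq_exp2l // /ratlen; lia.
Qed.

Lemma szb_sum (f : nat -> rat) n E : (forall i, (i < n)%N -> szb (f i) E) ->
  szb (\sum_(0 <= i < n) f i) (n * (E + 1)).
Proof.
elim: n => [|n IH] h; first by rewrite big_nil szb0.
rewrite big_nat_recr //= mulSn addnC.
rewrite addnA; apply: szbD; last exact: h.
by apply: IH => i lin; apply: h; apply: leqW.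
Qed.

Lemma szb_prod (f : nat -> rat) n E : (forall i, (i < n)%N -> szb (f i) E) ->
  szb (\prod_(0 <= i < n) f i) (n * E).
Proof.
elim: n => [|n IH] h; first by rewrite big_nil szb1.
rewrite big_nat_recr //= mulSn addnC; apply: szbM; last exact: h.
by apply: IH => i lin; apply: h; apply: leqW.
Qed.

Lemma szbX x n E : szb x E -> szb (x ^+ n) (n * E).
Proof.
move=> hx; elim: n => [|n IH]; first by rewrite expr0 szb1.
by rewrite exprS mulSn szbM.
Qed.

End Sizes.

(** * Costs of expressions, assignments and loops *)

Section Costs.
Variable l : nat.
Hypothesis l_gt0 : (0 < l)%N.

(** Only the leaves are bounded by [l]; the length of a value then exceeds [l] at most by the factor
    [isteps e]. *)
Fixpoint iok (s : state) (e : iexp) : Prop :=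
  match e with
  | IConst n => (bitlen n <= l)%N
  | IReg r => (bitlen (reg s r) <= l)%N
  | IOp _ e1 e2 => iok s e1 /\ iok s e2
  end.

Fixpoint qok (s : state) (e : qexp) : Prop :=
  match e with
  | QConst c => szb c l
  | QCell a i j =>
      [/\ iok s i, iok s j & szb (cell s a (ival s i) (ival s j)) l]
  | QOfIndex e => iok s e
  | QOp _ e1 e2 => qok s e1 /\ qok s e2
  end.

Fixpoint bok (s : state) (e : bexp) : Prop :=
  match e with
  | BILe e1 e2 => iok s e1 /\ iok s e2
  | BQLe e1 e2 => qok s e1 /\ qok s e2
  | BNot e => bok s e
  | BAnd e1 e2 => bok s e1 /\ bok s e2
  end.

Lemma qsteps_gt0 e : (0 < qsteps e)%N. Proof. by case: e => //= *; lia. Qed.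

Lemma ival_bitlen s e : iok s e -> (bitlen (ival s e) <= isteps e * l)%N.
Proof.
elim: e => [n|r|o e1 IH1 e2 IH2] /=; rewrite ?mul1n // => -[/IH1 h1 /IH2 h2].
have : (bitlen (iop_val o (ival s e1) (ival s e2)) <=
    bitlen (ival s e1) + bitlen (ival s e2))%N.
  case: o => /=; [exact: bitlenD| |exact: bitlenM].
  by apply: leq_trans (leq_addr _ _); apply/bitlen_mono/leq_subr.
by move=> h; rewrite !mulnDl; lia.
Qed.

Lemma qval_szb s e : qok s e -> szb (qval s e) (qsteps e * l).
Proof.
elim: e => [c|a i j|e|o e1 IH1 e2 IH2] /=.
- by rewrite mul1n.
- by case=> _ _; apply: szb_le; rewrite leq_pmull // addn1.
- move=> /ival_bitlen h; apply: szb_nat; apply: ltnW.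
  apply: leq_trans (ltn_bitlen _) _; rewrite leq_exp2l //.
  by rewrite (leq_trans h) // leq_mul2r leq_addr orbT.
case=> /IH1 h1 /IH2 h2; rewrite !mulnDl mul1n.
case: o => /=.
- by apply: szb_le (szbD h1 h2); rewrite leq_add2l.
- by apply: szb_le (szbB h1 h2); rewrite leq_add2l.
- by apply: szb_le (szbM h1 h2); rewrite leq_addr.
- by apply: szb_le (szbM h1 (szbV h2)); rewrite leq_addr.
Qed.

Lemma ratlen_qval s e : qok s e -> (ratlen (qval s e) <= 5 * (qsteps e * l))%N.
Proof.
move=> /qval_szb/ratlen_szb h; apply: leq_trans h _.
have : (0 < qsteps e * l)%N by rewrite muln_gt0 qsteps_gt0.
by move: (qsteps e * l)%N => x; lia.
Qed.

(* Every expression of [program] below has at most 40 steps, and its leaves are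
   numbers of length at most [l]. *)
Definition unit_cost : nat := ((5 * (40 * l)) ^ 2)%N.

Lemma unit_cost_ge k : (k <= 40)%N -> ((5 * (k * l)) ^ 2 <= unit_cost)%N.
Proof. by move=> k40; rewrite leq_exp2r // leq_mul2l leq_mul2r k40 orbT. Qed.

Lemma unit_cost_lin k : (k <= 40)%N -> (5 * (k * l) <= unit_cost)%N.
Proof.
move=> k40; have [->|k0] := posnP k; first by rewrite mul0n muln0.
apply: leq_trans (unit_cost_ge k40); rewrite expnS expn1 leq_pmull //.
by rewrite !muln_gt0 k0 l_gt0.
Qed.

Lemma unit_cost_gt0 : (0 < unit_cost)%N.
Proof. by rewrite /unit_cost expn_gt0 !muln_gt0 l_gt0. Qed.

Let U := unit_cost.

Lemma ibits_le s e : iok s e -> (isteps e <= 40)%N -> (ibits s e <= isteps e * U)%N.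
Proof.
elim: e => [n|r|o e1 IH1 e2 IH2] /=.
- move=> h _; rewrite mul1n (leq_trans h) //.
  by apply: leq_trans (unit_cost_lin (k := 1) _); rewrite // mul1n leq_pmull.
- move=> h _; rewrite mul1n (leq_trans h) //.
  by apply: leq_trans (unit_cost_lin (k := 1) _); rewrite // mul1n leq_pmull.
move=> [o1 o2] le.
have h1 := IH1 o1 ltac:(lia); have h2 := IH2 o2 ltac:(lia).
have b1 := ival_bitlen o1; have b2 := ival_bitlen o2.
rewrite !mulnDl mul1n leq_add // ?leq_add //.
apply: leq_trans (unit_cost_ge (k := isteps e1 + isteps e2) _); last by lia.
by rewrite leq_exp2r // mulnDl (leq_trans (leq_add b1 b2)) // leq_pmull.
Qed.

Lemma qbits_le s e : qok s e -> (qsteps e <= 40)%N -> (qbits s e <= qsteps e * U)%N.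
Proof.
elim: e => [c|a i j|e|o e1 IH1 e2 IH2] /=.
- move=> h _; rewrite mul1n; have := @ratlen_qval s (QConst c) h.
  by move/leq_trans; apply; rewrite /= unit_cost_lin.
- move=> h; have [hi hj hc] := h => le.
  rewrite !mulnDl mul1n leq_add //.
    by rewrite leq_add // ibits_le //; lia.
  apply: leq_trans (unit_cost_lin (k := 1) _) => //.
  by apply: leq_trans (ratlen_szb hc) _; rewrite mul1n; lia.
- move=> h le; rewrite mulnDl mul1n leq_add // ?ibits_le //; first by lia.
  apply: leq_trans (ival_bitlen h) _.
  apply: leq_trans (unit_cost_lin (k := isteps e) _); last by lia.
  by rewrite leq_pmull.
move=> [o1 o2] le.
have h1 := IH1 o1 ltac:(lia); have h2 := IH2 o2 ltac:(lia).
have b1 := ratlen_qval o1; have b2 := ratlen_qval o2.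
rewrite !mulnDl mul1n leq_add // ?leq_add //.
apply: leq_trans (unit_cost_ge (k := qsteps e1 + qsteps e2) _); last by lia.
by rewrite leq_exp2r // mulnDl mulnDr leq_add.
Qed.

Lemma bbits_le s e : bok s e -> (bsteps e <= 40)%N -> (bbits s e <= bsteps e * U)%N.
Proof.
have U0 := unit_cost_gt0.
elim: e => [e1 e2|e1 e2|e IH|e1 IH1 e2 IH2] /=.
- move=> [o1 o2] le.
  have b1 := ival_bitlen o1; have b2 := ival_bitlen o2.
  rewrite !mulnDl mul1n leq_add // ?leq_add // ?ibits_le //; try by lia.
  apply: leq_trans (unit_cost_ge (k := isteps e1 + isteps e2) _); last by lia.
  by rewrite leq_exp2r // mulnDl (leq_trans (leq_add b1 b2)) // leq_pmull.
- move=> [o1 o2] le.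
  have b1 := ratlen_qval o1; have b2 := ratlen_qval o2.
  rewrite !mulnDl mul1n leq_add // ?leq_add // ?qbits_le //; try by lia.
  apply: leq_trans (unit_cost_ge (k := qsteps e1 + qsteps e2) _); last by lia.
  by rewrite leq_exp2r // mulnDl mulnDr leq_add.
- by move=> h le; rewrite mulnDl mul1n leq_add // IH //; lia.
move=> [o1 o2] le; rewrite !mulnDl mul1n leq_add // leq_add //.
  by rewrite IH1 //; lia.
by rewrite IH2 //; lia.
Qed.

(** Bit operations are bounded through the actual number [t] of steps, so that both bounds compose
    and a single count of steps suffices. *)
Definition run (c : cmd) (s s' : state) (T : nat) : Prop :=
  exists t w, [/\ exec c s s' t w, (t <= T)%N & (w <= t * U)%N].

Lemma run_le c s s' T T' : (T <= T')%N -> run c s s' T -> run c s s' T'.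
Proof. by move=> h [t [w [? ? ?]]]; exists t, w; split=> //; apply: leq_trans h. Qed.

Lemma run_set_reg r e s : iok s e -> (isteps e <= 40)%N ->
  run (ISet r e) s (set_reg s r (ival s e)) 41.
Proof.
move=> ok le; eexists; eexists; split; first exact: exec_ISet.
  by rewrite addn1.
rewrite mulnDl mul1n leq_add ?ibits_le //.
apply: leq_trans (ival_bitlen ok) _.
by apply: leq_trans (unit_cost_lin le); rewrite leq_pmull.
Qed.

Lemma run_set_cell a i j e s : iok s i -> iok s j -> qok s e ->
  (isteps i <= 40)%N -> (isteps j <= 40)%N -> (qsteps e <= 40)%N ->
  run (QSet a i j e) s (set_cell s a (ival s i) (ival s j) (qval s e)) 121.
Proof.
move=> oi oj oe li lj le; eexists; eexists; split; first exact: exec_QSet.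
  by lia.
rewrite !mulnDl mul1n leq_add // ?leq_add // ?ibits_le ?qbits_le //.
by apply: leq_trans (ratlen_qval oe) _; apply: unit_cost_lin.
Qed.

Lemma run_seq c1 c2 s s' s'' T1 T2 : run c1 s s' T1 -> run c2 s' s'' T2 ->
  run (Seq c1 c2) s s'' (T1 + T2).
Proof.
move=> [t1 [w1 [e1 ? ?]]] [t2 [w2 [e2 ? ?]]].
exists (t1 + t2)%N, (w1 + w2)%N; split; first exact: exec_Seq e1 e2.
  by rewrite leq_add.
by rewrite mulnDl leq_add.
Qed.

Lemma run_if e c1 c2 s s' T : bok s e -> (bsteps e <= 40)%N ->
  run (if bval s e then c1 else c2) s s' T -> run (If e c1 c2) s s' (T + 41).
Proof.
move=> ok le [t [w [ex tT wT]]].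
exists (bsteps e + t + 1)%N, (bbits s e + w + 1)%N; split; last first.
- rewrite !mulnDl mul1n leq_add ?unit_cost_gt0 // leq_add //.
  exact: bbits_le.
- by lia.
by case: ifP ex => b ex; [apply: exec_IfTrue|apply: exec_IfFalse; rewrite // b].
Qed.

(** The test [r + 1 <= e] is [r < e], and [e] is evaluated anew before each iteration. *)
Definition ifor (r : nat) (e : iexp) (c : cmd) : cmd :=
  Seq (ISet r (IConst 0))
      (While (BILe (IOp IAdd (IReg r) (IConst 1)) e)
             (Seq c (ISet r (IOp IAdd (IReg r) (IConst 1))))).

(* [F k] is the state before iteration [k], and [H k] the state after the body
   of that iteration. *)
Lemma run_for r e c n (F H : nat -> state) s T :
  (isteps e <= 36)%N -> (bitlen n.+1 <= l)%N ->
  set_reg s r 0 = F 0%N ->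
  (forall k, (k <= n)%N -> [/\ reg (F k) r = k, ival (F k) e = n & iok (F k) e]) ->
  (forall k, (k < n)%N -> [/\ run c (F k) (H k) T, reg (H k) r = k &
                              set_reg (H k) r k.+1 = F k.+1]) ->
  run (ifor r e c) s (F n) (n.+1 * (T + 123)).
Proof.
move=> le ln F0 hF hH.
have l1 : (bitlen 1 <= l)%N by apply: leq_trans ln; apply: bitlen_mono.
have l0 : (bitlen 0 <= l)%N by apply: leq_trans ln; apply: bitlen_mono.
have lk k : (k <= n)%N -> (bitlen k <= l)%N.
  by move=> kn; apply: leq_trans ln; apply: bitlen_mono; apply: leqW.
suff h k : (k <= n)%N ->
    run (While (BILe (IOp IAdd (IReg r) (IConst 1)) e)
             (Seq c (ISet r (IOp IAdd (IReg r) (IConst 1)))))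
        (F k) (F n) (41 + (n - k) * (T + 82)).
  apply: run_le (run_seq (s' := F 0%N) (T1 := 41) _ (h 0%N _)) => //.
    by rewrite subn0 mulSn mulnDr mulnDr; lia.
  by rewrite -F0; apply: (@run_set_reg r (IConst 0) s).
move=> kn; have [j] := ubnP (n - k); elim: j k kn => // j IH k kn nk.
have [rk ek oke] := hF k kn.
have okb : bok (F k) (BILe (IOp IAdd (IReg r) (IConst 1)) e).
  by do !split=> //=; rewrite rk lk.
have lb : (bsteps (BILe (IOp IAdd (IReg r) (IConst 1)) e) <= 40)%N by rewrite /=; lia.
have hb := bbits_le okb lb; have U0 := unit_cost_gt0.
have bE : bval (F k) (BILe (IOp IAdd (IReg r) (IConst 1)) e) = (k < n)%N.
  by rewrite /= rk ek addn1.
move: lb hb bE okb; set be := BILe _ _ => lb hb bE okb.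
have [lt|ge] := ltnP k n; last first.
  have -> : k = n by apply/eqP; rewrite eqn_leq kn.
  have -> : F n = F k by congr F; apply/eqP; rewrite eqn_leq kn ge.
  eexists; eexists; split; first by apply: exec_WhileStop; rewrite bE -leqNgt.
    by lia.
  by rewrite mulnDl mul1n leq_add.
have [rc rH eH] := hH k lt.
have [t1 [w1 [e1 h1 h1']]] : run (Seq c (ISet r (IOp IAdd (IReg r) (IConst 1))))
    (F k) (F k.+1) (T + 41).
  apply: run_seq rc _; rewrite -eH.
  have -> : k.+1 = ival (H k) (IOp IAdd (IReg r) (IConst 1)).
    by rewrite /= rH addn1.
  by apply: run_set_reg => //; rewrite /= rH; split=> //; apply: lk.
have [t2 [w2 [e2 h2 h2']]] := IH k.+1 lt ltac:(lia).
exists (bsteps be + t1 + t2 + 1)%N, (bbits (F k) be + w1 + w2 + 1)%N; split.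
- by apply: (exec_WhileStep _ e1 e2); rewrite bE.
- have -> : (n - k = (n - k.+1).+1)%N by lia.
  rewrite mulSn; move: h1 h2 lb; move: (_ * _)%N (bsteps be) => z y; lia.
- move: hb; move: (bsteps be) (bbits _ _) => y z hb.
  by rewrite !mulnDl mul1n; do 3!apply: leq_add => //.
Qed.

End Costs.

(** * The program *)

Definition col0 (f : nat -> rat) (x y : nat) : rat := if y == 0%N then f x else 0.
Definition upd1 (f : nat -> rat) (i : nat) v (x : nat) : rat :=
  if x == i then v else f x.
Definition upd2 (f : nat -> nat -> rat) (i j : nat) v (x y : nat) : rat :=
  if (x == i) && (y == j) then v else f x y.

Definition reg_i := IReg 2.
Definition reg_j := IReg 3.
Definition idx0 := IConst 0.
(** Scalars 0 to 5 are the common denominator, the bound [G] on the entries, [far], [ratio], [tiny]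
    and the current power of [ratio]. *)
Definition scal k := QCell 8 (IConst k) idx0.
Definition set_scal k e := QSet 8 (IConst k) idx0 e.
Definition qA i j := QOp QDiv (QCell 0 i j) (QCell 1 i j).
Definition qb i := QOp QDiv (QCell 2 i idx0) (QCell 3 i idx0).
Definition qx j := QOp QDiv (QCell 4 j idx0) (QCell 5 j idx0).
Definition qmul := QOp QMul.
Definition qadd := QOp QAdd.
Definition qsub := QOp QSub.
Definition isucc e := IOp IAdd e (IConst 1).

Definition prog_den : cmd :=
  Seq (set_scal 0 (QConst 1))
 (Seq (ifor 2 (IReg 0) (ifor 3 (IReg 1)
        (set_scal 0 (qmul (scal 0) (QCell 1 reg_i reg_j)))))
 (Seq (ifor 2 (IReg 0) (set_scal 0 (qmul (scal 0) (QCell 3 reg_i idx0))))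
      (ifor 2 (IReg 1) (set_scal 0 (qmul (scal 0) (QCell 5 reg_i idx0)))))).

Definition prog_scale : cmd :=
  Seq (ifor 2 (IReg 0) (ifor 3 (IReg 1)
        (QSet 6 reg_i reg_j (qmul (qA reg_i reg_j) (qmul (scal 0) (scal 0))))))
 (Seq (ifor 2 (IReg 0) (QSet 7 reg_i idx0 (qmul (qb reg_i) (qmul (scal 0) (scal 0)))))
      (ifor 2 (IReg 0) (Seq (QSet 9 reg_i idx0 (QCell 7 reg_i idx0)) (ifor 3 (IReg 1)
        (QSet 9 reg_i idx0 (qsub (QCell 9 reg_i idx0) (qmul (QCell 6 reg_i reg_j) (qx reg_j)))))))).

Definition prog_bound : cmd :=
  Seq (set_scal 1 (QConst 1))
 (Seq (ifor 2 (IReg 0) (ifor 3 (IReg 1)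
        (set_scal 1 (qadd (scal 1) (qmul (QCell 6 reg_i reg_j) (QCell 6 reg_i reg_j))))))
 (Seq (ifor 2 (IReg 0)
        (set_scal 1 (qadd (scal 1) (qmul (QCell 7 reg_i idx0) (QCell 7 reg_i idx0)))))
 (Seq (set_scal 2 (QConst 1))
      (ifor 2 (isucc (IReg 1)) (set_scal 2 (qmul (scal 2) (scal 1))))))).

Definition prog_ratio : cmd :=
  Seq (set_scal 3 (QOp QDiv (QConst 1)
    (qmul (qmul (QOfIndex (IConst 16)) (QOfIndex (isucc (IReg 1))))
          (qmul (qmul (scal 2) (scal 2)) (scal 2)))))
 (Seq (set_scal 4 (QConst 1))
      (ifor 2 (isucc (IReg 0)) (set_scal 4 (qmul (scal 4) (scal 3))))).

Definition prog_row : cmd :=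
  ifor 2 (IReg 0) (If (BQLe (QCell 9 reg_i idx0) (QConst 0))
    (ifor 3 (IReg 1) (QSet 6 (IReg 0) reg_j
       (qsub (QCell 6 (IReg 0) reg_j) (QCell 6 reg_i reg_j))))
    Skip).

(** Row [m.+1] expresses z >= 0: only its coefficient -1 is written, as its other entries and its
    right-hand side keep their initial value 0. *)
Definition prog_coef : cmd :=
  Seq (QSet 7 (IReg 0) idx0 (qadd (scal 2) (QConst 1)))
 (Seq (QSet 6 (IReg 0) (IReg 1) (qadd (scal 2) (QConst 1)))
 (Seq (set_scal 5 (QConst 1))
 (Seq (ifor 2 (IReg 0) (Seq (set_scal 5 (qmul (scal 5) (scal 3)))
        (If (BQLe (QCell 9 reg_i idx0) (QConst 0))
          (Seq (QSet 6 reg_i (IReg 1) (scal 4))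
               (QSet 6 (IReg 0) (IReg 1) (qadd (QCell 6 (IReg 0) (IReg 1))
                  (qsub (QCell 7 reg_i idx0) (scal 4)))))
          (QSet 6 reg_i (IReg 1) (qsub (QCell 9 reg_i idx0) (scal 5))))))
      (QSet 6 (isucc (IReg 0)) (IReg 1) (qsub (QConst 0) (QConst 1)))))).

Definition program : cmd :=
  Seq prog_den (Seq prog_scale (Seq prog_bound (Seq prog_ratio
    (Seq prog_row prog_coef)))).

(** * Correctness and cost of the program *)

Section Program.
Variables (m d : nat) (A : 'M[rat]_(m, d)) (b : 'cV[rat]_m) (x : 'cV[rat]_d).

Definition mem : Type :=
  ((nat -> nat -> rat) * (nat -> rat) * seq rat * (nat -> rat))%type.

(* Registers 2 and 3 are the loop counters; array 7 and the scratch arrays 8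
   (scalars) and 9 (slacks) only use their column 0. *)
Definition St (i j : nat) (M : mem) : state :=
  let: (fA, fb, sc, fs) := M in
  State (fun r => match r with 0 => m | 1 => d | 2 => i | 3 => j | _ => 0 end%N)
        (fun a => match a with
         | 0 => num_cells A | 1 => den_cells A
         | 2 => num_cells b | 3 => den_cells b
         | 4 => num_cells x | 5 => den_cells x
         | 6 => fA | 7 => col0 fb | 8 => col0 (nth 0%R sc) | 9 => col0 fs
         | _ => fun _ _ => 0%R
         end%N).

Lemma input_St :
  input_state A b x = St 0 0 (fun _ _ => 0, fun=> 0, [::], fun=> 0).
Proof.
congr State; first by apply/funext => -[|[|[|[|r]]]].
apply/funext => -[|[|[|[|[|[|[|[|[|[|a]]]]]]]]]] //;
  apply/funext => i; apply/funext => j; rewrite /col0 ?nth_nil; by case: ifP.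
Qed.

Lemma set_reg2 i j M n : set_reg (St i j M) 2 n = St n j M.
Proof. by case: M => -[[? ?] ?] ?; congr State; apply/funext => -[|[|[|[|r]]]]. Qed.

Lemma set_reg3 i j M n : set_reg (St i j M) 3 n = St i n M.
Proof. by case: M => -[[? ?] ?] ?; congr State; apply/funext => -[|[|[|[|r]]]]. Qed.

Lemma reg2 i j M : reg (St i j M) 2 = i. Proof. by case: M => -[[]]. Qed.
Lemma reg3 i j M : reg (St i j M) 3 = j. Proof. by case: M => -[[]]. Qed.

Ltac cells := congr State; apply/funext => -[|[|[|[|[|[|[|[|[|[|a]]]]]]]]]] //=;
  apply/funext => p'; apply/funext => q' //=.

Lemma set_cell6 i j fA fb sc fs p q v :
  set_cell (St i j (fA, fb, sc, fs)) 6 p q v = St i j (upd2 fA p q v, fb, sc, fs).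
Proof. by cells. Qed.

Lemma set_cell7 i j fA fb sc fs p v :
  set_cell (St i j (fA, fb, sc, fs)) 7 p 0 v = St i j (fA, upd1 fb p v, sc, fs).
Proof. by cells; rewrite /col0 /upd1; case: eqP; case: eqP. Qed.

Lemma set_cell8 i j fA fb sc fs p v :
  set_cell (St i j (fA, fb, sc, fs)) 8 p 0 v = St i j (fA, fb, set_nth 0 sc p v, fs).
Proof. by cells; rewrite /col0 nth_set_nth /=; case: eqP; case: eqP. Qed.

Lemma set_cell9 i j fA fb sc fs p v :
  set_cell (St i j (fA, fb, sc, fs)) 9 p 0 v = St i j (fA, fb, sc, upd1 fs p v).
Proof. by cells; rewrite /col0 /upd1; case: eqP; case: eqP. Qed.

Variable l : nat.
Hypothesis idx : forall k, (k <= m + d + 16)%N -> (bitlen k <= l)%N.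

Let l_gt0 : (0 < l)%N.
Proof. by apply: leq_trans (idx (leq0n _)). Qed.

Definition loop_cost (n T : nat) := (n.+1 * (T + 123))%N.

Definition loop_bound e n := [/\ (isteps e <= 36)%N, (n < m + d + 16)%N &
  forall i j M, ival (St i j M) e = n /\ iok l (St i j M) e].

Lemma loop_bound_m : loop_bound (IReg 0) m.
Proof.
split=> // [|i j [[[]]]]; first by lia.
by move=> *; split=> //=; apply: idx; lia.
Qed.

Lemma loop_bound_d : loop_bound (IReg 1) d.
Proof.
split=> // [|i j [[[]]]]; first by lia.
by move=> *; split=> //=; apply: idx; lia.
Qed.

Lemma loop_bound_m1 : loop_bound (isucc (IReg 0)) m.+1.
Proof.
split=> // [|i j [[[]]]]; first by lia.
by move=> * /=; split; [rewrite addn1|split; apply: idx; lia].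
Qed.

Lemma loop_bound_d1 : loop_bound (isucc (IReg 1)) d.+1.
Proof.
split=> // [|i j [[[]]]]; first by lia.
by move=> * /=; split; [rewrite addn1|split; apply: idx; lia].
Qed.

Lemma for3 e c n i j (P : nat -> mem) T : loop_bound e n ->
  (forall k, (k < n)%N -> run l c (St i k (P k)) (St i k (P k.+1)) T) ->
  run l (ifor 3 e c) (St i j (P 0%N)) (St i n (P n)) (loop_cost n T).
Proof.
move=> [le ln en] body.
apply: (@run_for l l_gt0 3 e c n (fun k => St i k (P k)) (fun k => St i k (P k.+1)))
  => //.
- exact: idx.
- exact: set_reg3.
- by move=> k kn; rewrite reg3; split=> //; have [] := en i k (P k).
- by move=> k kn; rewrite reg3 set_reg3; split=> //; apply: body.
Qed.

(** The final loop counters are left unspecified: register 3 depends on which branches ran an inner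
    loop. *)
Definition mrun c M M' T := forall i j, exists i' j',
  run l c (St i j M) (St i' j' M') T.

Lemma for2 e c n (P : nat -> mem) T : loop_bound e n ->
  (forall k j, (k < n)%N -> exists j', run l c (St k j (P k)) (St k j' (P k.+1)) T) ->
  mrun (ifor 2 e c) (P 0%N) (P n) (loop_cost n T).
Proof.
move=> [le ln en] body i j.
have /boolp.choice [g hg] (kj : nat * nat) : exists j', (kj.1 < n)%N ->
    run l c (St kj.1 kj.2 (P kj.1)) (St kj.1 j' (P kj.1.+1)) T.
  have [lt|ge] := ltnP kj.1 n; last by exists 0%N.
  by have [j' hj'] := body kj.1 kj.2 lt; exists j'.
(* The contents of register 3 at the start of each iteration, as left by the previous one. *)
pose q := fix q k := if k is k'.+1 then g (k', q k') else j.
exists n, (q n).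
apply: (@run_for l l_gt0 2 e c n (fun k => St k (q k) (P k))
  (fun k => St k (q k.+1) (P k.+1))) => //.
- exact: idx.
- exact: set_reg2.
- by move=> k kn; rewrite reg2; split=> //; have [] := en k (q k) (P k).
- by move=> k kn; rewrite reg2 set_reg2; split=> //; apply: (hg (k, q k)).
Qed.

Lemma mrun_seq c c' M M' M'' T T' : mrun c M M' T -> mrun c' M' M'' T' ->
  mrun (Seq c c') M M'' (T + T').
Proof.
move=> h h' i j; have [i1 [j1 h1]] := h i j; have [i2 [j2 h2]] := h' i1 j1.
by exists i2, j2; apply: run_seq h1 h2.
Qed.

Section Assignments.
Variables (i j : nat) (fA : nat -> nat -> rat) (fb : nat -> rat) (sc : seq rat)
  (fs : nat -> rat).
Let s := St i j (fA, fb, sc, fs).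

Lemma run6 ei ej e fA' : iok l s ei -> iok l s ej -> qok l s e ->
  (isteps ei <= 40)%N -> (isteps ej <= 40)%N -> (qsteps e <= 40)%N ->
  upd2 fA (ival s ei) (ival s ej) (qval s e) = fA' ->
  run l (QSet 6 ei ej e) s (St i j (fA', fb, sc, fs)) 121.
Proof. by move=> ? ? ? ? ? ? <-; rewrite -set_cell6; apply: run_set_cell. Qed.

Let ok0 : iok l s idx0. Proof. exact: idx. Qed.

Lemma run7 ei e fb' : iok l s ei -> qok l s e ->
  (isteps ei <= 40)%N -> (qsteps e <= 40)%N ->
  upd1 fb (ival s ei) (qval s e) = fb' ->
  run l (QSet 7 ei idx0 e) s (St i j (fA, fb', sc, fs)) 121.
Proof.
move=> ? ? ? ? <-; rewrite -set_cell7.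
by apply: (@run_set_cell l l_gt0 7 ei idx0).
Qed.

Lemma run8 k e sc' : (k <= 16)%N -> qok l s e -> (qsteps e <= 40)%N ->
  set_nth 0 sc k (qval s e) = sc' ->
  run l (set_scal k e) s (St i j (fA, fb, sc', fs)) 121.
Proof.
move=> k16 ? ? <-; rewrite -set_cell8.
apply: (@run_set_cell l l_gt0 8 (IConst k) idx0) => //=.
by apply: idx; apply: leq_trans k16 _; rewrite leq_addl.
Qed.

Lemma run9 ei e fs' : iok l s ei -> qok l s e ->
  (isteps ei <= 40)%N -> (qsteps e <= 40)%N ->
  upd1 fs (ival s ei) (qval s e) = fs' ->
  run l (QSet 9 ei idx0 e) s (St i j (fA, fb, sc, fs')) 121.
Proof.
move=> ? ? ? ? <-; rewrite -set_cell9.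
by apply: (@run_set_cell l l_gt0 9 ei idx0).
Qed.

End Assignments.

Definition dprodA i : rat := \prod_(0 <= i' < i) \prod_(0 <= j' < d) den_cells A i' j'.
Definition dprodAj i j : rat := dprodA i * \prod_(0 <= j' < j) den_cells A i j'.
Definition dprodB i : rat := dprodA m * \prod_(0 <= i' < i) den_cells b i' 0.
Definition dprodX j : rat := dprodB m * \prod_(0 <= j' < j) den_cells x j' 0.
Definition denominator : rat := dprodX d.

Lemma dprodA_rec i : dprodA i.+1 = dprodAj i d.
Proof. by rewrite /dprodA big_nat_recr. Qed.
Lemma dprodAj_rec i j : dprodAj i j.+1 = dprodAj i j * den_cells A i j.
Proof. by rewrite /dprodAj big_nat_recr //= mulrA. Qed.
Lemma dprodB_rec i : dprodB i.+1 = dprodB i * den_cells b i 0.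
Proof. by rewrite /dprodB big_nat_recr //= mulrA. Qed.
Lemma dprodX_rec i : dprodX i.+1 = dprodX i * den_cells x i 0.
Proof. by rewrite /dprodX big_nat_recr //= mulrA. Qed.

(* After scaling by the square of the common denominator, not only [A] and [b]
   but also the slacks [b - A x] are integral. *)
Definition scaled (h : rat) := h * (denominator * denominator).
Definition A_scaled i j : rat := scaled (num_cells A i j / den_cells A i j).
Definition b_scaled i : rat := scaled (num_cells b i 0 / den_cells b i 0).
Definition x_entry j : rat := num_cells x j 0 / den_cells x j 0.
Definition slack_partial i j : rat := b_scaled i - \sum_(0 <= j' < j) A_scaled i j' * x_entry j'.
Definition slack_entry i : rat := slack_partial i d.
(** For integers, sums of squares dominate sums of absolute values, and they need no sign tests. *)
Definition normA i : rat := 1 + \sum_(0 <= i' < i) \sum_(0 <= j' < d) A_scaled i' j' * A_scaled i' j'.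
Definition normA_partial i j : rat := normA i + \sum_(0 <= j' < j) A_scaled i j' * A_scaled i j'.
Definition normB i : rat := normA m + \sum_(0 <= i' < i) b_scaled i' * b_scaled i'.
Definition norm_total : rat := normB m.
Definition far_value : rat := norm_total ^+ d.+1.
Definition ratio_value : rat :=
  1 / (16%:R * d.+1%:R * (far_value * far_value * far_value)).
Definition tiny_value : rat := ratio_value ^+ m.+1.
Definition row_partial i y : rat :=
  - \sum_(0 <= i' < i) (if slack_entry i' <= 0 then A_scaled i' y else 0).
Definition corner_partial i : rat := far_value + 1 +
  \sum_(0 <= i' < i) (if slack_entry i' <= 0 then b_scaled i' - tiny_value else 0).
Definition coef_entry i : rat :=
  if slack_entry i <= 0 then tiny_value else slack_entry i - ratio_value ^+ i.+1.

Lemma num_cells_out1 p q (B : 'M[rat]_(p, q)) i j : (p <= i)%N -> num_cells B i j = 0.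
Proof. by move=> h; rewrite /num_cells insubF // ltnNge h. Qed.

Lemma num_cells_out2 p q (B : 'M[rat]_(p, q)) i j : (q <= j)%N -> num_cells B i j = 0.
Proof. by move=> h; rewrite /num_cells; case: insub => // ?; rewrite insubF // ltnNge h. Qed.

Lemma A_scaled_out1 i j : (m <= i)%N -> A_scaled i j = 0.
Proof. by move=> h; rewrite /A_scaled num_cells_out1 // /scaled !mul0r. Qed.

Lemma A_scaled_out2 i j : (d <= j)%N -> A_scaled i j = 0.
Proof. by move=> h; rewrite /A_scaled num_cells_out2 // /scaled !mul0r. Qed.

Lemma b_scaled_out i : (m <= i)%N -> b_scaled i = 0.
Proof. by move=> h; rewrite /b_scaled num_cells_out1 // /scaled !mul0r. Qed.

Lemma slack_partial_rec i j : slack_partial i j.+1 = slack_partial i j - A_scaled i j * x_entry j.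
Proof. by rewrite /slack_partial big_nat_recr //= opprD addrA. Qed.
Lemma normA_rec i : normA i.+1 = normA_partial i d.
Proof. by rewrite /normA big_nat_recr //= addrA. Qed.
Lemma normA_partial_rec i j : normA_partial i j.+1 = normA_partial i j + A_scaled i j * A_scaled i j.
Proof. by rewrite /normA_partial big_nat_recr //= addrA. Qed.
Lemma normB_rec i : normB i.+1 = normB i + b_scaled i * b_scaled i.
Proof. by rewrite /normB big_nat_recr //= addrA. Qed.
Lemma row_partial_rec i y : row_partial i.+1 y = row_partial i y - (if slack_entry i <= 0 then A_scaled i y else 0).
Proof. by rewrite /row_partial big_nat_recr //= opprD. Qed.
Lemma row_partial_out i y : (d <= y)%N -> row_partial i y = 0.
Proof.
move=> h; rewrite /row_partial big1 ?oppr0 // => k _; case: ifP => // _; exact: A_scaled_out2.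
Qed.
Lemma corner_partial_rec i : corner_partial i.+1 =
  corner_partial i + (if slack_entry i <= 0 then b_scaled i - tiny_value else 0).
Proof. by rewrite /corner_partial big_nat_recr //= addrA. Qed.

Hypothesis l_nA : forall i j, szb (num_cells A i j) l.
Hypothesis l_dA : forall i j, szb (den_cells A i j) l.
Hypothesis l_nb : forall i j, szb (num_cells b i j) l.
Hypothesis l_db : forall i j, szb (den_cells b i j) l.
Hypothesis l_nx : forall i j, szb (num_cells x i j) l.
Hypothesis l_dx : forall i j, szb (den_cells x i j) l.
Hypothesis l_dprodAj : forall i j, (i <= m)%N -> (j <= d)%N -> szb (dprodAj i j) l.
Hypothesis l_dprodB : forall i, (i <= m)%N -> szb (dprodB i) l.
Hypothesis l_dprodX : forall i, (i <= d)%N -> szb (dprodX i) l.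

Hypothesis l_A_scaled : forall i j, szb (A_scaled i j) l.
Hypothesis l_b_scaled : forall i, szb (b_scaled i) l.
Hypothesis l_slack_partial : forall i j, (j <= d)%N -> szb (slack_partial i j) l.
Hypothesis l_normA_partial : forall i j, (i <= m)%N -> (j <= d)%N -> szb (normA_partial i j) l.
Hypothesis l_normB : forall i, (i <= m)%N -> szb (normB i) l.
Hypothesis l_GX : forall k, (k <= d.+1)%N -> szb (norm_total ^+ k) l.
Hypothesis l_ratioX : forall k, (k <= m.+1)%N -> szb (ratio_value ^+ k) l.
Hypothesis l_row_partial : forall i y, (i <= m)%N -> szb (row_partial i y) l.
Hypothesis l_corner_partial : forall i, (i <= m)%N -> szb (corner_partial i) l.

Ltac bits := by apply: idx; lia.
Ltac conjs :=
  repeat match goal with |- _ /\ _ => split | |- and3 _ _ _ => split end.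
Ltac leaf := rewrite /=; conjs; rewrite /= /col0 /= ?szb1 ?szb0 //;
  try (by apply: idx; lia); auto.

Lemma mrun_scal fA fb sc fs k e sc' : (k <= 16)%N ->
  (forall i j, qok l (St i j (fA, fb, sc, fs)) e /\
    set_nth 0 sc k (qval (St i j (fA, fb, sc, fs)) e) = sc') ->
  (qsteps e <= 40)%N ->
  mrun (set_scal k e) (fA, fb, sc, fs) (fA, fb, sc', fs) 121.
Proof. by move=> ? h ? i j; have [? ?] := h i j; exists i, j; apply: run8. Qed.

Lemma run_prog_den fA fb fs :
  mrun prog_den (fA, fb, [::], fs) (fA, fb, [:: denominator], fs)
   (121 + (loop_cost m (loop_cost d 121) + (loop_cost m 121 + loop_cost d 121))).
Proof.
pose P (h : nat -> rat) (k : nat) : mem := (fA, fb, [:: h k], fs).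
have b0 : (bitlen 0 <= l)%N by exact: idx.
apply: (mrun_seq (M' := P dprodA 0%N)).
  apply: mrun_scal => // i j; split; first exact: szb1.
  by rewrite /dprodA big_nil.
apply: (mrun_seq (M' := P dprodA m)).
  apply: for2; first exact: loop_bound_m.
  move=> k j km; exists d; rewrite {2}/P dprodA_rec.
  have -> : P dprodA k = P (dprodAj k) 0%N by rewrite /P /dprodAj big_nil mulr1.
  apply: for3; first exact: loop_bound_d.
  move=> j' jd; apply: run8 => //; last by rewrite dprodAj_rec.
  do !split=> //=; [exact: l_dprodAj (ltnW km) (ltnW jd)|bits|bits].
have -> : P dprodA m = P dprodB 0%N by rewrite /P /dprodB big_nil mulr1.
apply: (mrun_seq (M' := P dprodB m)).
  apply: for2; first exact: loop_bound_m.
  move=> k j km; exists j; apply: run8 => //; last by rewrite dprodB_rec.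
  do !split=> //=; [exact: l_dprodB (ltnW km)|bits].
have -> : P dprodB m = P dprodX 0%N by rewrite /P /dprodX big_nil mulr1.
apply: for2; first exact: loop_bound_d.
move=> k j km; exists j; apply: run8 => //; last by rewrite dprodX_rec.
do !split=> //=; [exact: l_dprodX (ltnW km)|bits].
Qed.

(** Array 6 when rows below [k] and the first [j] entries of row [k] have been written. *)
Definition partA k j : nat -> nat -> rat := fun y z =>
  if (y < k)%N || (y == k) && (z < j)%N then A_scaled y z else 0.

Lemma partA_done : partA m 0 = A_scaled.
Proof.
apply/funext => y; apply/funext => z; rewrite /partA ltn0 andbF orbF.
by case: ltnP => // h; rewrite A_scaled_out1.
Qed.

Lemma partA_row k : partA k d = partA k.+1 0.
Proof.
apply/funext => y; apply/funext => z; rewrite /partA ltn0 andbF orbF [in RHS]ltnS [in RHS]leq_eqVlt.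
case: (ltngtP y k) => //= _; by case: ltnP => // h; rewrite A_scaled_out2.
Qed.

Lemma partA_upd k j : upd2 (partA k j) k j (A_scaled k j) = partA k j.+1.
Proof.
apply/funext => y; apply/funext => z; rewrite /upd2 /partA.
case: (ltngtP y k) => //= ->; rewrite [in RHS]ltnS [in RHS]leq_eqVlt.
by case: eqP => //= ->.
Qed.

Definition part1 (h : nat -> rat) k : nat -> rat := fun y => if (y < k)%N then h y else 0.

Lemma part1_upd h k : upd1 (part1 h k) k (h k) = part1 h k.+1.
Proof.
apply/funext => y; rewrite /upd1 /part1 [in RHS]ltnS [in RHS]leq_eqVlt.
by case: eqP => //= ->.
Qed.

Lemma part1_done h : (forall y, (m <= y)%N -> h y = 0) -> part1 h m = h.
Proof. by move=> hh; apply/funext => y; rewrite /part1; case: ltnP => // /hh. Qed.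

Lemma upd1_upd1 f k u v : upd1 (upd1 f k u) k v = upd1 f k v.
Proof. by apply/funext => y; rewrite /upd1; case: eqP. Qed.

Lemma run_prog_scale :
  mrun prog_scale (fun _ _ => 0, fun=> 0, [:: denominator], fun=> 0)
    (A_scaled, b_scaled, [:: denominator], part1 slack_entry m)
   (loop_cost m (loop_cost d 121) +
    (loop_cost m 121 + loop_cost m (121 + loop_cost d 121))).
Proof.
have lD : szb denominator l by exact: l_dprodX.
have z0 : (fun _ _ => 0) = partA 0 0.
  by apply/funext => y; apply/funext => z; rewrite /partA !ltn0 andbF.
have z1 h : (fun=> 0) = part1 h 0 by [].
pose P k : mem := (partA k 0, fun=> 0, [:: denominator], fun=> 0).
apply: (mrun_seq (M' := P m)).
  rewrite z0 -/(P 0%N); apply: for2; first exact: loop_bound_m.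
  move=> k j km; exists d; rewrite /P -partA_row.
  apply: (@for3 _ _ _ k j (fun j => (partA k j, _, _, _))); first exact: loop_bound_d.
  move=> j' jd; apply: run6 => //; last exact: partA_upd.
  - by rewrite /=; bits.
  - by rewrite /=; bits.
  - by leaf.
rewrite /P partA_done.
pose P1 k : mem := (A_scaled, part1 b_scaled k, [:: denominator], fun=> 0).
apply: (mrun_seq (M' := P1 m)).
  rewrite {1}(z1 b_scaled) -/(P1 0%N); apply: for2; first exact: loop_bound_m.
  move=> k j km; exists j; apply: run7 => //; last exact: part1_upd.
  - by rewrite /=; bits.
  - by leaf.
rewrite /P1 (part1_done b_scaled_out).
pose P2 k : mem := (A_scaled, b_scaled, [:: denominator], part1 slack_entry k).
rewrite (z1 slack_entry) -/(P2 0%N) -/(P2 m); apply: for2; first exact: loop_bound_m.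
move=> k j km; exists d.
apply: (run_seq (s' := St k j (A_scaled, b_scaled, [:: denominator],
          upd1 (part1 slack_entry k) k (slack_partial k 0)))).
  apply: run9 => //; first by rewrite /=; bits.
    by leaf.
  by rewrite /= /col0 /= /slack_partial big_nil subr0.
rewrite /P2 -(part1_upd slack_entry k).
apply: (@for3 _ _ _ k j (fun j => (_, _, _, upd1 (part1 slack_entry k) k (slack_partial k j)))).
  exact: loop_bound_d.
move=> j' jd; apply: run9 => //; first by rewrite /=; bits.
- do !split=> //=; try bits.
  by rewrite /col0 /= /upd1 eqxx; apply: l_slack_partial (ltnW jd).
- by rewrite /= upd1_upd1 /col0 /upd1 !eqxx /= slack_partial_rec.
Qed.

Lemma run_prog_bound fs :
  mrun prog_bound (A_scaled, b_scaled, [:: denominator], fs)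
    (A_scaled, b_scaled, [:: denominator; norm_total; far_value], fs)
   (121 + (loop_cost m (loop_cost d 121) + (loop_cost m 121 +
     (121 + loop_cost d.+1 121)))).
Proof.
pose P (h : nat -> rat) k : mem := (A_scaled, b_scaled, [:: denominator; h k], fs).
apply: (mrun_seq (M' := P normA 0%N)).
  apply: mrun_scal => // i j; split; first exact: szb1.
  by rewrite /normA big_nil addr0.
apply: (mrun_seq (M' := P normA m)).
  apply: for2; first exact: loop_bound_m.
  move=> k j km; exists d; rewrite {2}/P normA_rec.
  have -> : P normA k = P (normA_partial k) 0%N by rewrite /P /normA_partial big_nil addr0.
  apply: for3; first exact: loop_bound_d.
  move=> j' jd; apply: run8 => //; last by rewrite normA_partial_rec.
  by have ? := l_normA_partial (ltnW km) (ltnW jd); leaf.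
have -> : P normA m = P normB 0%N by rewrite /P /normB big_nil addr0.
apply: (mrun_seq (M' := P normB m)).
  apply: for2; first exact: loop_bound_m.
  move=> k j km; exists j; apply: run8 => //; last by rewrite normB_rec.
  by have ? := l_normB (ltnW km); leaf.
pose P2 k : mem := (A_scaled, b_scaled, [:: denominator; norm_total; norm_total ^+ k], fs).
apply: (mrun_seq (M' := P2 0%N)).
  by apply: mrun_scal => // i j; split; first exact: szb1.
apply: for2; first exact: loop_bound_d1.
move=> k j km; exists j; apply: run8 => //; last by rewrite /= exprSr.
by have ? := l_GX (ltnW km); have ? := l_normB (leqnn m); leaf.
Qed.

Lemma run_prog_ratio fs :
  mrun prog_ratio (A_scaled, b_scaled, [:: denominator; norm_total; far_value], fs)
    (A_scaled, b_scaled, [:: denominator; norm_total; far_value; ratio_value; tiny_value], fs)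
   (121 + (121 + loop_cost m.+1 121)).
Proof.
have lf : szb far_value l by exact: l_GX.
apply: mrun_seq (_ : mrun _ _
    (A_scaled, b_scaled, [:: denominator; norm_total; far_value; ratio_value], fs) _) _.
  apply: mrun_scal => // i j; split; last by rewrite /= addn1.
  by leaf.
pose P2 k : mem := (A_scaled, b_scaled, [:: denominator; norm_total; far_value; ratio_value; ratio_value ^+ k], fs).
apply: (mrun_seq (M' := P2 0%N)).
  by apply: mrun_scal => // i j; split; first exact: szb1.
apply: for2; first exact: loop_bound_m1.
move=> k j km; exists j; apply: run8 => //; last by rewrite /= exprSr.
by have ? := l_ratioX (ltnW km); have lr := l_ratioX (ltn0Sn m); rewrite expr1 in lr; leaf.
Qed.

Definition withrow (h : nat -> rat) : nat -> nat -> rat :=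
  fun y z => if y == m then h z else A_scaled y z.

Lemma withrow_upd h j v : upd2 (withrow h) m j v = withrow (upd1 h j v).
Proof.
apply/funext => y; apply/funext => z; rewrite /upd2 /withrow /upd1.
by case: eqP => //= _; case: eqP.
Qed.

Lemma withrow0 : A_scaled = withrow (row_partial 0).
Proof.
apply/funext => y; apply/funext => z; rewrite /withrow /row_partial big_nil oppr0.
by case: eqP => // ->; rewrite A_scaled_out1.
Qed.

Lemma run_prog_row sc : mrun prog_row (A_scaled, b_scaled, sc, part1 slack_entry m)
  (withrow (row_partial m), b_scaled, sc, part1 slack_entry m) (loop_cost m (loop_cost d 121 + 41)).
Proof.
rewrite {1}withrow0; pose P k : mem := (withrow (row_partial k), b_scaled, sc, part1 slack_entry m).
rewrite -/(P 0%N) -/(P m); apply: for2; first exact: loop_bound_m.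
move=> k j km; exists (if slack_entry k <= 0 then d else j); rewrite /P.
apply: run_if => //.
  by have ? := l_slack_partial k (leqnn d); leaf; rewrite /part1 km.
rewrite /= /col0 /= /part1 km; case: ifP => sk; last first.
  have -> : row_partial k.+1 = row_partial k.
    by apply/funext => y; rewrite row_partial_rec sk subr0.
  exists 1%N, 1%N; split; [exact: exec_Skip|by []|].
  by rewrite mul1n unit_cost_gt0.
(* During the inner loop, the entries before [j] of row [m] are already updated and the others are
   not. *)
pose h j y := if (y < j)%N then row_partial k.+1 y else row_partial k y.
have -> : row_partial k.+1 = h d.
  by apply/funext => y; rewrite /h; case: ltnP => // yd; rewrite !row_partial_out.
apply: (@for3 _ _ _ k j (fun j => (withrow (h j), b_scaled, sc, part1 slack_entry m))).
  exact: loop_bound_d.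
have mk : (k == m) = false by rewrite ltn_eqF.
have hj j' : h j' j' = row_partial k j' by rewrite /h ltnn.
move=> j' jd; apply: run6 => //.
- by leaf.
- by leaf.
- have ? := l_row_partial j' (ltnW km); leaf; last by rewrite /withrow mk.
  by rewrite /withrow eqxx hj.
rewrite /= /withrow eqxx mk hj -/(withrow _) withrow_upd; congr withrow.
apply/funext => y; rewrite /upd1 /h [in RHS]ltnS [in RHS]leq_eqVlt.
by case: eqP => //= ->; rewrite row_partial_rec sk.
Qed.

(** Array 6 while column [d] is filled: [row] is the redundant normal, [co] and [cn] are the rock
    coefficients of the given rows and of the redundant one, and [z] belongs to the inequality on
    the height. *)
Definition outA (row co : nat -> rat) (cn z : rat) : nat -> nat -> rat :=
  fun y w => if w == d then (if y == m then cn else if y == m.+1 then z else co y)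
             else withrow row y w.

Definition finalA : nat -> nat -> rat := outA (row_partial m) (part1 coef_entry m) (corner_partial m) (-1).
Definition finalb : nat -> rat := upd1 b_scaled m (far_value + 1).

Lemma outA_start cn : upd2 (withrow (row_partial m)) m d cn =
  outA (row_partial m) (part1 coef_entry 0) cn 0.
Proof.
apply/funext => y; apply/funext => w; rewrite /upd2 /outA /withrow.
case: (eqVneq w d) => [->|]; last by rewrite andbF.
rewrite andbT; case: eqP => // _.
by rewrite A_scaled_out2 // /part1; case: ifP.
Qed.

Lemma outA_corner row co cn z v : upd2 (outA row co cn z) m d v = outA row co v z.
Proof.
apply/funext => y; apply/funext => w; rewrite /upd2 /outA.
by case: (w == d); rewrite ?andbF // andbT; case: eqP.
Qed.

Lemma outA_coef row co cn z k v : (k < m)%N ->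
  upd2 (outA row co cn z) k d v = outA row (upd1 co k v) cn z.
Proof.
move=> km; apply/funext => y; apply/funext => w; rewrite /upd2 /outA /upd1.
case: (w == d); rewrite ?andbF // andbT; case: eqP => // ->.
by rewrite !ltn_eqF // ltnW.
Qed.

Lemma outA_last row co cn z v : upd2 (outA row co cn z) m.+1 d v = outA row co cn v.
Proof.
apply/funext => y; apply/funext => w; rewrite /upd2 /outA.
case: (w == d); rewrite ?andbF // andbT; case: eqP => // ->.
by rewrite gtn_eqF.
Qed.

Lemma run_prog_coef fs : fs = part1 slack_entry m ->
  mrun prog_coef
    (withrow (row_partial m), b_scaled, [:: denominator; norm_total; far_value; ratio_value; tiny_value], fs)
    (finalA, finalb, [:: denominator; norm_total; far_value; ratio_value; tiny_value; ratio_value ^+ m], fs)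
    (121 + (121 + (121 + (loop_cost m (121 + (242 + 41)) + 121)))).
Proof.
move=> fsE; set sc := [:: _; _; _; _; _].
have lf : szb far_value l by exact: l_GX.
have lt : szb tiny_value l by exact: l_ratioX.
have lr : szb ratio_value l by have := l_ratioX (ltn0Sn m); rewrite expr1.
apply: mrun_seq (_ : mrun _ _ (withrow (row_partial m), finalb, sc, fs) _) _.
  move=> i j; exists i, j; apply: run7 => //; by leaf.
pose P k : mem := (outA (row_partial m) (part1 coef_entry k) (corner_partial k) 0, finalb,
                   rcons sc (ratio_value ^+ k), fs).
apply: mrun_seq (_ : mrun _ _ (outA (row_partial m) (part1 coef_entry 0) (corner_partial 0) 0,
    finalb, sc, fs) _) _.
  move=> i j; exists i, j; apply: run6 => //; try by leaf.
  by rewrite /= outA_start /corner_partial big_nil addr0.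
apply: (mrun_seq (M' := P 0%N)).
  by apply: mrun_scal => // i j; split; first exact: szb1.
apply: (mrun_seq (M' := P m)).
  apply: for2; first exact: loop_bound_m.
  move=> k j km; exists j.
  have mk : (k == m) = false by rewrite ltn_eqF.
  have fsk : fs k = slack_entry k by rewrite fsE /part1 km.
  have fbk : finalb k = b_scaled k by rewrite /finalb /upd1 mk.
  have lk := l_ratioX (leqW (ltnW km)); have lk1 := l_ratioX (leqW km).
  have ls : szb (slack_entry k) l by exact: l_slack_partial.
  apply: (run_seq (s' := St k j (outA (row_partial m) (part1 coef_entry k) (corner_partial k) 0,
      finalb, rcons sc (ratio_value ^+ k.+1), fs))).
    by apply: run8 => //; [leaf|rewrite /= exprSr].
  apply: run_if => //; first by leaf; rewrite fsk.
  rewrite /= /col0 /= fsk; case: ifP => sk.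
    have ck : upd1 (part1 coef_entry k) k tiny_value = part1 coef_entry k.+1.
      by rewrite -part1_upd /coef_entry sk.
    have lc := l_corner_partial (ltnW km).
    apply: (run_seq (T1 := 121) (s' := St k j (outA (row_partial m) (part1 coef_entry k.+1)
       (corner_partial k) 0, finalb, rcons sc (ratio_value ^+ k.+1), fs))).
      apply: run6 => //; try by leaf.
      by rewrite /= outA_coef // ck.
    apply: run6 => //; try by leaf.
      by leaf; [rewrite /outA !eqxx|rewrite fbk].
    by rewrite /= /col0 /= fbk {2}/outA !eqxx outA_corner corner_partial_rec sk.
  apply: (run_le (T := 121)) => //; apply: run6 => //; try by leaf.
    by leaf; rewrite fsk.
  rewrite /= /col0 /= fsk outA_coef //.
  have -> : corner_partial k.+1 = corner_partial k by rewrite corner_partial_rec sk addr0.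
  by congr outA; rewrite -part1_upd /coef_entry sk.
move=> i j; exists i, j; apply: run6 => //; try by leaf.
by rewrite /= addn1 sub0r outA_last.
Qed.

Definition total_cost : nat :=
  ((121 + (loop_cost m (loop_cost d 121) + (loop_cost m 121 + loop_cost d 121))) +
  ((loop_cost m (loop_cost d 121) +
    (loop_cost m 121 + loop_cost m (121 + loop_cost d 121))) +
  ((121 + (loop_cost m (loop_cost d 121) + (loop_cost m 121 +
     (121 + loop_cost d.+1 121)))) +
  ((121 + (121 + loop_cost m.+1 121)) +
  (loop_cost m (loop_cost d 121 + 41) +
   (121 + (121 + (121 + (loop_cost m (121 + (242 + 41)) + 121))))))))).

Lemma run_program : exists s, run l program (input_state A b x) s total_cost /\
  (forall i j, cell s 6 i j = finalA i j) /\ (forall i, cell s 7 i 0 = finalb i).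
Proof.
rewrite input_St.
have h := mrun_seq (run_prog_den _ _ _) (mrun_seq run_prog_scale
  (mrun_seq (run_prog_bound _) (mrun_seq (run_prog_ratio _)
  (mrun_seq (run_prog_row _) (run_prog_coef erefl))))).
have [i [j hij]] := h 0%N 0%N.
by exists (St i j (finalA, finalb, [:: denominator; norm_total; far_value; ratio_value; tiny_value;
  ratio_value ^+ m], part1 slack_entry m)).
Qed.

End Program.

(** * Polynomial bounds on steps and lengths *)

Section PolynomialBounds.

Definition polyb (f : nat -> nat) := exists q : {poly nat},
  forall N, (f N <= q.[N])%N.
Definition polyb2 (f : nat -> nat -> nat) := exists p : {poly {poly nat}},
  forall m d, (f m d <= (p.[m%:P]).[d])%N.

Lemma polyb_const c : polyb (fun=> c).
Proof. by exists c%:P => N; rewrite hornerC. Qed.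

Lemma polyb_id : polyb id.
Proof. by exists 'X => N; rewrite hornerX. Qed.

Lemma polybD f g : polyb f -> polyb g -> polyb (fun N => f N + g N)%N.
Proof.
by move=> [p hp] [q hq]; exists (p + q) => N; rewrite hornerD; apply: leq_add.
Qed.

Lemma polybM f g : polyb f -> polyb g -> polyb (fun N => f N * g N)%N.
Proof.
by move=> [p hp] [q hq]; exists (p * q) => N; rewrite hornerM; apply: leq_mul.
Qed.

Lemma polybS f : polyb f -> polyb (fun N => (f N).+1).
Proof.
move=> hf; have [q hq] := polybD (polyb_const 1) hf.
by exists q => N; rewrite -add1n.
Qed.

Lemma polyb2_const c : polyb2 (fun _ _ => c).
Proof. by exists (c%:P)%:P => m d; rewrite !hornerC. Qed.

Lemma polyb2_fst : polyb2 (fun m _ => m).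
Proof. by exists 'X => m d; rewrite hornerX hornerC. Qed.

Lemma polyb2_snd : polyb2 (fun _ d => d).
Proof. by exists ('X)%:P => m d; rewrite hornerC hornerX. Qed.

Lemma polyb2D f g : polyb2 f -> polyb2 g -> polyb2 (fun m d => f m d + g m d)%N.
Proof.
by move=> [p hp] [q hq]; exists (p + q) => m d; rewrite !hornerD; apply: leq_add.
Qed.

Lemma polyb2M f g : polyb2 f -> polyb2 g -> polyb2 (fun m d => f m d * g m d)%N.
Proof.
by move=> [p hp] [q hq]; exists (p * q) => m d; rewrite !hornerM; apply: leq_mul.
Qed.

Lemma polyb2S f : polyb2 f -> polyb2 (fun m d => (f m d).+1).
Proof.
move=> hf; have [q hq] := polyb2D (polyb2_const 1) hf.
by exists q => m d; rewrite -add1n.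
Qed.

End PolynomialBounds.

(** The common denominator is the plain product of m d + m + d denominators, each of at most [N]
    bits; this is already polynomial, so no least common multiple is computed. *)
Definition len_den N := (N * (N * N) + N * N + N * N)%N.
Definition len_entry N := (N + N + (len_den N + len_den N))%N.
Definition len_slack N := (len_entry N + N * (len_entry N + (N + N) + 1) + 1)%N.
Definition len_bound N := (N * (N * (len_entry N + len_entry N + 1) + 1) +
  N * (len_entry N + len_entry N + 1) + 2)%N.
Definition len_far N := ((N + 1) * len_bound N)%N.
Definition len_ratio N := (4 + (N + 1) + (len_far N + len_far N + len_far N))%N.
Definition len_tiny N := ((N + 1) * len_ratio N)%N.
Definition len_corner N :=
  (len_far N + 1 + N * (len_entry N + len_tiny N + 1 + 1) + 1)%N.
Definition len_max N := (N + N + 17 + len_den N + len_entry N + len_slack N +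
  len_bound N + len_far N + len_tiny N + N * (len_entry N + 1) + len_corner N)%N.

Ltac poly := repeat lazymatch goal with
  | |- polyb (fun=> ?c) => exact: (polyb_const c)
  | |- polyb (fun N => N) => exact: polyb_id
  | |- polyb (fun N => S (@?f N)) => apply: (@polybS f)
  | |- polyb (fun N => addn (@?f N) (@?g N)) => apply: (@polybD f g)
  | |- polyb (fun N => muln (@?f N) (@?g N)) => apply: (@polybM f g)
  | |- polyb2 (fun _ _ => ?c) => exact: (polyb2_const c)
  | |- polyb2 (fun m d => m) => exact: polyb2_fst
  | |- polyb2 (fun m d => d) => exact: polyb2_snd
  | |- polyb2 (fun m d => S (@?f m d)) => apply: (@polyb2S f)
  | |- polyb2 (fun m d => addn (@?f m d) (@?g m d)) => apply: (@polyb2D f g)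
  | |- polyb2 (fun m d => muln (@?f m d) (@?g m d)) => apply: (@polyb2M f g)
  end.

Lemma polyb_len_max : polyb len_max.
Proof.
rewrite /len_max /len_corner /len_tiny /len_ratio /len_far /len_bound /len_slack
  /len_entry /len_den; poly.
Qed.

Lemma polyb2_total_cost : polyb2 total_cost.
Proof. rewrite /total_cost /loop_cost; poly. Qed.

Lemma total_cost_mono m d m' d' : (m <= m')%N -> (d <= d')%N ->
  (total_cost m d <= total_cost m' d')%N.
Proof.
move=> mm dd; rewrite /total_cost /loop_cost.
repeat lazymatch goal with
  | |- is_true (?c <= ?c)%N => exact: leqnn
  | |- is_true (S _ <= S _)%N => rewrite ltnS
  | |- is_true (_ + _ <= _ + _)%N => apply: leq_add
  | |- is_true (_ * _ <= _ * _)%N => apply: leq_mul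
  end; done.
Qed.

Lemma polyb_total_cost : polyb (fun N => total_cost N N).
Proof. rewrite /total_cost /loop_cost; poly. Qed.

Lemma polyb_unit_cost f : polyb f -> polyb (fun N => unit_cost (f N)).
Proof.
move=> hf; rewrite /unit_cost.
have h : polyb (fun N => 5 * (40 * f N))%N by do 2!apply: (polybM (polyb_const _)).
exact: polybM.
Qed.

(** * Lengths of the intermediate values of the program *)

Section Lengths.
Variables (m d : nat) (A : 'M[rat]_(m, d)) (b : 'cV[rat]_m) (x : 'cV[rat]_d).
Let N := input_length A b x.

Lemma entry_mxlen p q (B : 'M[rat]_(p, q)) i j : (ratlen (B i j) <= mxlen B)%N.
Proof.
by rewrite /mxlen (bigD1 i) //= (bigD1 j) //= -addnA leq_addr.
Qed.

Lemma col_mxlen p (B : 'cV[rat]_p) : (p <= mxlen B)%N.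
Proof.
rewrite /mxlen -[leqLHS]muln1 -[X in (X * _ <= _)%N]card_ord -sum_nat_const.
by apply: leq_sum => i _; rewrite big_ord1 /ratlen -addnA leq_addr.
Qed.

(** The entries of [b] are counted rather than those of [A], of which there are none if [d] is 0. *)
Lemma m_le : (m <= N)%N.
Proof. by have := col_mxlen b; rewrite /N /input_length; lia. Qed.

Lemma d_le : (d <= N)%N.
Proof. by have := col_mxlen x; rewrite /N /input_length; lia. Qed.

Lemma szb_num p q (B : 'M[rat]_(p, q)) i j : (mxlen B <= N)%N ->
  szb (num_cells B i j) N.
Proof.
move=> BN; rewrite /num_cells; case: insub => [i'|]; last exact: szb0.
case: insub => [j'|]; last exact: szb0.
have /andP [h _] := szb_ratlen (B i' j').
apply: (@szb_frac _ (numq (B i' j')) 1); rewrite ?mulr1 ?expn_gt0 //.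
by apply: leq_trans h _; rewrite leq_exp2l // (leq_trans (entry_mxlen _ _ _)).
Qed.

Lemma szb_den p q (B : 'M[rat]_(p, q)) i j : (mxlen B <= N)%N ->
  szb (den_cells B i j) N.
Proof.
move=> BN; rewrite /den_cells; case: insub => [i'|]; last exact: szb0.
case: insub => [j'|]; last exact: szb0.
have /andP [_ h] := szb_ratlen (B i' j').
apply: (@szb_frac _ (denq (B i' j')) 1); rewrite ?mulr1 ?expn_gt0 //.
by apply: leq_trans h _; rewrite leq_exp2l // (leq_trans (entry_mxlen _ _ _)).
Qed.

Let lenA_le : (mxlen A <= N)%N. Proof. by rewrite /N /input_length; lia. Qed.
Let lenb_le : (mxlen b <= N)%N. Proof. by rewrite /N /input_length; lia. Qed.
Let lenx_le : (mxlen x <= N)%N. Proof. by rewrite /N /input_length; lia. Qed.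

Lemma szb_dprodA i : szb (dprodA A i) (i * (d * N)).
Proof. by do 2 (apply: szb_prod => ? _); apply: szb_den. Qed.

Lemma szb_dprodAj i j : (i <= m)%N -> (j <= d)%N -> szb (dprodAj A i j) (len_den N).
Proof.
move=> im jd; have h := szb_prod (fun j' (_ : (j' < j)%N) => szb_den i j' lenA_le).
apply: szb_le (szbM (szb_dprodA i) h).
have mN := m_le; have dN := d_le.
apply: leq_trans (leq_addr _ _); rewrite leq_add // leq_mul //.
- exact: leq_trans mN.
- by rewrite leq_mul2r dN orbT.
- exact: leq_trans dN.
Qed.

Lemma szb_dprodB i : (i <= m)%N -> szb (dprodB A b i) (m * (d * N) + i * N).
Proof.
move=> im; apply: szbM; first exact: szb_dprodA.
by apply: szb_prod => i' _; apply: szb_den.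
Qed.

Lemma szb_dprodX j : (j <= d)%N -> szb (dprodX A b x j) (len_den N).
Proof.
move=> jd; have h := szb_prod (fun j' (_ : (j' < j)%N) => szb_den j' 0 lenx_le).
apply: szb_le (szbM (szb_dprodB (leqnn m)) h).
have mN := m_le; have dN := d_le.
by rewrite !leq_add // leq_mul // ?leq_mul // (leq_trans jd).
Qed.

Lemma szb_scaled h E : szb h E -> szb (scaled A b x h) (E + (len_den N + len_den N)).
Proof. by move=> hE; do 2?apply: szbM => //; apply: szb_dprodX. Qed.

Lemma szb_A_scaled i j : szb (A_scaled A b x i j) (len_entry N).
Proof. by apply: szb_scaled; apply: szbM; [exact: szb_num|apply/szbV/szb_den]. Qed.

Lemma szb_b_scaled i : szb (b_scaled A b x i) (len_entry N).
Proof. by apply: szb_scaled; apply: szbM; [exact: szb_num|apply/szbV/szb_den]. Qed.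

Lemma szb_x_entry j : szb (x_entry x j) (N + N).
Proof. by apply: szbM; [exact: szb_num|apply/szbV/szb_den]. Qed.

Lemma szb_slack_partial i j : (j <= d)%N -> szb (slack_partial A b x i j) (len_slack N).
Proof.
move=> jd; apply: (szb_le _ (szbB (szb_b_scaled i) (szb_sum
  (fun j' (_ : (j' < j)%N) => szbM (szb_A_scaled i j') (szb_x_entry j'))))).
by rewrite leq_add2r leq_add2l leq_mul2r (leq_trans jd d_le) orbT.
Qed.

Let sq := (len_entry N + len_entry N + 1)%N.

Lemma szb_normA i : szb (normA A b x i) (i * (d * sq + 1) + 1).
Proof.
apply: (szbD (E := 0) (szb1 _)); apply: szb_sum => i' _; apply: szb_sum => j' _.
by apply: szbM; exact: szb_A_scaled.
Qed.

Lemma len_bound_ge i d' j : (i <= N)%N -> (d' <= N)%N -> (j <= N)%N ->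
  (i * (d' * sq + 1) + 1 + j * sq + 1 <= len_bound N)%N.
Proof.
move=> iN dN jN; rewrite /len_bound -/sq.
have h1 : (i * (d' * sq + 1) <= N * (N * sq + 1))%N.
  by rewrite leq_mul // leq_add2r leq_mul2r dN orbT.
have h2 : (j * sq <= N * sq)%N by rewrite leq_mul2r jN orbT.
by move: (_ * (_ + 1))%N (_ * (_ + 1))%N (_ * _)%N (_ * _)%N h1 h2; lia.
Qed.

Lemma szb_normA_partial i j : (i <= m)%N -> (j <= d)%N -> szb (normA_partial A b x i j) (len_bound N).
Proof.
move=> im jd; have h := szb_sum
  (fun j' (_ : (j' < j)%N) => szbM (szb_A_scaled i j') (szb_A_scaled i j')).
apply: (szb_le _ (szbD (szb_normA i) h)); have mN := m_le; have dN := d_le.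
exact: len_bound_ge (leq_trans im mN) dN (leq_trans jd dN).
Qed.

Lemma szb_normB i : (i <= m)%N -> szb (normB A b x i) (len_bound N).
Proof.
move=> im; have h := szb_sum
  (fun j' (_ : (j' < i)%N) => szbM (szb_b_scaled j') (szb_b_scaled j')).
apply: (szb_le _ (szbD (szb_normA m) h)); have mN := m_le; have dN := d_le.
exact: len_bound_ge mN dN (leq_trans im mN).
Qed.

Lemma szb_GX k : (k <= d.+1)%N -> szb (norm_total A b x ^+ k) (len_far N).
Proof.
move=> kd; apply: (szb_le _ (szbX k (szb_normB (leqnn m)))).
by rewrite leq_mul2r addn1 (leq_trans kd) ?orbT // ltnS d_le.
Qed.

Lemma szb_ratio : szb (ratio_value A b x) (len_ratio N).
Proof.
have hd : (d.+1 <= 2 ^ (N + 1))%N.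
  rewrite addn1; apply: leq_trans (ltn_expl N.+1 (ltnSn 1)); rewrite ltnS.
  exact: leqW d_le.
have hf : szb (far_value A b x) (len_far N) := szb_GX (leqnn d.+1).
rewrite /ratio_value div1r /len_ratio; apply: szbV.
apply: szbM; last exact: szbM (szbM hf hf) hf.
exact: szbM (szb_nat (n := 16) (E := 4) isT) (szb_nat hd).
Qed.

Lemma szb_ratioX k : (k <= m.+1)%N -> szb (ratio_value A b x ^+ k) (len_tiny N).
Proof.
move=> km; apply: (szb_le _ (szbX k szb_ratio)).
by rewrite leq_mul2r addn1 (leq_trans km) ?orbT // ltnS m_le.
Qed.

Lemma szb_row_partial i y : (i <= m)%N -> szb (row_partial A b x i y) (N * (len_entry N + 1)).
Proof.
move=> im; rewrite szbN; apply: (szb_le _ (szb_sum (E := len_entry N) _)).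
  by rewrite leq_mul2r (leq_trans im m_le) orbT.
by move=> i' _; case: ifP => _; [exact: szb_A_scaled|exact: szb0].
Qed.

Lemma szb_corner_partial i : (i <= m)%N -> szb (corner_partial A b x i) (len_corner N).
Proof.
move=> im; have h1 := szbD (szb_GX (leqnn d.+1)) (szb1 0).
have h2 : szb (\sum_(0 <= i' < i)
    (if slack_entry A b x i' <= 0 then b_scaled A b x i' - tiny_value A b x else 0))
    (i * (len_entry N + len_tiny N + 1 + 1)).
  apply: szb_sum => i' _; case: ifP => _; last exact: szb0.
  by apply: szbB; [exact: szb_b_scaled|exact: szb_ratioX].
apply: (szb_le _ (szbD h1 h2)); rewrite addn0.
by rewrite leq_add2r leq_add2l leq_mul2r (leq_trans im m_le) orbT.
Qed.

Lemma run_program_bound : exists s, [/\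
  run (len_max N) program (input_state A b x) s (total_cost m d),
  forall i j, cell s 6 i j = finalA A b x i j &
  forall i, cell s 7 i 0 = finalb A b x i].
Proof.
have mN := m_le; have dN := d_le.
have [|||||||||||||||||||s [h1 [h2 h3]]] := @run_program m d A b x (len_max N).
- move=> k hk; apply: leq_trans (bitlen_leS k) _; rewrite /len_max; lia.
- by move=> i j; apply: (szb_le _ (szb_num i j lenA_le)); rewrite /len_max; lia.
- by move=> i j; apply: (szb_le _ (szb_den i j lenA_le)); rewrite /len_max; lia.
- by move=> i j; apply: (szb_le _ (szb_num i j lenb_le)); rewrite /len_max; lia.
- by move=> i j; apply: (szb_le _ (szb_den i j lenb_le)); rewrite /len_max; lia.
- by move=> i j; apply: (szb_le _ (szb_num i j lenx_le)); rewrite /len_max; lia.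
- by move=> i j; apply: (szb_le _ (szb_den i j lenx_le)); rewrite /len_max; lia.
- by move=> i j im jd; apply: (szb_le _ (szb_dprodAj im jd)); rewrite /len_max; lia.
- move=> i im; have := szb_dprodB im; apply: szb_le.
  by rewrite /len_max /len_den; apply: leq_trans (_ : N * (N * N) + N * N <= _)%N;
    [rewrite leq_add // ?leq_mul // (leq_trans im)|lia].
- by move=> j jd; apply: (szb_le _ (szb_dprodX jd)); rewrite /len_max; lia.
- by move=> i j; apply: (szb_le _ (szb_A_scaled i j)); rewrite /len_max; lia.
- by move=> i; apply: (szb_le _ (szb_b_scaled i)); rewrite /len_max; lia.
- by move=> i j jd; apply: (szb_le _ (szb_slack_partial i jd)); rewrite /len_max; lia.
- by move=> i j im jd; apply: (szb_le _ (szb_normA_partial im jd)); rewrite /len_max; lia.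
- by move=> i im; apply: (szb_le _ (szb_normB im)); rewrite /len_max; lia.
- by move=> k kd; apply: (szb_le _ (szb_GX kd)); rewrite /len_max; lia.
- by move=> k km; apply: (szb_le _ (szb_ratioX km)); rewrite /len_max; lia.
- by move=> i y im; apply: (szb_le _ (szb_row_partial y im)); rewrite /len_max; lia.
- by move=> i im; apply: (szb_le _ (szb_corner_partial im)); rewrite /len_max; lia.
by exists s.
Qed.

End Lengths.

(** * From the program to the theorem *)

Section Scaling.
Variable R : realType.

Lemma polyhedron_scale m n (A : 'M[R]_(m, n)) (b : 'cV[R]_m) c : 0 < c ->
  polyhedron (c *: A) (c *: b) = polyhedron A b.
Proof.
move=> c0; apply/seteqP; split=> x hx i; have := hx i;
  by rewrite -scalemxAl [(c *: (A *m x)) i 0]mxE [(c *: b) i 0]mxE ler_pM2l.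
Qed.

Lemma non_degenerate_scale m n (A : 'M[R]_(m, n)) (b : 'cV[R]_m) c : 0 < c ->
  non_degenerate A b -> non_degenerate (c *: A) (c *: b).
Proof.
move=> c0 [h1 [x hx] h3]; have cn : c != 0 by rewrite gt_eqF.
have hyp x' i : ((c *: A *m x') i 0 = (c *: b) i 0) <-> (A *m x') i 0 = b i 0.
  rewrite -scalemxAl [(c *: (A *m x')) i 0]mxE [(c *: b) i 0]mxE.
  by split=> [/(mulfI cn)|->].
split.
- by move=> i; rewrite linearZ /= scaler_eq0 (negPf cn) /=.
- by exists x; rewrite polyhedron_scale.
move=> v [I hI]; apply: etrans (h3 v _).
  by apply: eq_card => i; apply/eqP/eqP => /hyp.
exists I; rewrite -hI; apply/seteqP; split=> y hy i /hy /=;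
  by rewrite /hyperplane /= => /hyp.
Qed.

Lemma rock_mx_polyhedron m d (A : 'M[R]_(m, d)) (a b : 'cV[R]_m) :
  polyhedron (rock_mx A a) (rock_rhs b) = rock_polyhedron A a b.
Proof.
have e1 y i : (rock_mx A a *m y) (lshift 1 i) 0 =
    (A *m usubmx y) i 0 + a i 0 * dsubmx y 0 0.
  rewrite /rock_mx -{1}[y]vsubmxK mul_block_col col_mxEu [LHS]mxE.
  by rewrite [X in _ + X]mxE big_ord1.
have e2 y : (rock_mx A a *m y) (rshift m 0) 0 = - dsubmx y 0 0.
  by rewrite /rock_mx -{1}[y]vsubmxK mul_block_col col_mxEd mul0mx add0r
    mulNmx mul1mx mxE.
have e3 i : rock_rhs b (lshift 1 i) 0 = b i 0 by rewrite col_mxEu.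
have e4 : rock_rhs b (rshift m 0) 0 = 0 by rewrite col_mxEd mxE.
apply/seteqP; split=> y hy.
  split=> [i|]; first by rewrite -e1 -e3.
  by have := hy (rshift m 0); rewrite e2 e4 oppr_le0.
move=> i; case: (ext_cases i) => [[j ->]|->]; case: hy => h1 h2.
  by rewrite e1 e3.
by rewrite e2 e4 oppr_le0.
Qed.

Lemma ratr_int_num (x : rat) : x \is a Num.int -> (ratr x : R) \is a Num.int.
Proof. by move=> /intrP [z ->]; rewrite ratr_int. Qed.

Lemma int_norm_le_sqr (x : R) : x \is a Num.int -> `|x| <= x * x.
Proof.
move=> xi; have [->|x0] := eqVneq x 0; first by rewrite normr0 mul0r.
rewrite -expr2 -real_normK ?num_real // expr2 ler_peMr //.
exact: norm_intr_ge1.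
Qed.

End Scaling.

(** * The computed data as the data of the rock extension *)

Section Correctness.
Variables (R : realType) (m d : nat).
Variables (A : 'M[rat]_(m, d)) (b : 'cV[rat]_m) (x : 'cV[rat]_d).

Let D := denominator A b x.

Lemma den_cells_ord p q (B : 'M[rat]_(p, q)) (i : 'I_p) (j : 'I_q) :
  den_cells B i j = (denq (B i j))%:~R.
Proof. by rewrite /den_cells !valK. Qed.

Lemma num_cells_ord p q (B : 'M[rat]_(p, q)) (i : 'I_p) (j : 'I_q) :
  num_cells B i j = (numq (B i j))%:~R.
Proof. by rewrite /num_cells !valK. Qed.

Lemma mul_den_int (h z : rat) : z \is a Num.int ->
  h * ((denq h)%:~R * z) \is a Num.int.
Proof. by move=> zi; rewrite mulrA -numqE rpredM ?intr_int. Qed.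

Lemma DE : D = (\prod_(i < m) \prod_(j < d) (denq (A i j))%:~R) *
  (\prod_(i < m) (denq (b i 0))%:~R) * (\prod_(j < d) (denq (x j 0))%:~R).
Proof.
rewrite /D /denominator /dprodX /dprodB /dprodA !big_mkord.
congr (_ * _ * _).
- apply: eq_bigr => i _; rewrite big_mkord; apply: eq_bigr => j _.
  exact: den_cells_ord.
- by apply: eq_bigr => i _; rewrite -den_cells_ord.
- by apply: eq_bigr => i _; rewrite -den_cells_ord.
Qed.

Let pi1 : (\prod_(i < m) \prod_(j < d) (denq (A i j))%:~R : rat) \is a Num.int.
Proof. by do 2!apply: rpred_prod => ? _; exact: intr_int. Qed.
Let pi2 : (\prod_(i < m) (denq (b i 0))%:~R : rat) \is a Num.int.
Proof. by apply: rpred_prod => ? _; exact: intr_int. Qed.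
Let pi3 : (\prod_(j < d) (denq (x j 0))%:~R : rat) \is a Num.int.
Proof. by apply: rpred_prod => ? _; exact: intr_int. Qed.

Lemma D_int : D \is a Num.int.
Proof. by rewrite DE !rpredM. Qed.

Lemma AD_int i j : A i j * D \is a Num.int.
Proof.
rewrite DE (bigD1 i) //= (bigD1 j) //= -!mulrA; apply: mul_den_int.
rewrite !rpredM //; first by apply: rpred_prod => ? _; exact: intr_int.
by do 2!apply: rpred_prod => ? _; exact: intr_int.
Qed.

Lemma bD_int i : b i 0 * D \is a Num.int.
Proof.
rewrite DE [X in _ * (X * _)]mulrC (bigD1 i) //= -!mulrA; apply: mul_den_int.
by rewrite !rpredM //; apply: rpred_prod => ? _; exact: intr_int.
Qed.

Lemma xD_int j : x j 0 * D \is a Num.int.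
Proof.
rewrite DE [X in _ * X]mulrC (bigD1 j) //= -!mulrA; apply: mul_den_int.
by rewrite !rpredM //; apply: rpred_prod => ? _; exact: intr_int.
Qed.

Lemma D_gt0 : 0 < D.
Proof.
have pos (h : rat) : (0 : rat) < (denq h)%:~R by rewrite ltr0z denq_gt0.
by rewrite DE !mulr_gt0 //; do ?[apply: prodr_gt0 => ? _|exact: pos].
Qed.

Let A1 := (D * D) *: A.
Let b1 := (D * D) *: b.

Lemma A_scaled_ord (i : 'I_m) (j : 'I_d) : A_scaled A b x i j = A1 i j.
Proof.
by rewrite /A_scaled /scaled num_cells_ord den_cells_ord divq_num_den mxE mulrC.
Qed.

Lemma b_scaled_ord (i : 'I_m) : b_scaled A b x i = b1 i 0.
Proof.
rewrite /b_scaled /scaled (num_cells_ord b i ord0) (den_cells_ord b i ord0).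
by rewrite divq_num_den mxE mulrC.
Qed.

Lemma x_entry_ord (j : 'I_d) : x_entry x j = x j 0.
Proof.
by rewrite /x_entry (num_cells_ord x j ord0) (den_cells_ord x j ord0) divq_num_den.
Qed.

Lemma slack_entry_ord (i : 'I_m) : slack_entry A b x i = b1 i 0 - (A1 *m x) i 0.
Proof.
rewrite /slack_entry /slack_partial b_scaled_ord big_mkord; congr (_ - _); rewrite [RHS]mxE.
by apply: eq_bigr => j _; rewrite A_scaled_ord x_entry_ord.
Qed.

Lemma A1_int i j : A1 i j \is a Num.int.
Proof. by rewrite mxE mulrC mulrA rpredM ?AD_int ?D_int. Qed.

Lemma b1_int i : b1 i 0 \is a Num.int.
Proof. by rewrite mxE mulrC mulrA rpredM ?bD_int ?D_int. Qed.

Lemma slack_entry_int (i : 'I_m) : slack_entry A b x i \is a Num.int.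
Proof.
rewrite slack_entry_ord rpredB ?b1_int // mxE rpred_sum // => j _; rewrite mxE.
have -> : D * D * A i j * x j 0 = (A i j * D) * (x j 0 * D) by ring.
by rewrite rpredM ?AD_int ?xD_int.
Qed.

Let AR : 'M[R]_(m, d) := ratr_mx R A1.
Let bR : 'cV[R]_m := ratr_mx R b1.
Let xR : 'cV[R]_d := ratr_mx R x.
Let GR : R := ratr (norm_total A b x).

Lemma ratr_slack i : slack AR bR xR i = ratr (slack_entry A b x i).
Proof.
by rewrite slack_entry_ord rmorphB /slack /AR /xR /ratr_mx -map_mxM /= !mxE.
Qed.

Lemma GR_E : GR = 1 + \sum_i \sum_j AR i j * AR i j + \sum_i bR i 0 * bR i 0.
Proof.
rewrite /GR /norm_total /normB /normA !rmorphD rmorph1 !rmorph_sum !big_mkord.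
congr (_ + _ + _).
  apply: eq_bigr => i _; rewrite big_mkord rmorph_sum; apply: eq_bigr => j _.
  by rewrite A_scaled_ord rmorphM !mxE.
by apply: eq_bigr => i _; rewrite b_scaled_ord rmorphM !mxE.
Qed.

Lemma AR_int i j : AR i j \is a Num.int.
Proof. by rewrite mxE ratr_int_num // A1_int. Qed.

Lemma bR_int i : bR i 0 \is a Num.int.
Proof. by rewrite mxE ratr_int_num // b1_int. Qed.

Lemma slackR_int i : slack AR bR xR i \is a Num.int.
Proof. by rewrite ratr_slack ratr_int_num // slack_entry_int. Qed.

Let sqA_ge0 : 0 <= \sum_i \sum_j AR i j * AR i j.
Proof. by do 2!apply: sumr_ge0 => ? _; rewrite -expr2 sqr_ge0. Qed.
Let sqb_ge0 : 0 <= \sum_i bR i 0 * bR i 0.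
Proof. by apply: sumr_ge0 => ? _; rewrite -expr2 sqr_ge0. Qed.

Lemma GR_int : GR \is a Num.int.
Proof.
rewrite GR_E !rpredD ?rpred1 //; last first.
  by apply: rpred_sum => i _; rewrite rpredM ?bR_int.
by do 2!apply: rpred_sum => ? _; rewrite rpredM ?AR_int.
Qed.

Lemma GR_ge1 : 1 <= GR.
Proof. by rewrite GR_E -addrA lerDl addr_ge0. Qed.

Lemma AR_G : \sum_i \sum_j `|AR i j| <= GR.
Proof.
rewrite GR_E; apply: le_trans (_ : \sum_i \sum_j AR i j * AR i j <= _).
  by do 2!apply: ler_sum => ? _; rewrite int_norm_le_sqr ?AR_int.
by rewrite -[leLHS]addr0 lerD // lerDr.
Qed.

Lemma bR_G : \sum_i `|bR i 0| <= GR.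
Proof.
rewrite GR_E; apply: le_trans (_ : \sum_i bR i 0 * bR i 0 <= _).
  by apply: ler_sum => ? _; rewrite int_norm_le_sqr ?bR_int.
by rewrite lerDr addr_ge0.
Qed.

Hypothesis feasible : polyhedron AR bR xR.

(** Feasibility of [xU] makes the slacks nonnegative, so a single comparison detects tightness. *)
Lemma tight_slack_entry (i : 'I_m) : (i \in tight AR bR xR) = (slack_entry A b x i <= 0).
Proof.
have s0 : 0 <= slack AR bR xR i by rewrite subr_ge0 feasible.
rewrite in_tight eq_sym -subr_eq0 -/(slack AR bR xR i).
rewrite -(@ler_rat R) rmorph0 -ratr_slack.
by rewrite eq_le s0 andbT.
Qed.

Lemma ratr_ratio : ratr (ratio_value A b x) = ratio d GR.
Proof.
rewrite /ratio_value div1r fmorphV !rmorphM /= !ratr_nat /far_value rmorphXn /=.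
by rewrite -/GR.
Qed.

Lemma ratr_tiny : ratr (tiny_value A b x) = tiny m d GR.
Proof. by rewrite /tiny_value rmorphXn /= ratr_ratio. Qed.

Lemma ratr_coef (i : 'I_m) : ratr (coef_entry A b x i) = rock_coef AR bR xR GR i 0.
Proof.
rewrite /coef_entry mxE tight_slack_entry; case: ifP => _; first exact: ratr_tiny.
by rewrite rmorphB rmorphXn /= ratr_ratio ratr_slack.
Qed.

Lemma ratr_row (j : 'I_d) : ratr (row_partial A b x m j) = extra_row AR bR xR 0 j.
Proof.
rewrite /row_partial rmorphN rmorph_sum big_mkord extra_rowE; congr (- _).
rewrite [RHS]big_mkcond; apply: eq_bigr => i _; rewrite -tight_slack_entry.
by case: ifP => _; rewrite ?rmorph0 // A_scaled_ord [RHS]mxE.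
Qed.

Lemma ratr_corner : ratr (corner_partial A b x m) = extra_coef AR bR xR GR.
Proof.
rewrite /corner_partial !rmorphD rmorph1 rmorph_sum big_mkord /far_value rmorphXn -/GR.
congr (_ + _); rewrite [RHS]big_mkcond; apply: eq_bigr => i _.
rewrite -tight_slack_entry; case: ifP => _; rewrite ?rmorph0 // rmorphB /= ratr_tiny.
by rewrite b_scaled_ord [in RHS]mxE.
Qed.

Let fA := finalA A b x.
Let fb := finalb A b x.

Definition out_mx : 'M[rat]_(m + 1, d) := \matrix_(i, j) fA i j.
Definition out_coef : 'cV[rat]_(m + 1) := \col_i fA i d.
Definition out_rhs : 'cV[rat]_(m + 1) := \col_i fb i.

Lemma fA_entry (i : 'I_m) (j : 'I_d) : fA i j = A1 i j.
Proof.
by rewrite /fA /finalA /outA ltn_eqF // /withrow ltn_eqF // A_scaled_ord.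
Qed.

Lemma fA_row (j : 'I_d) : fA m j = row_partial A b x m j.
Proof. by rewrite /fA /finalA /outA ltn_eqF // /withrow eqxx. Qed.

Lemma fA_coef (i : 'I_m) : fA i d = coef_entry A b x i.
Proof.
by rewrite /fA /finalA /outA eqxx ltn_eqF // ltn_eqF ?leqW // /part1 ltn_ord.
Qed.

Lemma fA_corner : fA m d = corner_partial A b x m.
Proof. by rewrite /fA /finalA /outA !eqxx. Qed.

Lemma fA_last_row (j : 'I_d) : fA m.+1 j = 0.
Proof.
by rewrite /fA /finalA /outA ltn_eqF // /withrow gtn_eqF // A_scaled_out1.
Qed.

Lemma fA_last : fA m.+1 d = -1.
Proof. by rewrite /fA /finalA /outA eqxx gtn_eqF // eqxx. Qed.

Lemma fb_entry (i : 'I_m) : fb i = b1 i 0.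
Proof. by rewrite /fb /finalb /upd1 ltn_eqF // b_scaled_ord. Qed.

Lemma fb_last : fb m = far_value A b x + 1.
Proof. by rewrite /fb /finalb /upd1 eqxx. Qed.

Lemma fb_base : fb m.+1 = 0.
Proof. by rewrite /fb /finalb /upd1 gtn_eqF // b_scaled_out. Qed.

Lemma ratr_out_mx : ratr_mx R out_mx = ext_mx AR bR xR.
Proof.
apply/matrixP => i j; rewrite [LHS]mxE [out_mx _ _]mxE.
case: (ext_cases i) => [[k ->]|->] /=.
  by rewrite fA_entry col_mxEu [RHS]mxE.
by rewrite addn0 fA_row ratr_row col_mxEd.
Qed.

Lemma ratr_out_coef : ratr_mx R out_coef = ext_coef AR bR xR GR.
Proof.
apply/colP => i; rewrite [LHS]mxE [out_coef _ _]mxE.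
case: (ext_cases i) => [[k ->]|->] /=.
  by rewrite fA_coef col_mxEu ratr_coef.
by rewrite addn0 fA_corner ratr_corner col_mxEd mxE eqxx mulr1n.
Qed.

Lemma ratr_out_rhs : ratr_mx R out_rhs = ext_rhs d bR GR.
Proof.
apply/colP => i; rewrite [LHS]mxE [out_rhs _ _]mxE.
case: (ext_cases i) => [[k ->]|->] /=.
  by rewrite fb_entry col_mxEu [RHS]mxE.
by rewrite addn0 fb_last rmorphD rmorph1 rmorphXn col_mxEd mxE eqxx mulr1n.
Qed.

Definition out_AQ : 'M[rat]_(m + 1 + 1, d + 1) := block_mx out_mx out_coef 0 (-1).
Definition out_bQ : 'cV[rat]_(m + 1 + 1) := col_mx out_rhs 0.

Lemma out_AQ_cells (i : 'I_(m + 1 + 1)) (j : 'I_(d + 1)) : fA i j = out_AQ i j.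
Proof.
rewrite /out_AQ; case: (split_ordP i) => i' ->; case: (split_ordP j) => j' -> /=.
- by rewrite block_mxEul mxE.
- by rewrite block_mxEur (ord1 j') addn0 mxE.
- by rewrite block_mxEdl (ord1 i') addn0 addn1 fA_last_row mxE.
- by rewrite block_mxEdr (ord1 i') (ord1 j') !addn0 addn1 fA_last !mxE.
Qed.

Lemma out_bQ_cells (i : 'I_(m + 1 + 1)) : fb i = out_bQ i 0.
Proof.
rewrite /out_bQ; case: (split_ordP i) => i' -> /=.
- by rewrite col_mxEu mxE.
- by rewrite col_mxEd (ord1 i') addn0 addn1 fb_base mxE.
Qed.

Lemma ratr_out_AQ : ratr_mx R out_AQ = rock_mx (ext_mx AR bR xR) (ext_coef AR bR xR GR).
Proof.
rewrite -ratr_out_mx -ratr_out_coef /ratr_mx /out_AQ map_block_mx /rock_mx.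
by rewrite map_mx0 map_mxN map_mx1.
Qed.

Lemma ratr_out_bQ : ratr_mx R out_bQ = rock_rhs (ext_rhs d bR GR).
Proof. by rewrite -ratr_out_rhs /ratr_mx /out_bQ map_col_mx map_mx0. Qed.

End Correctness.

Theorem theorem5p1 (R : realType) :
  exists (prog : cmd) (p : {poly {poly nat}}) (q : {poly nat}),
  forall (m d : nat) (A : 'M[rat]_(m, d)) (b : 'cV[rat]_m) (xU : 'cV[rat]_d),
  let P : set 'cV[R]_d := polyhedron (ratr_mx R A) (ratr_mx R b) in
  non_degenerate (ratr_mx R A) (ratr_mx R b) ->
  bounded_set P ->
  vertex P (ratr_mx R xU) ->
  exists (AQ : 'M[rat]_(m + 2, d + 1)) (bQ : 'cV[rat]_(m + 2)),
  let Q : set 'cV[R]_(d + 1) := polyhedron (ratr_mx R AQ) (ratr_mx R bQ) in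
  [/\ computes prog A b xU AQ bQ
        (p.[m%:P]).[d] q.[input_length A b xU],
      simple_polytope Q,
      rational_rock_extension P Q,
      [set F | facet Q F] #<= `I_(m + 2) &
      exists2 delta, is_diameter Q delta & (delta <= 2 * (m - d + 1))%N].
Proof.
have [p hp] := polyb2_total_cost.
(* Steps are bounded in terms of [m] and [d] alone. For bit operations, [m] and [d] are replaced by
   the input length and each step is charged the unit cost of the longest number. *)
have [q hq] := polybM polyb_total_cost (polyb_unit_cost polyb_len_max).
exists program, p, q => m d A b xU P nd bP vU.
have -> : (m + 2 = m + 1 + 1)%N by rewrite -addnA.
(* Scaling by the positive number [D * D] changes neither [P] nor the arrangement, and makes the
   system and the slacks at [xU] integral. *)
pose D := denominator A b xU.
pose AR := ratr_mx R ((D * D) *: A); pose bR := ratr_mx R ((D * D) *: b).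
have c0 : 0 < ratr (D * D) :> R by rewrite ltr0q mulr_gt0 ?D_gt0.
have eAR : AR = ratr (D * D) *: ratr_mx R A by rewrite /AR /ratr_mx map_mxZ.
have ebR : bR = ratr (D * D) *: ratr_mx R b by rewrite /bR /ratr_mx map_mxZ.
have eP : polyhedron AR bR = P by rewrite eAR ebR polyhedron_scale.
have nd' : non_degenerate AR bR by rewrite eAR ebR; apply: non_degenerate_scale.
have bP' : bounded_set (polyhedron AR bR) by rewrite eP.
have vU' : vertex (polyhedron AR bR) (ratr_mx R xU) by rewrite eP.
have fU : polyhedron AR bR (ratr_mx R xU) by have /vertexP [] := vU'.
have hAi := AR_int R A b xU; have hbi := bR_int R A b xU.
have hsi := slackR_int R A b xU.
have hG1 := GR_ge1 R A b xU; have hAG := AR_G R A b xU; have hbG := bR_G R A b xU.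
have hGi := GR_int R A b xU.
have [bQ [sQ fQ dQ]] := rock_exists hAi hbi hGi hG1 hAG hbG nd' vU'.
exists (out_AQ A b xU), (out_bQ A b xU) => Q.
have eQ : Q = polyhedron (rock_mx (ext_mx AR bR (ratr_mx R xU))
    (ext_coef AR bR (ratr_mx R xU) (ratr (norm_total A b xU))))
    (rock_rhs (ext_rhs d bR (ratr (norm_total A b xU)))).
  by rewrite /Q ratr_out_AQ // ratr_out_bQ.
split; rewrite ?eQ //.
  have [s [[t [w [ex ht hw]]] hA hb]] := run_program_bound A b xU.
  exists s, t, w; split=> //.
  - by move=> i j; rewrite hA out_AQ_cells.
  - by move=> i j; rewrite ord1 hb out_bQ_cells.
  - exact: leq_trans ht (hp m d).
  apply: leq_trans hw _; apply: leq_trans (hq _); rewrite leq_mul2r.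
  apply/orP; right; apply: leq_trans ht _.
  by apply: total_cost_mono; [exact: m_le|exact: d_le].
exists (m + 1)%N, (out_mx A b xU), (out_coef A b xU), (out_rhs A b xU); split.
- rewrite ratr_out_mx // ratr_out_rhs -eP; apply/esym.
  exact: ext_polyhedron hAi hG1 hAG hbG bP'.
- move=> i; rewrite -(ltr0q R).
  have := ext_coef_gt0 hsi hG1 hbG nd' vU' i.
  by rewrite -ratr_out_coef // mxE.
- by rewrite ratr_out_mx // ratr_out_coef // ratr_out_rhs -rock_mx_polyhedron.
- by rewrite -eQ in bQ *.
Qed.
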